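(* Let $A$ be a symmetric positive definite $s\times s$ matrix with $A_{j,k}>0$ for all $j,k$. If $\gamma_k>0$ for all $k=1,\dots,s$ and $$\lVert\sqrt\Gamma\,\mathcal A\sqrt\Gamma\rVert_2<4\,\frac{q-1}{q},$$ then, under the Gibbs measures $\mu_N$, as $N\to\infty$, $$\sqrt{\mathcal S}\,\big(m-\tfrac1q\mathbf 1_{sq}\big)\Rightarrow W,$$ where $W\sim\mathcal N(0,\Sigma)$ is an $sq$-dimensional centered Gaussian random vector with singular covariance matrix $$\Sigma=\big(\sqrt\Gamma\mathcal A\sqrt\Gamma\big)^{-1}\left(\Big(I_{sq}+\sqrt\Gamma\mathcal A\sqrt\Gamma\big(I_s\otimes(\tfrac1{q^2}\mathbf 1_{q\times q}-\tfrac1q I_q)\big)\Big)^{-1}-I_{sq}\right).$$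
   Context: Block Potts model. Fix integers $s\ge1$ (number of blocks) and $q\ge2$ (number of colors). For each $N\in\mathbb N$ the set $\{1,\dots,N\}$ is partitioned into $s$ non-empty blocks $S_1,\dots,S_s$ (depending on $N$), and the limits $\gamma_k=\lim_{N\to\infty}|S_k|/N$ are assumed to exist. $\mathbf 1_{d\times e}$ is the $d\times e$ all-ones matrix, $\mathbf 1_d=\mathbf 1_{d\times1}$, $I_d$ is the identity matrix, $\otimes$ is the Kronecker product, $e_k\in\mathbb R^s$, $e_c\in\mathbb R^q$ are standard unit vectors, $\lVert\cdot\rVert_2$ is the spectral norm. Let $A$ be the $s\times s$ interaction matrix, $S=\operatorname{diag}(|S_1|,\dots,|S_s|)$, $\mathcal S=S\otimes I_q$, $\mathcal A=A\otimes I_q$, $\Gamma=\lim_{N\to\infty}\mathcal S/N=\operatorname{diag}(\gamma)\otimes I_q$. For $\omega\in\{1,\dots,q\}^N$ the magnetization is the vector $m=m(\omega)\in\mathbb R^{sq}$ with components $m_{k,c}=(e_k\otimes e_c)^Tm=\frac1{|S_k|}\sum_{i\in S_k}\mathbf 1_{\{\omega_i=c\}}$. The Hamiltonian is $H_N(\omega)=-\frac1{2N}m^T\mathcal S\mathcal A\mathcal S m$ and the Gibbs measure on $\{1,\dots,q\}^N$ is $\mu_N(\omega)=\exp(-H_N(\omega))/\sum_{\omega'}\exp(-H_N(\omega'))$. The symbol $\Rightarrow$ denotes convergence in distribution (of the law under $\mu_N$) as $N\to\infty$. *)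

(* Defs.v *)
From HB Require Import structures.
From mathcomp Require Import all_boot all_order all_algebra.
From mathcomp Require Export mxtens.
From mathcomp Require Import all_classical all_reals all_analysis.
Import Order.TTheory GRing.Theory Num.Theory.
Import numFieldNormedType.Exports.

Set Implicit Arguments.
Unset Strict Implicit.
Unset Printing Implicit Defensive.

Local Open Scope classical_set_scope.
Local Open Scope ring_scope.

Section LinearAlgebra.
Context {R : realType}.

Definition posdefmx n (A : 'M[R]_n) : Prop :=
  forall x : 'cV[R]_n, x != 0 -> 0 < (x^T *m A *m x) 0 0.

Definition l2norm n (x : 'cV[R]_n) : R := Num.sqrt (\sum_i x i 0 ^+ 2).

Definition spectral_norm n (M : 'M[R]_n) : R :=
  sup [set l2norm (M *m x) | x in [set x : 'cV[R]_n | l2norm x <= 1]].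

(* The principal square root of a diagonal matrix with nonnegative entries;
   it is only ever applied to such matrices. *)
Definition diag_sqrt n (D : 'M[R]_n) : 'M[R]_n :=
  diag_mx (\row_i Num.sqrt (D i i)).

End LinearAlgebra.

Section Gaussian.
Context {R : realType} {d : measure_display} {T : measurableType d}.
Variable P : probability T R.

(* The degenerate case is split off because the library's [normal_prob m 0] is
   the uniform law on [0, 1] instead of the Dirac mass at m. *)
Definition univariate_normal (Y : T -> R) : Prop :=
  exists m sigma : R, 0 <= sigma /\
    forall B : set R, measurable B ->
      P (Y @^-1` B) = if sigma == 0 then \d_m B else normal_prob m sigma B.

Definition centered_gaussian n (W : 'I_n -> {RV P >-> R}) (Sigma : 'M[R]_n) :
    Prop :=
  [/\ forall t : 'I_n -> R,
        univariate_normal (fun w => \sum_i t i * W i w),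
      forall i, ('E_P[W i] = 0)%E
    & forall i j, covariance P (W i) (W j) = (Sigma i j)%:E].

End Gaussian.

(* Vectors and matrices of dimension s * q are indexed through
   [mxtens_index (k, c)], so that e_k (x) e_c is the basis vector with that
   index and [*t] is the Kronecker product. Blocks, colours and sites are
   numbered from 0. *)
Section BlockPotts.
Context {R : realType}.
Variables s q : nat.

Definition is_block_partition N (S : 'I_s -> {set 'I_N}) : Prop :=
  injective S /\ finset.partition (S @: finset.setTfor 'I_s)%SET
                                  (finset.setTfor 'I_N).

Definition lift_mx (A : 'M[R]_s) : 'M[R]_(s * q) := A *t (1%:M : 'M[R]_q).

Definition config N := {ffun 'I_N -> 'I_q}.

Section FixedN.
Variables (A : 'M[R]_s) (N : nat) (S : 'I_s -> {set 'I_N}).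

Definition size_mx : 'M[R]_(s * q) :=
  lift_mx (diag_mx (\row_k (#|S k|%:R : R))).

Definition magnetization (w : config N) : 'cV[R]_(s * q) :=
  \col_i let: (k, c) := mxtens_unindex i in
    (#|S k|%:R)^-1 * \sum_(j in S k) (w j == c)%:R.

Definition hamiltonian (w : config N) : R :=
  let m := magnetization w in
  - (2 * N%:R)^-1 *
    (m^T *m size_mx *m lift_mx A *m size_mx *m m) 0 0.

Definition gibbs (w : config N) : R :=
  expR (- hamiltonian w) / \sum_(w' : config N) expR (- hamiltonian w').

Definition gibbs_expectation (F : config N -> R) : R :=
  \sum_(w : config N) gibbs w * F w.

Definition scaled_magnetization (w : config N) : 'cV[R]_(s * q) :=
  diag_sqrt size_mx *m (magnetization w - const_mx (q%:R^-1)).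

End FixedN.

(* Convergence in distribution, under the Gibbs measures, of vectors X_N to the
   random vector W (given by its coordinates). *)
Definition gibbs_cvg_in_distribution (A : 'M[R]_s)
    (S : forall N, 'I_s -> {set 'I_N}) n (X : forall N, config N -> 'cV[R]_n)
    d (T : measurableType d) (P : probability T R) (W : 'I_n -> {RV P >-> R}) :
    Prop :=
  forall f : 'cV[R]_n -> R,
    continuous f -> (exists M : R, forall x, `|f x| <= M) ->
    (fun N => gibbs_expectation A (S N) (fun w => f (X N w))) @ \oo -->
      (\int[P]_w f (\col_i W i w))%R.

Section Limit.
Variables (A : 'M[R]_s) (gamma : 'I_s -> R).

Definition Gamma_mx : 'M[R]_(s * q) := lift_mx (diag_mx (\row_k gamma k)).

Definition coupling_mx : 'M[R]_(s * q) :=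
  diag_sqrt Gamma_mx *m lift_mx A *m diag_sqrt Gamma_mx.

Definition limit_cov : 'M[R]_(s * q) :=
  let J : 'M[R]_(s * q) :=
    (1%:M : 'M[R]_s) *t
      ((q%:R ^+ 2)^-1 *: const_mx 1 - q%:R^-1 *: 1%:M : 'M[R]_q) in
  invmx coupling_mx *m (invmx (1%:M + coupling_mx *m J) - 1%:M).

End Limit.
End BlockPotts.

(* Main.v *)
(* Write Y for the rescaled magnetization and K_N(i,j) for the entries of the
   coupling matrix with |S_k|/N in place of gamma_k, so that the Gibbs measure has
   density proportional to exp(Y^T K_N Y / 2) with respect to the uniform measure
   on configurations, and K_N tends to K.

   Tightness: a centered real function h on q colours satisfies
   mean(exp h) <= exp(q / (8 (q - 1)) |h|^2), so under the uniform measure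
   E exp(h.Y) <= exp(|h|^2 / (2 C)) with C = 4 (q - 1) / q. Linearizing the square
   in the exponent bounds E exp(b |Y|^2 / 2) for b < C, and |K| < C then bounds
   the second moments of Y under the Gibbs measure.

   Limit: recolouring one site at a time gives an approximate Stein identity
   E (t.Y) sin(u t.Y + phi) = u (t^T Sigma t) E cos(u t.Y + phi) + o(1), where
   Sigma = V (I - K V)^-1 and V is the covariance of Y without interaction. This is
   an approximate linear differential equation in u for E cos(u t.Y + phi), hence
   E cos(t.Y + phi) -> exp(-t^T Sigma t / 2) cos phi. A bounded continuous f is
   uniformly close on boxes to trigonometric polynomials with the same bound
   (Bernstein polynomials in the variables (1 + sin(x_i / 2M)) / 2), and the second
   moments control what happens outside the box. *)

Require Import Defs.
From HB Require Import structures.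
From mathcomp Require Import all_boot all_order all_algebra.
From mathcomp Require Import all_classical all_reals all_analysis.
From mathcomp Require Import measurable_realfun ring lra zify.
Import Order.TTheory GRing.Theory Num.Theory.
Import numFieldNormedType.Exports.

Set Implicit Arguments.
Unset Strict Implicit.
Unset Printing Implicit Defensive.

Local Open Scope classical_set_scope.
Local Open Scope ring_scope.

(** * Exponential moments *)

(** Two thresholds meet in the norm condition. Bounded second moments need |K| < C = 4 (q - 1) / q,
    while I - K V is invertible as soon as |K| < q. Since C <= q amounts to (q - 2)^2 >= 0,
    tightness is the binding constraint.

    The fluctuations of a block add up to 0 over the colours, so Y stays in a proper subspace and
    the limit has no density. Only the laws of the projections t.Y are handled: their cosines with
    an arbitrary phase act as a characteristic function, without complex numbers.

    Recolouring against t does not give a closed equation, because the weight contributes a term in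
    K Y. The identity is therefore applied in the direction r with (I - K V) r = t, where this term
    cancels; this is the origin of the inverse in Sigma. As r is chosen for the limit K, replacing
    K_N by K leaves an error linear in Y.

    One recolouring costs an error of order nu^2 (1 + |Y|^2), with nu = |S_k|^(-1/2). The squares
    nu^2 add up to s over all sites, and the further factor nu carried by each site makes the total
    of order N^(-1/2) once the second moment is bounded. *)

Lemma cvg_sumr {R : realType} (T : Type) (F : set_system T) {FF : Filter F}
    (I : Type) (r : seq I) (P : pred I) (f : I -> T -> R) (l : I -> R) :
  (forall i, f i @ F --> l i) ->
  (fun x => \sum_(i <- r | P i) f i x) @ F --> \sum_(i <- r | P i) l i.
Proof.
move=> h; elim: r => [|i r IH].
  by rewrite big_nil; under eq_fun do rewrite big_nil; exact: cvg_cst.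
rewrite big_cons; under eq_fun do rewrite big_cons.
by case: (P i) => //; apply: cvgD.
Qed.

(** * Sub-Gaussian bounds for a function of one uniform colour *)

Section SubGaussian.
Context {R : realType}.
Implicit Types (x y : R).

(** Hoeffding's lemma for two values. The gap [G] between the logarithms of the two sides vanishes
    at 0 together with [G'], and its second derivative is 1/4 - p (1 - p) >= 0, where [p y] is the
    weight [th] tilted by exp y. *)
Lemma expR_mix_le_pos (th x : R) : 0 <= th <= 1 -> 0 <= x ->
  th * expR x + (1 - th) <= expR (th * x + x ^+ 2 / 8).
Proof.
move=> /andP[th0 th1] x0.
pose Z y := th * expR y + (1 - th).
have Z0 y : 0 < Z y.
  rewrite /Z; have := expR_gt0 y; nra.
pose p y := th * expR y / Z y.
pose G y := th * y + y ^+ 2 / 8 - ln (Z y).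
pose G' y := th + y / 4 - p y.
have dZ y : is_derive y 1 Z (th * expR y).
  rewrite /Z; apply: is_derive_eq; rewrite /GRing.scale /=; ring.
have dG y : is_derive y 1 G (G' y).
  have d1 : is_derive y 1 (fun y => ln (Z y)) ((Z y)^-1 * (th * expR y)).
    exact: (is_derive1_comp (is_derive1_ln (Z0 y)) (dZ y)).
  rewrite /G; apply: is_derive_eq; rewrite /GRing.scale /= /G' /p; field.
  by rewrite gt_eqF.
have dG' y : is_derive y 1 G' (1 / 4 - p y * (1 - p y)).
  have d1 : is_derive y 1 (fun y => (Z y)^-1) (- (Z y) ^- 2 *: (th * expR y)).
    by apply: is_deriveV; rewrite gt_eqF.
  rewrite /G' /p; apply: is_derive_eq; rewrite /GRing.scale /=.
  have := Z0 y; rewrite /Z => Z0y; field; rewrite -/(Z y) gt_eqF //.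
have G0 : G 0 = 0.
  by rewrite /G /Z expR0 mulr1 (addrC th) subrK ln1; ring.
have G'0 : G' 0 = 0.
  by rewrite /G' /p /Z expR0; field; lra.
have cont (f df : R -> R) (a b : R) : (forall y, is_derive y 1 f (df y)) ->
    {within `[a, b], continuous f}.
  move=> d; apply: continuous_subspaceT => y.
  by apply: differentiable_continuous; apply/derivable1_diffP; apply: ex_derive.
have G'ge y : 0 <= y -> 0 <= G' y.
  move=> y0; have [c _] := MVT_segment y0 (fun z _ => dG' z) (cont _ _ _ _ dG').
  by rewrite G'0 !subr0 => ->; apply: mulr_ge0 => //; have := sqr_ge0 (p c - 1 / 2); rewrite expr2; lra.
have : 0 <= G x.
  have [c] := MVT_segment x0 (fun z _ => dG z) (cont _ _ _ _ dG).
  rewrite in_itv /= => /andP[/G'ge c0 _]; by rewrite G0 !subr0 => ->; rewrite mulr_ge0.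
rewrite /G subr_ge0 => h; rewrite -[leLHS](@lnK _ (Z x)) ?posrE //.
by rewrite ler_expR.
Qed.

Lemma expR_mix_le (th a b : R) : 0 <= th <= 1 ->
  th * expR a + (1 - th) * expR b
    <= expR (th * a + (1 - th) * b + (a - b) ^+ 2 / 8).
Proof.
move=> th01; wlog ab : th a b th01 / b <= a.
  move=> H; case/orP: (le_total a b) => ab; last exact: H.
  have := H (1 - th) b a; rewrite (_ : 1 - (1 - th) = th); last by ring.
  rewrite -(opprB a b) sqrrN (addrC ((1 - th) * b)) (addrC ((1 - th) * expR b)).
  by apply => //; lra.
have h := @expR_mix_le_pos th (a - b) th01; rewrite subr_ge0 in h.
have -> : th * expR a + (1 - th) * expR b =
    expR b * (th * expR (a - b) + (1 - th)).
  have -> : expR a = expR (a - b) * expR b by rewrite -expRD subrK.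
  by ring.
have -> : th * a + (1 - th) * b + (a - b) ^+ 2 / 8 =
    b + (th * (a - b) + (a - b) ^+ 2 / 8) by field.
by rewrite (expRD b) ler_pM2l ?expR_gt0 // h.
Qed.

(** Strict convexity: the mean value theorem on both sides of [y] would give two distinct points at
    which exp takes the same value [be]. *)
Lemma expR_affine_two_roots (al be x y z : R) :
  expR x = al + be * x -> expR y = al + be * y -> expR z = al + be * z ->
  x < y -> y < z -> False.
Proof.
move=> hx hy hz xy yz.
have cont (a b : R) : {within `[a, b], continuous (@expR R)}.
  by apply: continuous_subspaceT => u; exact: continuous_expR.
have [c cI] := MVT xy (fun u _ => is_derive_expR u) (cont _ _).
have [d dI] := MVT yz (fun u _ => is_derive_expR u) (cont _ _).
move: cI dI; rewrite !in_itv /= => /andP[_ cy] /andP[yd _].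
rewrite hx hy hz => e2 e1.
have : expR c < expR d by rewrite ltr_expR (lt_trans cy yd).
have : expR c = be by apply: (mulIf (_ : y - x != 0)); [rewrite gt_eqF ?subr_gt0|rewrite -e1; ring].
have : expR d = be by apply: (mulIf (_ : z - y != 0)); [rewrite gt_eqF ?subr_gt0|rewrite -e2; ring].
by move=> -> ->; rewrite ltxx.
Qed.

Lemma sum_two_valued q (h : 'I_q -> R) (a b : R) (G : R -> R) :
  (forall c, h c = a \/ h c = b) ->
  \sum_c G (h c) = #|[pred c | h c == a]|%:R * G a
                  + (q - #|[pred c | h c == a]|)%:R * G b.
Proof.
move=> hab; rewrite (bigID (fun c => h c == a)) /=; congr (_ + _).
  rewrite (eq_bigr (fun=> G a)) ?sumr_const; last by move=> c /eqP ->.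
  by rewrite mulr_natl; congr (_ *+ _); exact: eq_card.
rewrite (eq_bigr (fun=> G b)) ?sumr_const; last first.
  by move=> c; case: (hab c) => -> //; rewrite eqxx.
rewrite mulr_natl; congr (_ *+ _).
have := cardC [pred c | h c == a]; rewrite card_ord => /(canRL (addKn _)) <-.
exact: eq_card.
Qed.

(** Hoeffding's lemma gives the exponent (a - b)^2 / 8, which has to be compared with the sum of
    squares. If [a] is taken [k] times, q S - (q - 1) (a - b)^2 is the square of the sum of h plus
    (k - 1) (q - 1 - k) (a - b)^2. It vanishes for a centered h that singles out one colour, and
    this case fixes the constant q / (8 (q - 1)). *)
Lemma expR_mean_le_two_valued q (q2 : (2 <= q)%N) (h : 'I_q -> R) (a b : R) :
  (forall c, h c = a \/ h c = b) -> (exists c, h c = a) ->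
  (exists c, h c = b) -> a != b ->
  (\sum_c expR (h c)) / q%:R <=
  expR ((\sum_c h c) / q%:R + q%:R / (8 * (q%:R - 1)) * \sum_c h c ^+ 2).
Proof.
move=> hab [ca hca] [cb hcb] ab.
rewrite (sum_two_valued expR hab) (sum_two_valued id hab).
rewrite (sum_two_valued (fun x => x ^+ 2) hab).
set k := #|_|.
have k0 : (0 < k)%N by apply/card_gt0P; exists ca; rewrite inE hca.
have kq : (k < q)%N.
  rewrite -[ltnRHS](card_ord q); apply: proper_card.
  by apply/properP; split; [exact/fintype.subsetP|exists cb; rewrite ?inE // hcb eq_sym].
have q0 : 0 < q%:R :> R by rewrite ltr0n; lia.
rewrite (natrB _ (ltnW kq)).
have kR : 1 <= k%:R :> R by rewrite ler1n.
have kqR : k%:R <= q%:R - 1 :> R by rewrite -(natrB _ (_ : 1 <= q)%N) ?ler_nat; lia.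
have q2R : 2 <= q%:R :> R by rewrite (ler_nat R 2 q).
have th01 : 0 <= (k%:R / q%:R : R) <= 1.
  by rewrite divr_ge0 ?ler0n //= ler_pdivrMr // mul1r; lra.
have := expR_mix_le a b th01.
have -> : k%:R / q%:R * expR a + (1 - k%:R / q%:R) * expR b =
  (k%:R * expR a + (q%:R - k%:R) * expR b) / q%:R by field; rewrite gt_eqF.
move=> /le_trans; apply; rewrite ler_expR.
have -> : k%:R / q%:R * a + (1 - k%:R / q%:R) * b =
  (k%:R * a + (q%:R - k%:R) * b) / q%:R by field; rewrite gt_eqF.
rewrite lerD2l -mulrA.
have q1 : 0 < q%:R - 1 :> R by lra.
rewrite -subr_ge0.
set S := k%:R * _ + _.
have -> : q%:R * ((8 * (q%:R - 1))^-1 * S) - (a - b) ^+ 2 / 8 =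
  (q%:R * S - (q%:R - 1) * (a - b) ^+ 2) / (8 * (q%:R - 1)).
  by field; lra.
apply: divr_ge0; last lra.
have -> : q%:R * S - (q%:R - 1) * (a - b) ^+ 2 =
  (k%:R * a + (q%:R - k%:R) * b) ^+ 2 +
  (k%:R - 1) * (q%:R - 1 - k%:R) * (a - b) ^+ 2.
  by rewrite /S; ring.
by rewrite addr_ge0 ?sqr_ge0 // mulr_ge0 ?sqr_ge0 // mulr_ge0; lra.
Qed.

(* A minimiser of [kappa |h|^2 + mean h - ln (mean (exp h))] satisfies
   [exp (h c) = alpha + beta * h c] for every [c], hence takes at most two
   values by strict convexity, and the inequality is then Hoeffding's. *)
Lemma expR_mean_le_sqr q (q2 : (2 <= q)%N) (h : 'I_q -> R) :
  (\sum_c expR (h c)) / q%:R <=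
  expR ((\sum_c h c) / q%:R + q%:R / (8 * (q%:R - 1)) * \sum_c h c ^+ 2).
Proof.
have q2R : 2 <= q%:R :> R by rewrite (ler_nat R 2 q).
have q0 : 0 < q%:R :> R by lra.
set kappa : R := _ / (8 * _).
have kappa0 : 0 < kappa by rewrite divr_gt0 // mulr_gt0 //; lra.
pose Z (h : 'I_q -> R) := (\sum_c expR (h c)) / q%:R.
have Z0 h' : 0 < Z h'.
  rewrite /Z divr_gt0 //.
  rewrite (bigD1 (Ordinal (ltnW q2))) //= ltr_wpDr ?expR_gt0 //.
  by apply: sumr_ge0 => *; exact: expR_ge0.
pose G (h : 'I_q -> R) := kappa * (\sum_c h c ^+ 2) + (\sum_c h c) / q%:R - ln (Z h).
suff : 0 <= G h.
  rewrite /G subr_ge0 addrC => hh; rewrite -[leLHS](@lnK _ (Z h)) ?posrE //.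
  by rewrite ler_expR.
(* If the largest entry [m] is at least 2 / kappa, then kappa m^2 >= 2 m, while the mean is at least
   -m and the logarithm at most m. Hence a minimum over the compact cube of half-width 2 / kappa is
   all that is needed. *)
have Glarge h' c : (forall c', `|h' c'| <= `|h' c|) -> 2 / kappa <= `|h' c| -> 0 <= G h'.
  set m := `|h' c| => hm ml.
  have m0 : 0 <= m by exact: normr_ge0.
  have h1 : m ^+ 2 <= \sum_c h' c ^+ 2.
    rewrite (bigD1 c) //= /m real_normK ?num_real // lerDl.
    by apply: sumr_ge0 => *; exact: sqr_ge0.
  have hle c' : `|h' c'| <= m by exact: hm.
  have scst (x : R) : \sum_(c' < q) x = x * q%:R.
    by rewrite sumr_const card_ord mulr_natr.
  have h2 : - m <= (\sum_c h' c) / q%:R.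
    rewrite ler_pdivlMr // -scst; apply: ler_sum => c' _.
    by have := hle c'; rewrite ler_norml => /andP[].
  have h3 : ln (Z h') <= m.
    rewrite -[leRHS]expRK ler_ln ?posrE ?expR_gt0 // /Z ler_pdivrMr //.
    rewrite -scst; apply: ler_sum => c' _; rewrite ler_expR.
    by have := hle c'; rewrite ler_norml => /andP[].
  have h4 : 2 * m <= kappa * m ^+ 2.
    by rewrite expr2 mulrA ler_wpM2r // mulrC -ler_pdivrMr.
  by rewrite /G; have := ler_wpM2l (ltW kappa0) h1; lra.
pose M := 2 / kappa.
have M0 : 0 < M by rewrite divr_gt0.
pose A := [set v : 'rV[R]_q | forall c, `[(- M), M]%classic (v ord0 c)].
have cA : compact A.
  by apply: (@rV_compact R q (fun=> `[(- M), M]%classic)) => c; exact: segment_compact.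
have A0 : A !=set0 by exists 0 => c /=; rewrite mxE in_itv /=; apply/andP; split; lra.
have cG : {within A, continuous (fun v : 'rV[R]_q => G (v ord0))}.
  apply: continuous_subspaceT => v.
  have cc c : (fun v : 'rV[R]_q => v ord0 c) @ v --> v ord0 c.
    exact: coord_continuous.
  have csum (F : R -> R) : continuous F ->
      (fun v : 'rV[R]_q => \sum_c F (v ord0 c)) @ v --> \sum_c F (v ord0 c).
    move=> cF; apply: (@cvg_sumr R _ (nbhs v)) => c.
    by apply: continuous_cvg; [exact: cF|exact: cc].
  have FF : Filter (nbhs v) by exact: nbhs_filter.
  rewrite /continuous_at /G /Z.
  refine (@cvgB _ R^o _ (nbhs v) FF _ _ _ _ (@cvgD _ R^o _ (nbhs v) FF _ _ _ _ _ _) _).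
  - refine (@cvgM _ _ (nbhs v) FF _ _ _ _ _ _); [exact: cvg_cst|apply: (csum (fun x => x ^+ 2))].
    exact: exprn_continuous.
  - refine (@cvgM _ _ (nbhs v) FF _ _ _ _ _ _); [apply: (csum id) => x; exact: cvg_id|exact: cvg_cst].
  - apply: continuous_cvg; first exact/continuous_ln/Z0.
    by refine (@cvgM _ _ (nbhs v) FF _ _ _ _ _ _); [apply: csum; exact: continuous_expR|exact: cvg_cst].
have [v /set_mem Av vmin] := EVT_min_rV A0 cA cG.
have Gmin (h' : 'I_q -> R) : (forall c, - M <= h' c <= M) -> G (v ord0) <= G h'.
  move=> hM; have /vmin : (\row_c h' c) \in A.
    by apply/mem_set => c /=; rewrite mxE in_itv /=.
  by rewrite (_ : (\row_c h' c) ord0 = h') //; apply/funext => c; rewrite mxE.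
have Gmax (h' : 'I_q -> R) : exists c, forall c', `|h' c'| <= `|h' c|.
  pose c0 := Ordinal (ltnW q2).
  by exists [arg max_(c > c0) `|h' c|]%O => c'; case: arg_maxP => // c _; exact.
suff Gv : 0 <= G (v ord0).
  have [c hc] := Gmax h; have [/ltW hM|] := ltP `|h c| M; last exact: Glarge.
  apply: le_trans Gv _; apply: Gmin => c'; rewrite -ler_norml.
  exact: le_trans (hc c') hM.
have [c hc] := Gmax (v ord0).
have [vM|] := ltP `|v ord0 c| M; last exact: Glarge.
have vI c' : v ord0 c' \in `]-M, M[.
  by rewrite in_itv /= -ltr_norml; exact: le_lt_trans (hc c') vM.
clear Glarge Gmax A0 cA cG vmin hc vM c Av.
(* At an interior minimiser the derivative of [phi], which is [G] with only the coordinate [c]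
   moving, vanishes: 2 kappa t + 1/q = exp t / (q Z). Solved for exp t, this is affine in t with
   coefficients independent of [c]. *)
have vexp c : expR (v ord0 c) = Z (v ord0) + 2 * kappa * q%:R * Z (v ord0) * v ord0 c.
  pose S1 := \sum_(i < q | i != c) v ord0 i.
  pose S2 := \sum_(i < q | i != c) v ord0 i ^+ 2.
  pose S3 := \sum_(i < q | i != c) expR (v ord0 i).
  pose W t := (expR t + S3) / q%:R.
  pose phi t := kappa * (t ^+ 2 + S2) + (t + S1) / q%:R - ln (W t).
  pose up t := fun i => if i == c then t else v ord0 i.
  have upE t (F : R -> R) : \sum_i F (up t i) = F t + \sum_(i < q | i != c) F (v ord0 i).
    rewrite (bigD1 c) //= /up eqxx; congr (_ + _).
    by apply: eq_bigr => i /negbTE ->.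
  have phiE t : phi t = G (up t).
    by rewrite /G /Z /phi /W (upE t id) (upE t (@expR R)) (upE t (fun x => x ^+ 2)).
  have upv : up (v ord0 c) = v ord0.
    by apply/funext => i; rewrite /up; case: eqP => // ->.
  have ZE : W (v ord0 c) = Z (v ord0).
    by rewrite /W -(upE _ (@expR R)) upv.
  have W0 t : 0 < W t.
    by rewrite /W divr_gt0 // ltr_wpDr ?expR_gt0 // sumr_ge0 // => *; exact: expR_ge0.
  have dphi (t : R) : is_derive t 1 phi (2 * kappa * t + q%:R^-1 -
      (W t)^-1 * (expR t / q%:R)).
    have d0 : is_derive t 1 W (expR t / q%:R).
      by rewrite /W; apply: is_derive_eq; rewrite /GRing.scale /=; ring.
    have d1 : is_derive t 1 (fun t => ln (W t))
        ((W t)^-1 * (expR t / q%:R)).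
      exact: (is_derive1_comp (is_derive1_ln (W0 t)) d0).
    by rewrite /phi; apply: is_derive_eq; rewrite /GRing.scale /=; ring.
  have phimin t : t \in `]-M, M[ -> phi (v ord0 c) <= phi t.
    move=> tI; rewrite !phiE upv; apply: Gmin => i; rewrite /up.
    case: eqP => _; [move: tI|move: (vI i)]; rewrite in_itv /= => /andP[]; lra.
  have MM : - M <= M by lra.
  have := derive1_at_min MM (fun t _ => @ex_derive _ _ _ _ _ _ _ (dphi t)) (vI c) phimin.
  move=> d0; have := @derive_val _ _ _ _ _ _ _ (dphi (v ord0 c)).
  rewrite (@derive_val _ _ _ _ _ _ _ d0) ZE => /esym e.
  have Zn : Z (v ord0) != 0 by rewrite gt_eqF.
  have qn : q%:R != 0 :> R by rewrite gt_eqF.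
  have -> : expR (v ord0 c) = Z (v ord0) * q%:R * (2 * kappa * v ord0 c + q%:R^-1 -
     (2 * kappa * v ord0 c + q%:R^-1 - (Z (v ord0))^-1 * (expR (v ord0 c) / q%:R))).
    by field; rewrite Zn qn.
  by rewrite e; field.
have GE h' : 0 <= G h' <->
   Z h' <= expR ((\sum_c h' c) / q%:R + kappa * \sum_c h' c ^+ 2).
  by rewrite /G subr_ge0 -[in X in _ <-> X](@lnK _ (Z h')) ?posrE // ler_expR addrC.
pose c0 := Ordinal (ltnW q2).
(* A constant minimiser is treated apart, as the two-valued bound asks for two distinct values that
   are both attained. *)
have [vc|/existsNP[c1 /eqP c1n]] := pselect (forall c, v ord0 c = v ord0 c0).
  apply/GE; rewrite /Z.
  under eq_bigr do rewrite vc.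
  under [X in X / q%:R + _]eq_bigr do rewrite vc.
  have scst (x : R) : (\sum_(c' < q) x) / q%:R = x.
    by rewrite sumr_const card_ord -[x *+ q]mulr_natr mulfK // gt_eqF.
  rewrite !scst ler_expR lerDl.
  by rewrite mulr_ge0 ?(ltW kappa0) // sumr_ge0 // => *; exact: sqr_ge0.
apply/GE; apply: (expR_mean_le_two_valued q2 (a := v ord0 c1) (b := v ord0 c0)) => //; last 2 first.
- by exists c1.
- by exists c0.
move=> c; apply: contrapT => nn.
have tri x y z : expR x = Z (v ord0) + 2 * kappa * q%:R * Z (v ord0) * x ->
  expR y = Z (v ord0) + 2 * kappa * q%:R * Z (v ord0) * y ->
  expR z = Z (v ord0) + 2 * kappa * q%:R * Z (v ord0) * z ->
  x < y -> y < z -> False by apply: expR_affine_two_roots.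
have [l1|l1|e] := ltgtP (v ord0 c) (v ord0 c1); last by apply: nn; left.
all: have [l2|l2|e] := ltgtP (v ord0 c) (v ord0 c0); last by apply: nn; right.
all: have [l3|l3|e] := ltgtP (v ord0 c1) (v ord0 c0); try lra; try by rewrite e eqxx in c1n.
all: eauto using vexp.
Qed.
End SubGaussian.

Lemma sum_pairE (V : nmodType) (I J : finType) (F : I * J -> V) :
  \sum_i F i = \sum_i \sum_j F (i, j).
Proof. by rewrite (pair_bigA _ (fun i j => F (i, j))); apply: eq_bigr => -[]. Qed.

(** * Exponential moments of the fluctuations under the uniform measure *)

Section Configurations.
Context {R : realType}.
Variables (s q N : nat) (b : 'I_N -> 'I_s) (nu : 'I_s -> R).
Local Notation cfg := {ffun 'I_N -> 'I_q}.

Definition block_size (k : 'I_s) := #|[pred j | b j == k]|.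

(** For [nu k] = |S_k|^(-1/2) this is the coordinate (k, c) of the rescaled magnetization, written
    with a block map instead of sets and indexed by pairs. *)
Definition fluctuation (w : cfg) (i : 'I_s * 'I_q) : R :=
  nu i.1 * \sum_(j | b j == i.1) ((w j == i.2)%:R - q%:R^-1).

Lemma sum_blocks (V : nmodType) (G : 'I_s -> V) :
  \sum_j G (b j) = \sum_k G k *+ block_size k.
Proof.
rewrite (partition_big b xpredT) //=; apply: eq_bigr => k _.
by rewrite (eq_bigr (fun=> G k)) ?sumr_const // => j /eqP ->.
Qed.

(** Turns a linear form of the fluctuations into a sum over sites of centered functions of the
    colour at that site, which is what makes sums over configurations factorize. *)
Lemma fluctuation_dot (h : 'I_s * 'I_q -> R) (w : cfg) :
  \sum_i h i * fluctuation w i =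
  \sum_j nu (b j) * (h (b j, w j) - (\sum_c h (b j, c)) / q%:R).
Proof.
rewrite (partition_big b xpredT) //= sum_pairE.
apply: eq_bigr => k _; rewrite /fluctuation /=.
under eq_bigr do rewrite mulr_sumr mulr_sumr.
rewrite exchange_big /=; apply: eq_bigr => j /eqP <-.
rewrite mulrBr (bigD1 (w j)) //= eqxx.
rewrite (eq_bigr (fun c => - (nu (b j) / q%:R) * h (b j, c))); last first.
  by move=> c /negbTE; rewrite eq_sym => ->; rewrite sub0r; ring.
by rewrite [in RHS](bigD1 (w j)) //= -mulr_sumr; ring.
Qed.

Hypothesis nuE : forall k, (block_size k)%:R * nu k ^+ 2 = 1.

Lemma sum_blocks_nu (G : 'I_s -> R) :
  \sum_j nu (b j) ^+ 2 * G (b j) = \sum_k G k.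
Proof.
rewrite (sum_blocks (fun k => nu k ^+ 2 * G k)); apply: eq_bigr => k _.
by rewrite -mulr_natl mulrA nuE mul1r.
Qed.

(** Sites are independent under the uniform measure, so [expR_mean_le_sqr] is applied site by site.
    Centering [h] within a block only decreases its sum of squares, and [nuE] makes the sites of a
    block contribute that sum exactly once. *)
Lemma sum_expR_fluctuation_le (q2 : (2 <= q)%N) (h : 'I_s * 'I_q -> R) :
  \sum_(w : cfg) expR (\sum_i h i * fluctuation w i) <=
  q%:R ^+ N * expR (q%:R / (8 * (q%:R - 1)) * \sum_i h i ^+ 2).
Proof.
have q2R : 2 <= q%:R :> R by rewrite (ler_nat R 2 q).
set ka : R := _ / (8 * _).
have ka0 : 0 <= ka by rewrite divr_ge0 // mulr_ge0 //; lra.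
pose me k := (\sum_c h (k, c)) / q%:R.
pose F j c := expR (nu (b j) * (h (b j, c) - me (b j))).
under eq_bigr do rewrite fluctuation_dot expR_sum.
rewrite -(bigA_distr_bigA F).
have Fle j : \sum_c F j c <= q%:R * expR (ka * (nu (b j) ^+ 2 * \sum_c h (b j, c) ^+ 2)).
  have q0 : 0 < q%:R :> R by lra.
  rewrite mulrC -ler_pdivrMr //.
  apply: le_trans (expR_mean_le_sqr q2 (fun c => nu (b j) * (h (b j, c) - me (b j)))) _.
  have sme : \sum_c (h (b j, c) - me (b j)) = 0.
    rewrite sumrB sumr_const card_ord -[me _ *+ _]mulr_natr /me divfK ?subrr //.
    by rewrite gt_eqF.
  rewrite -mulr_sumr sme mulr0 mul0r add0r ler_expR ler_wpM2l //.
  under eq_bigr do rewrite exprMn.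
  rewrite -mulr_sumr ler_wpM2l ?sqr_ge0 //.
  rewrite -subr_ge0 -sumrB.
  rewrite (eq_bigr (fun c => me (b j) *+ 2 * (h (b j, c) - me (b j)) + me (b j) ^+ 2)).
    by rewrite big_split /= -mulr_sumr sme mulr0 add0r sumr_ge0 // => *; exact: sqr_ge0.
  by move=> c _; ring.
apply: (@le_trans _ _ (\prod_j (q%:R * expR (ka * (nu (b j) ^+ 2 * \sum_c h (b j, c) ^+ 2))))).
  by apply: ler_prod => j _; rewrite Fle sumr_ge0 // => *; exact: expR_ge0.
rewrite big_split /= prodr_const card_ord -expR_sum -mulr_sumr.
rewrite (sum_blocks_nu (fun k => \sum_c h (k, c) ^+ 2)).
by rewrite [in leRHS]sum_pairE.
Qed.
End Configurations.

(** * From linear to quadratic exponents *)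

Section ExponentialSquare.
Context {R : realType}.

(** The integers of absolute value below [M], with 0 listed twice; the repetition is harmless
    because sums over [j] only serve as upper bounds. *)
Definition signed_nat (M : nat) (j : bool * 'I_M) : R := (-1) ^+ j.1 * j.2%:R.

(* A discrete Hubbard-Stratonovich transform: the sum over [j] stands for the
   integral over the auxiliary Gaussian field. *)
Lemma expR_sqr_le_sum (M : nat) (be y : R) : 0 < be -> be * `|y| < M%:R ->
  expR (be / 2 * y ^+ 2) <=
  expR (2 * be)^-1 *
  \sum_(j : bool * 'I_M) expR (signed_nat j * y - signed_nat j ^+ 2 / (2 * be)).
Proof.
move=> be0 yM.
have x0 : 0 <= be * `|y| by rewrite mulr_ge0 // ltW.
(* A single term suffices, the one of be * y rounded towards 0. Completing the square leaves (1 -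
   (be |y| - m)^2) / (2 be) >= 0, whence the prefactor [expR (2 * be)^-1]. *)
pose m := Num.truncn (be * `|y|).
have /andP[m1 m2] : m%:R <= be * `|y| < m.+1%:R by apply: truncn_itv.
have mM : (m < M)%N by rewrite -(ltr_nat R); exact: le_lt_trans m1 yM.
pose j0 : bool * 'I_M := (y < 0, Ordinal mM).
have j0y : signed_nat j0 * y = m%:R * `|y|.
  rewrite /signed_nat /=; case: ltrP => y0; first by rewrite ltr0_norm // expr1; ring.
  by rewrite ger0_norm // expr0 mul1r.
have j02 : signed_nat j0 ^+ 2 = m%:R ^+ 2.
  by rewrite /signed_nat exprMn sqrr_sign mul1r.
rewrite (bigD1 j0) //= mulrDr ler_wpDr ?mulr_ge0 ?expR_ge0 //.
  by apply: sumr_ge0 => *; exact: expR_ge0.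
rewrite -expRD ler_expR j0y j02 -(real_normK (num_real y)) -subr_ge0.
have -> : (2 * be)^-1 + (m%:R * `|y| - m%:R ^+ 2 / (2 * be)) - be / 2 * `|y| ^+ 2
  = (1 - (be * `|y| - m%:R) ^+ 2) / (2 * be) by field; rewrite gt_eqF.
apply: divr_ge0; last by rewrite mulr_ge0 // ltW.
have : 0 <= be * `|y| - m%:R <= 1 by move: m2; rewrite -natr1; lra.
by move: (_ - m%:R) => z /andP[z0 z1]; rewrite subr_ge0 expr_le1.
Qed.

(** A natural number is at most its square, so each sign contributes at most a geometric series. The
    bound does not depend on [M]. *)
Lemma sum_expR_signed_sqr_le (M : nat) (a : R) : 0 < a ->
  \sum_(j : bool * 'I_M) expR (- a * signed_nat j ^+ 2) <= 2 / (1 - expR (- a)).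
Proof.
move=> a0; have e1 : expR (- a) < 1 by rewrite expR_lt1 oppr_lt0.
rewrite -(pair_bigA _ (fun b m => expR (- a * signed_nat (b, m) ^+ 2))) /=.
have geo : \sum_(m < M) expR (- a) ^+ m <= (1 - expR (- a))^-1.
  rewrite -[leRHS]mul1r ler_pdivlMr ?subr_gt0 // mulrC.
  by rewrite -opprB mulNr -subrX1 opprB gerBl exprn_ge0 ?expR_ge0.
have le1 b : \sum_(m < M) expR (- a * signed_nat (b, m) ^+ 2) <= (1 - expR (- a))^-1.
  apply: le_trans geo; apply: ler_sum => m _.
  rewrite -expRM_natl ler_expR /signed_nat /= exprMn sqrr_sign mul1r.
  rewrite mulNr mulrN lerN2 mulrC ler_pM2l //.
  rewrite -natrX ler_nat; case: (m : nat) => // k; rewrite expnS leq_pmulr //.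
rewrite big_bool /=; have := lerD (le1 true) (le1 false); rewrite mulr2n mulrDl !mul1r; exact.
Qed.

(** Each square is linearized separately. A choice [f] of one integer per coordinate gives a linear
    exponent, to which the hypothesis applies; its cost ka j^2 is beaten by the Gaussian factor exp
    (- j^2 / (2 be)) because 2 ka be < 1. The cut-off [M] depends on [Y] but drops out of the
    bound. *)
Lemma sum_expR_sqr_le (I O : finType) (Y : O -> I -> R) (B ka be : R) :
  0 < be -> 2 * ka * be < 1 -> 0 <= B ->
  (forall h : I -> R, \sum_w expR (\sum_i h i * Y w i)
     <= B * expR (ka * \sum_i h i ^+ 2)) ->
  \sum_w expR (be / 2 * \sum_i Y w i ^+ 2) <=
  B * (expR (2 * be)^-1 * (2 / (1 - expR (ka - (2 * be)^-1)))) ^+ #|I|.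
Proof.
move=> be0 kb B0 hY.
have [M hM] : exists M : nat, forall w i, be * `|Y w i| < M%:R.
  exists (Num.truncn (\sum_w \sum_i be * `|Y w i|)).+1 => w i.
  apply: le_lt_trans (truncnS_gt _).
  rewrite (bigD1 w) //= (bigD1 i) //= -addrA lerDl addr_ge0 //.
    by apply: sumr_ge0 => *; rewrite mulr_ge0 // ltW.
  by apply: sumr_ge0 => *; apply: sumr_ge0 => *; rewrite mulr_ge0 // ltW.
set c := expR (2 * be)^-1.
pose a := (2 * be)^-1 - ka.
have a0 : 0 < a.
  rewrite subr_gt0 -[(2 * be)^-1]mul1r ltr_pdivlMr ?mulr_gt0 //.
  by rewrite mulrA (mulrC ka).
pose e w i (j : bool * 'I_M) : R := signed_nat j * Y w i - signed_nat j ^+ 2 / (2 * be).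
have step1 w : expR (be / 2 * \sum_i Y w i ^+ 2) <=
    c ^+ #|I| * \sum_(f : {ffun I -> bool * 'I_M}) expR (\sum_i e w i (f i)).
  rewrite mulr_sumr expR_sum.
  have -> : c ^+ #|I| * \sum_(f : {ffun I -> bool * 'I_M}) expR (\sum_i e w i (f i))
    = \prod_i (c * \sum_j expR (e w i j)).
    rewrite big_split /= prodr_const bigA_distr_bigA /=; congr (_ * _).
    by apply: eq_bigr => f _; rewrite expR_sum.
  apply: ler_prod => i _; rewrite expR_ge0 /=; exact: expR_sqr_le_sum.
apply: le_trans (ler_sum _ (fun w _ => step1 w)) _.
rewrite -mulr_sumr exchange_big /= exprMn mulrCA ler_wpM2l ?exprn_ge0 ?expR_ge0 //.
have step2 (f : {ffun I -> bool * 'I_M}) :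
    \sum_w expR (\sum_i e w i (f i)) <=
    B * \prod_i expR (- a * signed_nat (f i) ^+ 2).
  rewrite (eq_bigr (fun w => expR (- (\sum_i signed_nat (f i) ^+ 2) / (2 * be)) *
     expR (\sum_i signed_nat (f i) * Y w i))); last first.
    move=> w _; rewrite -expRD /e sumrB addrC; congr expR; congr (_ + _).
    by rewrite mulNr -mulr_suml.
  rewrite -mulr_sumr -expR_sum -mulr_sumr.
  apply: le_trans (ler_wpM2l (expR_ge0 _) (hY (fun i => signed_nat (f i)))) _.
  rewrite mulrCA ler_wpM2l // -expRD le_eqVlt; apply/orP; left; apply/eqP.
  by congr expR; rewrite /a; field; rewrite gt_eqF.
apply: le_trans (ler_sum _ (fun f _ => step2 f)) _.
rewrite -mulr_sumr ler_wpM2l //.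
rewrite -(bigA_distr_bigA (fun _ j => expR (- a * signed_nat j ^+ 2))).
rewrite prodr_const; apply: lerXn2r; rewrite ?nnegrE.
- by apply: sumr_ge0 => *; exact: expR_ge0.
- by apply: divr_ge0 => //; rewrite subr_ge0 expR_le1 subr_le0 -subr_ge0 ltW.
- by rewrite (_ : ka - _ = - a) ?sum_expR_signed_sqr_le // /a opprB.
Qed.
End ExponentialSquare.

(** * A Stein identity for the Gibbs measure *)

Section Taylor.
Context {R : realType}.

Lemma MVT_abs (f df : R -> R) (x a : R) : (forall y : R, is_derive y 1 f (df y)) ->
  exists2 c, `|c - x| <= `|a| & f (x + a) - f x = df c * a.
Proof.
move=> d.
have cont (u v : R) : {within `[u, v], continuous f}.
  apply: continuous_subspaceT => y.
  by apply: differentiable_continuous; apply/derivable1_diffP; apply: ex_derive.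
have [a0|a0] := leP 0 a.
  have xa : x <= x + a by lra.
  have [c] := MVT_segment xa (fun y _ => d y) (cont _ _).
  rewrite in_itv /= => /andP[c1 c2] ->; exists c; last by congr (_ * _); lra.
  by rewrite !ger0_norm; lra.
have xa : x + a <= x by lra.
have [c] := MVT_segment xa (fun y _ => d y) (cont _ _).
rewrite in_itv /= => /andP[c1 c2] e; exists c; last by rewrite -opprB e; ring.
by rewrite ler0_norm ?ltr0_norm; lra.
Qed.

Lemma lipschitz_sin (x a : R) : `|sin (x + a) - sin x| <= `|a|.
Proof.
have [c _ ->] := MVT_abs x a (@is_derive_sin R).
by rewrite normrM ler_piMl // cos_max.
Qed.

Lemma lipschitz_cos (x a : R) : `|cos (x + a) - cos x| <= `|a|.
Proof.
have [c _ ->] := MVT_abs x a (@is_derive_cos R).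
by rewrite normrM normrN ler_piMl // sin_max.
Qed.

Lemma sin_taylor1 (x a : R) : `|sin (x + a) - sin x - a * cos x| <= a ^+ 2.
Proof.
have [c ca ->] := MVT_abs x a (@is_derive_sin R).
rewrite (_ : _ - _ = (cos (x + (c - x)) - cos x) * a); last first.
  by rewrite (addrC x) subrK; ring.
rewrite normrM -(real_normK (num_real a)) expr2 ler_wpM2r //.
exact: le_trans (lipschitz_cos _ _) ca.
Qed.

Lemma expR_taylor1 (a D : R) : `|a| <= D -> `|expR a - 1 - a| <= expR D * a ^+ 2.
Proof.
move=> aD; have [c ca] := MVT_abs 0 a (@is_derive_expR R).
rewrite add0r expR0 subr0 in ca * => ->.
have [c'] := MVT_abs 0 c (@is_derive_expR R).
rewrite add0r expR0 subr0 => c'c e.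
rewrite (_ : _ - _ = expR c' * (c * a)); last by rewrite mulrA -e; ring.
rewrite normrM (ger0_norm (expR_ge0 _)) ler_pM ?expR_ge0 //.
  rewrite ler_expR (le_trans (ler_norm _)) //.
  exact: le_trans c'c (le_trans ca aD).
by rewrite normrM -(real_normK (num_real a)) expr2 ler_wpM2r.
Qed.

(** Meant for the relative change of sin (theta) times the Gibbs weight under one recolouring: [al]
    is the increment of the angle, [de] that of the exponent and [de0] the part of [de] that is
    linear in the change of the fluctuations. *)
Lemma sin_expR_expansion (th al de de0 D : R) : `|de| <= D ->
  `|sin (th + al) * expR de - sin th - (al * cos th + de0 * sin th)|
    <= (expR D + 1) * de ^+ 2 + 2 * al ^+ 2 + `|de - de0|.
Proof.
move=> dD.
have -> : sin (th + al) * expR de - sin th - (al * cos th + de0 * sin th) =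
  sin (th + al) * (expR de - 1 - de) + (sin (th + al) - sin th - al * cos th)
  + de * (sin (th + al) - sin th) + (de - de0) * sin th by ring.
have h1 : `|sin (th + al) * (expR de - 1 - de)| <= expR D * de ^+ 2.
  rewrite normrM; apply: le_trans (expR_taylor1 dD).
  by rewrite ler_piMl // sin_max.
have h2 := sin_taylor1 th al.
have h3 : `|de * (sin (th + al) - sin th)| <= de ^+ 2 + al ^+ 2.
  rewrite normrM; have := lipschitz_sin th al => h.
  apply: le_trans (ler_wpM2l (normr_ge0 _) h) _.
  rewrite -(real_normK (num_real de)) -(real_normK (num_real al)).
  have := sqr_ge0 (`|de| - `|al|); have := sqr_ge0 (`|de| + `|al|); nra.
have h4 : `|(de - de0) * sin th| <= `|de - de0|.
  by rewrite normrM ler_piMr // sin_max.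
apply: le_trans (ler_normD _ _) _.
apply: le_trans (lerD (le_trans (ler_normD _ _) (lerD (ler_normD _ _) (lexx _))) (lexx _)) _.
lra.
Qed.

Lemma sqr_sum_le (I : finType) (x : I -> R) :
  (\sum_i x i) ^+ 2 <= #|I|%:R * \sum_i x i ^+ 2.
Proof.
have : 0 <= \sum_i \sum_j (x i - x j) ^+ 2.
  by apply: sumr_ge0 => i _; apply: sumr_ge0 => j _; exact: sqr_ge0.
suff -> : \sum_i \sum_j (x i - x j) ^+ 2 =
  2 * (#|I|%:R * \sum_i x i ^+ 2 - (\sum_i x i) ^+ 2) by lra.
rewrite (eq_bigr (fun i => #|I|%:R * x i ^+ 2 + \sum_j x j ^+ 2 - 2 * (\sum_j x j) * x i)).
  by rewrite sumrB big_split /= sumr_const -mulr_natl -!mulr_sumr; ring.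
move=> i _; rewrite (eq_bigr (fun j => x i ^+ 2 + x j ^+ 2 - 2 * x i * x j)).
  by rewrite sumrB big_split /= sumr_const -mulr_natl -!mulr_sumr; ring.
by move=> j _; ring.
Qed.
End Taylor.

Section QuadraticForm.
Context {R : realType} (I : finType) (K : I -> I -> R).

Definition matvec (x : I -> R) (i : I) : R := \sum_j K i j * x j.

Definition quad (x : I -> R) : R := \sum_i x i * matvec x i.

Hypothesis K_sym : forall i j, K i j = K j i.

Lemma quadB (x y : I -> R) :
  quad y - quad x = \sum_i matvec x i * (y i - x i) *+ 2
    + \sum_i (y i - x i) * matvec (fun j => y j - x j) i.
Proof.
have swap u v : \sum_i u i * matvec v i = \sum_i v i * matvec u i.
  rewrite /matvec; under eq_bigr do rewrite mulr_sumr.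
  rewrite exchange_big /=; apply: eq_bigr => j _; rewrite mulr_sumr.
  by apply: eq_bigr => i _; rewrite K_sym; ring.
have mvB u v i : matvec (fun j => u j - v j) i = matvec u i - matvec v i.
  by rewrite /matvec -sumrB; apply: eq_bigr => j _; rewrite mulrBr.
rewrite /quad -[RHS]big_split /=.
rewrite [RHS](eq_bigr (fun i => y i * matvec y i - x i * matvec x i
    + (y i * matvec x i - x i * matvec y i))).
  by rewrite big_split /= !sumrB (swap y x) subrr addr0.
by move=> i _; rewrite mvB; ring.
Qed.

End QuadraticForm.

Definition sqnorm {R : realType} (I : finType) (x : I -> R) := \sum_i x i ^+ 2.

(** This is q V r, where V is the covariance of the fluctuations without interaction. *)
Definition block_center {R : realType} s q (r : 'I_s * 'I_q -> R) i :=
  r i - (\sum_c r (i.1, c)) / q%:R.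

Lemma block_center_le {R : realType} s q (r : 'I_s * 'I_q -> R) (rb : R) i : (0 < q)%N ->
  (forall i, `|r i| <= rb) -> `|block_center r i| <= 2 * rb.
Proof.
move=> q0 r_le; have qR : 0 < q%:R :> R by rewrite ltr0n.
rewrite /block_center; apply: le_trans (ler_normB _ _) _.
rewrite mulr2n mulrDl mul1r lerD // normrM normfV (ger0_norm (ler0n _ q)).
rewrite ler_pdivrMr //; apply: le_trans (ler_norm_sum _ _ _) _.
apply: le_trans (ler_sum _ (fun c _ => r_le _)) _.
by rewrite sumr_const card_ord mulr_natr.
Qed.

(** * Changing the colour of one site *)

Section Resampling.
Context {R : realType}.
Variables (s q N : nat) (b : 'I_N -> 'I_s) (nu : 'I_s -> R).
Local Notation cfg := {ffun 'I_N -> 'I_q}.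
Local Notation Y := (fluctuation b nu).

Definition recolor (w : cfg) (j : 'I_N) (c : 'I_q) : cfg :=
  [ffun j' => if j' == j then c else w j'].

(** Exchanging the colour of site [j] with a spare colour is an involution of the pairs
    (configuration, colour). *)
Lemma sum_recolor (V : nmodType) (j : 'I_N) (G : cfg -> 'I_q -> V) :
  \sum_w \sum_c G (recolor w j c) (w j) = \sum_w \sum_c G w c.
Proof.
pose f (p : cfg * 'I_q) := (recolor p.1 j p.2, p.1 j).
have fK : involutive f.
  move=> [w c]; rewrite /f /=; congr (_, _); last by rewrite ffunE eqxx.
  by apply/ffunP => j'; rewrite !ffunE; case: eqP => // ->.
rewrite !(pair_bigA _ (fun w c => G _ _)) /= [in RHS](reindex_inj (inv_inj fK)).
by [].
Qed.

(** Integration by parts at one site: the exchange lets [rho] read the spare colour, which is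
    independent of [w], and as [rho] sums to 0 the value [F w] can be subtracted for free. *)
Lemma sum_centered_recolor (j : 'I_N) (rho : 'I_q -> R) (F : cfg -> R) :
  \sum_c rho c = 0 ->
  q%:R * \sum_(w : cfg) rho (w j) * F w =
  \sum_(w : cfg) \sum_c rho c * (F (recolor w j c) - F w).
Proof.
move=> rho0.
under [RHS]eq_bigr do (under eq_bigr do rewrite mulrBr).
under [RHS]eq_bigr do rewrite sumrB -mulr_suml rho0 mul0r subr0.
transitivity (\sum_(w : cfg) \sum_(c < q) rho (w j) * F w).
  by rewrite mulr_sumr; apply: eq_bigr => w _; rewrite sumr_const card_ord mulr_natl.
rewrite -(sum_recolor j (fun w _ => rho (w j) * F w)).
by apply: eq_bigr => w _; apply: eq_bigr => c _; rewrite ffunE eqxx.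
Qed.

Lemma fluctuation_recolor (h : 'I_s * 'I_q -> R) (w : cfg) j c :
  \sum_i h i * (Y (recolor w j c) i - Y w i) =
  nu (b j) * (h (b j, c) - h (b j, w j)).
Proof.
under eq_bigr do rewrite mulrBr.
rewrite sumrB !fluctuation_dot -sumrB (bigD1 j) //= [X in _ + X]big1 ?addr0.
  by rewrite ffunE eqxx; ring.
by move=> j' /negbTE jj'; rewrite ffunE jj' subrr.
Qed.

Variable K : 'I_s * 'I_q -> 'I_s * 'I_q -> R.
Hypothesis K_sym : forall i j, K i j = K j i.
Local Notation KY w := (matvec K (Y w)).
Local Notation weight w := (expR (quad K (Y w) / 2)).

Lemma quad_recolor (w : cfg) (j : 'I_N) (c : 'I_q) :
  let x := (b j, c) in let y := (b j, w j) in
  quad K (Y (recolor w j c)) - quad K (Y w) =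
  (nu (b j) * (KY w x - KY w y)) *+ 2
  + nu (b j) ^+ 2 * (K x x - K x y - K y x + K y y).
Proof.
move=> x y; rewrite quadB //; congr (_ + _).
  by rewrite sumrMnl fluctuation_recolor.
have mv i : matvec K (fun j0 => Y (recolor w j c) j0 - Y w j0) i =
    nu (b j) * (K i x - K i y).
  exact: fluctuation_recolor.
under eq_bigr do rewrite mulrC.
by rewrite (fluctuation_recolor (fun i => matvec K _ i)) !mv -/x -/y; ring.
Qed.

Hypothesis nu_gt0 : forall k, 0 < nu k.
Hypothesis nuE : forall k, (block_size b k)%:R * nu k ^+ 2 = 1.

Lemma fluctuation_le (w : cfg) i : `|Y w i| <= (nu i.1)^-1.
Proof.
have nu0 : nu i.1 != 0 by rewrite gt_eqF.
rewrite /fluctuation normrM (gtr0_norm (nu_gt0 _)).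
have -> : (nu i.1)^-1 = nu i.1 * (block_size b i.1)%:R.
  by apply: (mulfI nu0); rewrite divff // mulrA -expr2 mulrC nuE.
rewrite ler_pM2l //; apply: le_trans (ler_norm_sum _ _ _) _.
rewrite /block_size -sum1_card natr_sum; apply: ler_sum => j _.
have qV : 0 <= (q%:R^-1 : R) <= 1.
  rewrite invr_ge0 ler0n /=; case: (q) => [|n]; first by rewrite invr0.
  by rewrite invf_le1 ?ltr0n // ler1n.
by rewrite ler_norml; case: (w j == i.2) => /=; lra.
Qed.

Variables (kb L e : R).
Hypothesis K_le : forall i j, `|K i j| <= kb.
Hypothesis e1 : 0 < e <= 1.
Hypothesis nu_le : forall k, nu k <= e.
Hypothesis nu_ge : forall k, e <= L * nu k.

(** The crude bound |Y| <= 1 / nu <= L / e. It keeps the increment of the exponent under one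
    recolouring below a constant independent of N, so that the exponential in the Taylor remainder
    is harmless; the averaged estimates rest on [matvec_sqr_le] instead. *)
Lemma matvec_fluctuation_le (w : cfg) i : e * `|KY w i| <= kb * (s * q)%:R * L.
Proof.
have /andP[e0 _] := e1.
have kb0 : 0 <= kb by apply: le_trans (K_le i i); exact: normr_ge0.
rewrite /matvec; apply: (@le_trans _ _ (\sum_(j : 'I_s * 'I_q) kb * L)); last first.
  by rewrite sumr_const card_prod !card_ord -mulr_natr; lra.
rewrite mulrC; apply: le_trans (ler_wpM2r (ltW e0) (ler_norm_sum _ _ _)) _.
rewrite mulr_suml; apply: ler_sum => j _; rewrite normrM -mulrA.
apply: ler_pM => //; first by rewrite mulr_ge0 // ltW.
apply: le_trans (ler_wpM2r (ltW e0) (fluctuation_le w j)) _.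
by rewrite mulrC ler_pdivrMr.
Qed.

Lemma matvec_sqr_le (w : cfg) i :
  KY w i ^+ 2 <= (s * q)%:R * kb ^+ 2 * sqnorm (Y w).
Proof.
apply: le_trans (sqr_sum_le _) _; rewrite card_prod !card_ord -mulrA.
rewrite ler_wpM2l ?ler0n // mulr_sumr; apply: ler_sum => j _.
rewrite exprMn ler_wpM2r ?sqr_ge0 // -(real_normK (num_real (K i j))).
by rewrite ler_sqr ?nnegrE ?K_le // (le_trans _ (K_le i j)).
Qed.

Variables (t r : 'I_s * 'I_q -> R) (T rb u phi : R).
Hypothesis t_le : forall i, `|t i| <= T.
Hypothesis r_le : forall i, `|r i| <= rb.
Hypothesis u01 : 0 <= u <= 1.

Let theta (w : cfg) := u * (\sum_i t i * Y w i) + phi.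
Let F (w : cfg) := sin (theta w) * weight w.
(** The partial derivative of [F] in the coordinate [i] of the fluctuations, divided by the weight.
    The constant [D] bounds the increment of the exponent. *)
Let G (w : cfg) i := u * t i * cos (theta w) + KY w i * sin (theta w).
Let D := 2 * (kb * (s * q)%:R * L + kb).

(** Collects the errors of [sin_expR_expansion] per unit of nu^2 (1 + |Y|^2): the bound on the
    squared exponent increment, twice the bound 4 T^2 on the squared angle increment, and 2 kb for
    the quadratic part of the exponent. *)
Definition stein_remainder :=
  (expR D + 1) * (8 * (s * q)%:R * kb ^+ 2 + 8 * kb ^+ 2) + 8 * T ^+ 2 + 2 * kb.

Lemma stein_remainder_ge0 : 0 <= kb -> 0 <= stein_remainder.
Proof.
move=> kb0; have kb2 := sqr_ge0 kb; have T2 := sqr_ge0 T; have D0 := expR_ge0 D.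
have n0 : 0 <= (s * q)%:R * kb ^+ 2 by rewrite mulr_ge0 ?ler0n.
have : 0 <= (expR D + 1) * (8 * (s * q)%:R * kb ^+ 2 + 8 * kb ^+ 2).
  by apply: mulr_ge0; lra.
by rewrite /stein_remainder; lra.
Qed.

(** The moved coordinates change by [nu (b j)], so the first order term has one factor nu and the
    error has two. The second order part of the exponent comes from the four entries of [K] at the
    old and new colours. *)
Lemma recolor_expansion (w : cfg) (j : 'I_N) (c : 'I_q) :
  `|F (recolor w j c) - F w
      - weight w * (nu (b j) * (G w (b j, c) - G w (b j, w j)))|
  <= weight w * (nu (b j) ^+ 2 * stein_remainder * (1 + sqnorm (Y w))).
Proof.
have /andP[e0 e_le1] := e1.
set x := (b j, c); set y := (b j, w j); set v := nu (b j).
have v0 : 0 < v := nu_gt0 _.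
have ve : v <= e := nu_le _.
have kb0 : 0 <= kb by apply: le_trans (K_le x x); exact: normr_ge0.
have n20 : 0 <= sqnorm (Y w) by apply: sumr_ge0 => *; exact: sqr_ge0.
pose kk := K x x - K x y - K y x + K y y.
have kk4 : `|kk| <= 4 * kb.
  have := K_le x x; have := K_le x y; have := K_le y x; have := K_le y y.
  rewrite !ler_norml /kk => /andP[? ?] /andP[? ?] /andP[? ?] /andP[? ?]; lra.
pose al := u * (v * (t x - t y)).
pose de0 := v * (KY w x - KY w y).
pose de := de0 + v ^+ 2 * kk / 2.
have thE : theta (recolor w j c) = theta w + al.
  rewrite /theta /al -(fluctuation_recolor t w j c).
  have -> : \sum_i t i * (Y (recolor w j c) i - Y w i) =
      \sum_i t i * Y (recolor w j c) i - \sum_i t i * Y w i.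
    by rewrite -sumrB; apply: eq_bigr => i _; rewrite mulrBr.
  by ring.
have wE : weight (recolor w j c) = expR de * weight w.
  rewrite -expRD; congr expR.
  have := quad_recolor w j c => /= /(canRL (subrK _)) ->.
  by rewrite /de /de0 /kk -/x -/y -/v; field.
have v1 : v <= 1 by lra.
have v2 : v ^+ 2 <= 1 by rewrite expr_le1 // ltW.
have KYx z : `|v * KY w z| <= kb * (s * q)%:R * L.
  rewrite normrM (gtr0_norm v0); apply: le_trans (matvec_fluctuation_le w z).
  by rewrite ler_wpM2r.
have v2kk : `|v ^+ 2 * kk / 2| <= 2 * (v ^+ 2 * kb).
  rewrite -mulrA normrM (ger0_norm (sqr_ge0 v)) normrM normfV (ger0_norm (ler0n _ 2)).
  have := ler_wpM2l (sqr_ge0 v) kk4; lra.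
have deD : `|de| <= D.
  have := KYx x; have := KYx y; move: v2kk; rewrite /de /de0 /D !ler_norml.
  move=> /andP[? ?] /andP[? ?] /andP[? ?].
  have : v ^+ 2 * kb <= kb by rewrite ler_piMl.
  by rewrite mulrBr; lra.
have := sin_expR_expansion (theta w) al de0 deD.
rewrite /F thE wE.
have -> : sin (theta w + al) * (expR de * weight w) - sin (theta w) * weight w
   - weight w * (v * (G w x - G w y)) =
   weight w * (sin (theta w + al) * expR de - sin (theta w) -
     (al * cos (theta w) + de0 * sin (theta w))).
  by rewrite /G /al /de0; ring.
move=> h; rewrite normrM (gtr0_norm (expR_gt0 _)) ler_wpM2l ?expR_ge0 //.
apply: le_trans h _.
have hal : al ^+ 2 <= v ^+ 2 * (4 * T ^+ 2).
  have tt : (t x - t y) ^+ 2 <= 4 * T ^+ 2.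
    rewrite -(real_normK (num_real (t x - t y))) (_ : 4 * T ^+ 2 = (2 * T) ^+ 2); last by ring.
    have tT : `|t x - t y| <= 2 * T.
      by have := t_le x; have := t_le y; rewrite !ler_norml => /andP[? ?] /andP[? ?]; lra.
    by rewrite ler_sqr ?nnegrE // (le_trans _ tT).
  rewrite /al !exprMn; move/andP: u01 => [u0 u1].
  have u2 : u ^+ 2 <= 1 by rewrite expr_le1.
  apply: le_trans (_ : 1 * (v ^+ 2 * (t x - t y) ^+ 2) <= _).
    by rewrite ler_wpM2r // mulr_ge0 ?sqr_ge0.
  by rewrite mul1r ler_wpM2l ?sqr_ge0.
have hdd : `|de - de0| <= v ^+ 2 * (2 * kb) by rewrite /de addrC addKr; lra.
have hde : de ^+ 2 <= v ^+ 2 * (8 * (s * q)%:R * kb ^+ 2 * sqnorm (Y w) + 8 * kb ^+ 2).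
  have d2 : (v ^+ 2 * kk / 2) ^+ 2 <= v ^+ 2 * (4 * kb ^+ 2).
    have -> : (v ^+ 2 * kk / 2) ^+ 2 = v ^+ 2 * (v ^+ 2 * (kk / 2) ^+ 2) by ring.
    rewrite ler_wpM2l ?sqr_ge0 //.
    have k2 : (kk / 2) ^+ 2 <= 4 * kb ^+ 2.
      rewrite -(real_normK (num_real (kk / 2))) (_ : 4 * kb ^+ 2 = (2 * kb) ^+ 2); last by ring.
      have kk2 : `|kk / 2| <= 2 * kb.
        by rewrite normrM normfV (ger0_norm (ler0n _ 2)); lra.
      by rewrite ler_sqr ?nnegrE // (le_trans _ kk2).
    apply: le_trans k2; by rewrite ler_piMl ?sqr_ge0.
  have d0 : de0 ^+ 2 <= v ^+ 2 * (4 * (s * q)%:R * kb ^+ 2 * sqnorm (Y w)).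
    rewrite /de0 exprMn ler_wpM2l ?sqr_ge0 //.
    have := matvec_sqr_le w x; have := matvec_sqr_le w y.
    by have := sqr_ge0 (KY w x + KY w y); rewrite sqrrD sqrrB; lra.
  have := sqr_ge0 (de0 - v ^+ 2 * kk / 2); rewrite /de sqrrB sqrrD; lra.
have eD : 0 < expR D + 1 by have := expR_gt0 D; lra.
have := ler_wpM2l (ltW eD) hde.
rewrite /stein_remainder => h1.
set E := expR D + 1 in eD h1 *.
have q0 : 0 <= (s * q)%:R * kb ^+ 2 by rewrite mulr_ge0 ?ler0n ?sqr_ge0.
have k20 := sqr_ge0 kb; have T20 := sqr_ge0 T; have v20 := sqr_ge0 v.
apply: (@le_trans _ _ (E * (v ^+ 2 * (8 * (s * q)%:R * kb ^+ 2 * sqnorm (Y w) + 8 * kb ^+ 2))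
   + 2 * (v ^+ 2 * (4 * T ^+ 2)) + v ^+ 2 * (2 * kb))); first by lra.
rewrite -subr_ge0.
set n := (s * q)%:R in q0 *; set n2 := sqnorm _ in n20 *.
have -> : v ^+ 2 * (E * (8 * n * kb ^+ 2 + 8 * kb ^+ 2) + 8 * T ^+ 2 + 2 * kb) * (1 + n2) -
 (E * (v ^+ 2 * (8 * n * kb ^+ 2 * n2 + 8 * kb ^+ 2)) + 2 * (v ^+ 2 * (4 * T ^+ 2)) +
  v ^+ 2 * (2 * kb)) =
  v ^+ 2 * (E * (8 * (n * kb ^+ 2)) + (E * (8 * kb ^+ 2) + 8 * T ^+ 2 + 2 * kb) * n2) by ring.
have := mulr_ge0 (ltW eD) k20; have := mulr_ge0 (ltW eD) q0 => Eq Ek.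
by apply: mulr_ge0 => //; apply: addr_ge0; [lra|apply: mulr_ge0 => //; lra].
Qed.

(* Giving a site a new colour preserves the uniform measure, so each factor
   [rho (b j, w j)] turns into a difference of [F] along a recolouring, whose
   first order part is [G]. *)
Lemma stein_fluctuation : (0 < q)%N -> 0 <= kb -> 0 <= rb ->
  `|\sum_w (\sum_i r i * Y w i) * F w
      - q%:R^-1 * \sum_w weight w * \sum_i block_center r i * G w i|
  <= 2 * rb * s%:R * stein_remainder * e * \sum_w weight w * (1 + sqnorm (Y w)).
Proof.
move=> q0 kb0 rb0; set rho := block_center r.
have qR : 0 < q%:R :> R by rewrite ltr0n.
have rho_le i : `|rho i| <= 2 * rb by exact: block_center_le.
have rho0 k : \sum_c rho (k, c) = 0.
  rewrite /rho /block_center sumrB /= sumr_const card_ord -[_ *+ q]mulr_natr divfK ?subrr //.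
  by rewrite gt_eqF.
pose err w j c := F (recolor w j c) - F w
      - weight w * (nu (b j) * (G w (b j, c) - G w (b j, w j))).
have main : q%:R * \sum_w (\sum_i r i * Y w i) * F w -
    \sum_w weight w * \sum_i rho i * G w i =
    \sum_j nu (b j) * \sum_w \sum_c rho (b j, c) * err w j c.
  have -> : \sum_w (\sum_i r i * Y w i) * F w =
      \sum_j nu (b j) * \sum_(w : cfg) rho (b j, w j) * F w.
    under eq_bigr do rewrite fluctuation_dot mulr_suml.
    rewrite exchange_big /=; apply: eq_bigr => j _; rewrite mulr_sumr.
    by apply: eq_bigr => w _; rewrite /rho mulrA.
  (* The squares of nu add up to 1 over each block, so a sum over coordinates can be spread over the
     sites; the subtracted term in the old colour vanishes by [rho0]. *)
  have -> : \sum_w weight w * \sum_i rho i * G w i =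
      \sum_j nu (b j) * \sum_w \sum_c rho (b j, c) *
         (weight w * (nu (b j) * (G w (b j, c) - G w (b j, w j)))).
    rewrite (eq_bigr (fun w => \sum_j weight w * (nu (b j) ^+ 2 *
       \sum_c rho (b j, c) * G w (b j, c)))).
      rewrite exchange_big /=; apply: eq_bigr => j _; rewrite mulr_sumr.
      apply: eq_bigr => w _.
      rewrite [in RHS](eq_bigr (fun c => weight w * nu (b j) * (rho (b j, c) * G w (b j, c))
         - weight w * nu (b j) * G w (b j, w j) * rho (b j, c))).
        by rewrite sumrB -!mulr_sumr rho0; ring.
      by move=> c _; ring.
    move=> w _; rewrite -mulr_sumr sum_pairE.
    by rewrite (sum_blocks_nu nuE (fun k => \sum_c rho (k, c) * G w (k, c))).
  rewrite mulr_sumr -sumrB; apply: eq_bigr => j _.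
  rewrite mulrCA (sum_centered_recolor j F (rho0 (b j))) -mulrBr; congr (_ * _).
  rewrite -sumrB; apply: eq_bigr => w _; rewrite -sumrB; apply: eq_bigr => c _.
  by rewrite -mulrBr.
have C0 : 0 <= stein_remainder by exact: stein_remainder_ge0.
set S := \sum_w weight w * (1 + sqnorm (Y w)).
have S0 : 0 <= S.
  apply: sumr_ge0 => w _; rewrite mulr_ge0 ?expR_ge0 // addr_ge0 //.
  by apply: sumr_ge0 => *; exact: sqr_ge0.
set X := \sum_w _ * F w; set Z := \sum_w weight w * _.
have -> : X - q%:R^-1 * Z = q%:R^-1 * (q%:R * X - Z) by field; rewrite gt_eqF.
rewrite /X /Z main normrM normfV (gtr0_norm qR) mulrC ler_pdivrMr //.
have site j : `|\sum_w \sum_c rho (b j, c) * err w j c| <=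
    nu (b j) ^+ 2 * (q%:R * (2 * rb) * stein_remainder * S).
  apply: le_trans (ler_norm_sum _ _ _) _; rewrite /S 2!mulr_sumr.
  apply: ler_sum => w _; apply: le_trans (ler_norm_sum _ _ _) _.
  apply: (@le_trans _ _ (\sum_(c < q) 2 * rb * (weight w * (nu (b j) ^+ 2 * stein_remainder * (1 + sqnorm (Y w)))))).
    by apply: ler_sum => c _; rewrite normrM ler_pM //; exact: recolor_expansion.
  by rewrite sumr_const card_ord -[_ *+ q]mulr_natl; lra.
apply: le_trans (ler_norm_sum _ _ _) _.
apply: (@le_trans _ _ (\sum_j e * (nu (b j) ^+ 2 * (q%:R * (2 * rb) * stein_remainder * S)))).
  apply: ler_sum => j _; rewrite normrM (gtr0_norm (nu_gt0 _)) ler_pM //.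
  exact: ltW (nu_gt0 _).
rewrite -mulr_sumr; set M := _ * S.
rewrite (sum_blocks_nu nuE (fun=> M)) sumr_const card_ord -(mulr_natl M) /M.
by rewrite le_eqVlt; apply/orP; left; apply/eqP; ring.
Qed.

End Resampling.

(** * The differential equation of the Gaussian characteristic function *)

Section CharacteristicODE.
Context {R : realType}.

(** Multiply by the integrating factor exp (s2 u^2 / 2) and use the mean value theorem on [0, 1].
    The factor is largest at u = 1, where it is divided out again, so the error is not amplified. *)
Lemma gaussian_ode (a a' : R -> R) (s2 eps : R) : 0 <= s2 ->
  (forall u : R, is_derive u 1 a (a' u)) ->
  (forall u, 0 <= u <= 1 -> `|a' u + u * s2 * a u| <= eps) ->
  `|a 1 - expR (- (s2 / 2)) * a 0| <= eps.
Proof.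
move=> s20 da hle.
pose g u := expR (s2 * u ^+ 2 / 2).
have dg (u : R) : is_derive u 1 g (g u * (s2 * u)).
  have d0 : is_derive u 1 (fun u : R => s2 * u ^+ 2 / 2) (s2 * u).
    by apply: is_derive_eq; rewrite /GRing.scale /=; field.
  exact: (is_derive1_comp (is_derive_expR _) d0).
have df (u : R) : is_derive u 1 (fun u => g u * a u) (g u * (a' u + u * s2 * a u)).
  by apply: is_derive_eq; rewrite /GRing.scale /=; ring.
have cont : {within `[0, 1], continuous (fun u => g u * a u)}.
  apply: continuous_subspaceT => y.
  by apply: differentiable_continuous; apply/derivable1_diffP; apply: ex_derive.
have [c] := MVT_segment ler01 (fun y _ => df y) cont.
rewrite in_itv /= => c01; rewrite subr0 mulr1 => e.
have -> : a 1 - expR (- (s2 / 2)) * a 0 =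
    expR (- (s2 / 2)) * (g c * (a' c + c * s2 * a c)).
  rewrite -e /g expr0n /= mulr0 mul0r expR0 mul1r expr1n mulr1 mulrBr mulrA.
  by rewrite -expRD addNr expR0 mul1r.
rewrite normrM normrM !(ger0_norm (expR_ge0 _)) mulrA -expRD.
rewrite -[leRHS]mul1r ler_pM ?expR_ge0 ?hle //.
rewrite expR_le1 /g; have /andP[c0 c1] := c01.
have : s2 * c ^+ 2 <= s2 by rewrite ler_piMr // expr_le1.
lra.
Qed.

Lemma is_derive_sumr (I : Type) (l : seq I) (f : I -> R -> R) (df : I -> R) (x : R) :
  (forall i, is_derive x 1 (f i) (df i)) ->
  is_derive x 1 (fun u => \sum_(i <- l) f i u) (\sum_(i <- l) df i).
Proof.
move=> h; elim: l => [|i l IH].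
  by rewrite big_nil; under eq_fun do rewrite big_nil; exact: is_derive_cst.
rewrite big_cons; under eq_fun do rewrite big_cons.
exact: is_deriveD.
Qed.

End CharacteristicODE.

(** * Estimates at a fixed system size *)

Section SingleSize.
Context {R : realType}.
Variables (s q N : nat) (b : 'I_N -> 'I_s) (nu : 'I_s -> R).
Local Notation cfg := {ffun 'I_N -> 'I_q}.
Local Notation Y := (fluctuation b nu).
Variables K K0 : 'I_s * 'I_q -> 'I_s * 'I_q -> R.
Local Notation weight w := (expR (quad K (Y w) / 2)).

Definition gibbs_mean (F : cfg -> R) := (\sum_w weight w * F w) / \sum_w weight w.

Hypothesis q2 : (2 <= q)%N.
Hypothesis nuE : forall k, (block_size b k)%:R * nu k ^+ 2 = 1.
Variables be be' : R.
Hypothesis be_lt : 0 < be' < be.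
Hypothesis be_lt_crit : be < 4 * ((q%:R - 1) / q%:R).
Hypothesis K_psd : forall x, 0 <= quad K x.
Hypothesis K_le_be : forall x, quad K x <= be' * sqnorm x.

(* The first factor comes from
   [1 + y <= (1 + 2 / (be - be')) * expR ((be - be') / 2 * y)], the second one
   from [sum_expR_sqr_le]. *)
Definition moment_bound : R := (1 + 2 / (be - be')) *
  (expR (2 * be)^-1 * (2 / (1 - expR (q%:R / (8 * (q%:R - 1)) - (2 * be)^-1))))
   ^+ #|{: 'I_s * 'I_q}|.

(** Semidefiniteness of [K] makes every weight at least 1. This lower bound on the partition
    function absorbs the factor q^N of the exponential moments. *)
Lemma sum_weight_ge : q%:R ^+ N <= \sum_(w : cfg) weight w.
Proof.
have -> : q%:R ^+ N = \sum_(w : cfg) (1 : R).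
  by rewrite sumr_const card_ffun !card_ord natrX.
apply: ler_sum => w _; rewrite -[leLHS]expR0 ler_expR.
by rewrite divr_ge0.
Qed.

Lemma sum_weight_gt0 : 0 < \sum_(w : cfg) weight w.
Proof. by apply: lt_le_trans sum_weight_ge; rewrite exprn_gt0 // ltr0n ltnW. Qed.

Lemma sum_weight_moment_le :
  \sum_w weight w * (1 + sqnorm (Y w)) <= moment_bound * \sum_w weight w.
Proof.
have /andP[be'0 bb] := be_lt.
have be0 : 0 < be by lra.
have q2R : 2 <= q%:R :> R by rewrite (ler_nat R 2 q).
(* At be = 4 (q - 1) / q this product equals 1: the critical value in the theorem is the reciprocal
   of twice the one-site constant. *)
have kb : 2 * (q%:R / (8 * (q%:R - 1))) * be < 1.
  have : 2 * (q%:R / (8 * (q%:R - 1))) * be <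
     2 * (q%:R / (8 * (q%:R - 1))) * (4 * ((q%:R - 1) / q%:R)).
    by rewrite ltr_pM2l // mulr_gt0 // divr_gt0 ?mulr_gt0 //; lra.
  by rewrite (_ : _ * (4 * _) = 1) //; field; lra.
have qN0 : 0 <= q%:R ^+ N :> R by rewrite exprn_ge0.
have := sum_expR_sqr_le be0 kb qN0 (sum_expR_fluctuation_le nuE q2).
set Lam := _ ^+ #|_| => hsum.
have c0 : 0 < be - be' by lra.
have pt w : weight w * (1 + sqnorm (Y w)) <=
    (1 + 2 / (be - be')) * expR (be / 2 * sqnorm (Y w)).
  have n0 : 0 <= sqnorm (Y w) by apply: sumr_ge0 => *; exact: sqr_ge0.
  have h1 : weight w <= expR (be' / 2 * sqnorm (Y w)).
    by rewrite ler_expR; have := K_le_be (Y w); lra.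
  have h2 : 1 + sqnorm (Y w) <=
      (1 + 2 / (be - be')) * expR ((be - be') / 2 * sqnorm (Y w)).
    have := expR_ge1Dx ((be - be') / 2 * sqnorm (Y w)) => h.
    have z : 0 <= 2 / (be - be') by rewrite divr_ge0 // ltW.
    have := ler_wpM2l z h.
    have -> : 2 / (be - be') * (1 + (be - be') / 2 * sqnorm (Y w)) =
      2 / (be - be') + sqnorm (Y w) by field; lra.
    have : 0 <= (be - be') / 2 * sqnorm (Y w) by rewrite mulr_ge0 // divr_ge0 // ltW.
    by lra.
  apply: le_trans (ler_pM (expR_ge0 _) _ h1 h2) _; first by lra.
  by rewrite mulrCA -expRD -mulrDl -mulrDl (addrC be') subrK.
apply: le_trans (ler_sum _ (fun w _ => pt w)) _.
rewrite -mulr_sumr /moment_bound -mulrA ler_pM2l; last first.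
  by rewrite ltr_wpDr // divr_ge0 // ltW.
apply: le_trans hsum _; rewrite mulrC ler_wpM2l ?sum_weight_ge //.
rewrite exprn_ge0 // mulr_ge0 ?expR_ge0 // divr_ge0 // subr_ge0 expR_le1 subr_le0.
rewrite -[leRHS]mul1r ler_pdivlMr ?mulr_gt0 //; lra.
Qed.

Lemma gibbs_mean_moment_le : gibbs_mean (fun w => 1 + sqnorm (Y w)) <= moment_bound.
Proof. by rewrite /gibbs_mean ler_pdivrMr ?sum_weight_gt0 // sum_weight_moment_le. Qed.

Hypothesis K_sym : forall i j, K i j = K j i.
Hypothesis nu_gt0 : forall k, 0 < nu k.
Variables (kb L e ka : R).
Hypothesis kb_ge0 : 0 <= kb.
Hypothesis K_le : forall i j, `|K i j| <= kb.
Hypothesis e1 : 0 < e <= 1.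
Hypothesis nu_le : forall k, nu k <= e.
Hypothesis nu_ge : forall k, e <= L * nu k.
Hypothesis ka0 : 0 <= ka.
Hypothesis KK0 : forall i j, `|K i j - K0 i j| <= ka.

Variables (t r : 'I_s * 'I_q -> R) (T rb phi s2 : R).
Hypothesis t_le : forall i, `|t i| <= T.
Hypothesis r_le : forall i, `|r i| <= rb.
Hypothesis rb_ge0 : 0 <= rb.
Hypothesis rE : forall j, r j - q%:R^-1 * \sum_i block_center r i * K0 i j = t j.
Hypothesis s2_ge0 : 0 <= s2.
Hypothesis s2E : s2 = q%:R^-1 * \sum_i block_center r i * t i.

Let tau w := \sum_i t i * Y w i.

(** The Gibbs mean of cos (u tau + phi), as a function of u in [0, 1], satisfies the Gaussian
    equation up to two errors: the remainder of the Stein identity in the direction [r], and the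
    replacement of [K] by [K0], for which [r] was chosen. Both are linear in 1 + |Y|^2, hence the
    factor [moment_bound]. *)
Lemma gibbs_mean_cos_le :
  `|gibbs_mean (fun w => cos (tau w + phi)) - expR (- (s2 / 2)) * cos phi|
  <= (2 * rb * s%:R * stein_remainder s q kb L T * e
      + 2 * rb * (s * q)%:R ^+ 2 * ka) * moment_bound.
Proof.
set eps := _ * moment_bound.
set Z := \sum_(w : cfg) weight w.
have Z0 : 0 < Z by exact: sum_weight_gt0.
pose a u := gibbs_mean (fun w => cos (u * tau w + phi)).
pose a' u := - gibbs_mean (fun w => tau w * sin (u * tau w + phi)).
have da (u : R) : is_derive u 1 a (a' u).
  rewrite /a' /gibbs_mean -mulNr -sumrN.
  have d1 : is_derive u 1 (fun u => \sum_w weight w * cos (u * tau w + phi))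
      (\sum_w - (weight w * (tau w * sin (u * tau w + phi)))).
    apply: is_derive_sumr => w.
    have d2 : is_derive u 1 (fun u => u * tau w + phi) (tau w).
      by apply: is_derive_eq; rewrite /GRing.scale /=; ring.
    have d3 := is_derive1_comp (is_derive_cos _) d2.
    have d4 := is_deriveZ (weight w) d3.
    by apply: is_derive_eq d4 _; rewrite /GRing.scale /=; ring.
  have d5 := is_deriveZ Z^-1 d1.
  rewrite /a /gibbs_mean -/Z mulrC; under eq_fun do rewrite mulrC.
  exact: d5.
have := @gaussian_ode R a a' s2 eps s2_ge0 da.
have -> : a 1 = gibbs_mean (fun w => cos (tau w + phi)).
  by rewrite /a; congr gibbs_mean; apply/funext => w; rewrite mul1r.
have -> : a 0 = cos phi.
  rewrite /a /gibbs_mean; under eq_bigr do rewrite mul0r add0r.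
  by rewrite -mulr_suml mulrAC divff ?mul1r // gt_eqF.
apply=> u u01.
have q0 : (0 < q)%N by exact: ltnW q2.
have n0 w : 0 <= sqnorm (Y w) by apply: sumr_ge0 => *; exact: sqr_ge0.
have rho_le i := block_center_le i q0 r_le.
have := stein_fluctuation K_sym nu_gt0 nuE K_le e1 nu_le nu_ge phi t_le r_le u01 q0 kb_ge0 rb_ge0.
set X := \sum_w _; set W := \sum_w _; set S := \sum_w _ => hst.
pose E w := \sum_i block_center r i * \sum_j (K i j - K0 i j) * Y w j.
have key : a' u + u * s2 * a u =
  - (Z^-1 * ((X - q%:R^-1 * W) + q%:R^-1 * \sum_w weight w * sin (u * tau w + phi) * E w)).
  rewrite /a' /a /gibbs_mean -/Z.
  rewrite [X in _ = - (_ * X)](_ : _ = \sum_w weight w * (tau w * sin (u * tau w + phi))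
    - u * s2 * \sum_w weight w * cos (u * tau w + phi)); first by field; rewrite gt_eqF.
  rewrite /X /W !mulr_sumr -sumrB -big_split -sumrB /=; apply: eq_bigr => w _.
  rewrite -/(tau w).
  (* By [rE], the form r.Y is tau plus a term in K0 Y. That term cancels the K Y part of the Stein
     identity up to [E w], which only involves K - K0. *)
  have -> : \sum_i r i * Y w i = tau w + q%:R^-1 * \sum_i block_center r i * matvec K0 (Y w) i.
    rewrite /tau mulr_sumr; under [in RHS]eq_bigr do rewrite -rE mulrBl.
    rewrite sumrB -[LHS]addr0 -addrA; congr (_ + _).
    apply/eqP; rewrite eq_sym addrC subr_eq0; apply/eqP.
    under [RHS]eq_bigr do rewrite mulr_sumr mulr_suml.
    rewrite exchange_big /=; apply: eq_bigr => i _; rewrite /matvec mulrA mulr_sumr.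
    by apply: eq_bigr => j _; ring.
  have -> : E w = \sum_i block_center r i * matvec K (Y w) i
      - \sum_i block_center r i * matvec K0 (Y w) i.
    rewrite /E -sumrB; apply: eq_bigr => i _; rewrite -mulrBr /matvec -sumrB.
    by congr (_ * _); apply: eq_bigr => j _; rewrite mulrBl.
  have -> : \sum_i block_center r i * (u * t i * cos (u * tau w + phi) +
       matvec K (Y w) i * sin (u * tau w + phi)) =
     u * cos (u * tau w + phi) * (\sum_i block_center r i * t i) +
     sin (u * tau w + phi) * (\sum_i block_center r i * matvec K (Y w) i).
    by rewrite !mulr_sumr -big_split /=; apply: eq_bigr => i _; ring.
  by rewrite s2E; ring.
rewrite key normrN normrM normfV (gtr0_norm Z0) mulrC ler_pdivrMr //.
have hS : S <= moment_bound * Z := sum_weight_moment_le.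
have S0 : 0 <= S by apply: sumr_ge0 => w _; rewrite mulr_ge0 ?expR_ge0 // addr_ge0.
have hE w : `|E w| <= 2 * rb * (s * q)%:R ^+ 2 * ka * (1 + sqnorm (Y w)).
  have Yj j : `|Y w j| <= 1 + sqnorm (Y w).
    have : Y w j ^+ 2 <= sqnorm (Y w).
      by rewrite /sqnorm (bigD1 j) //= lerDl sumr_ge0 // => *; exact: sqr_ge0.
    have := sqr_ge0 (`|Y w j| - 1); rewrite -(real_normK (num_real (Y w j))); have := normr_ge0 (Y w j); nra.
  apply: le_trans (ler_norm_sum _ _ _) _.
  apply: (@le_trans _ _ (\sum_(i : 'I_s * 'I_q) 2 * rb * \sum_(j : 'I_s * 'I_q) ka * (1 + sqnorm (Y w)))).
    apply: ler_sum => i _; rewrite normrM ler_pM //.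
    apply: le_trans (ler_norm_sum _ _ _) _; apply: ler_sum => j _.
    by rewrite normrM ler_pM.
  set M := ka * _; rewrite !sumr_const card_prod !card_ord -(mulr_natl M) -mulr_natl /M.
  by rewrite le_eqVlt; apply/orP; left; apply/eqP; ring.
have hE2 : `|\sum_w weight w * sin (u * tau w + phi) * E w| <= 2 * rb * (s * q)%:R ^+ 2 * ka * S.
  apply: le_trans (ler_norm_sum _ _ _) _; rewrite /S mulr_sumr; apply: ler_sum => w _.
  rewrite !normrM (ger0_norm (expR_ge0 _)) mulrCA -mulrA ler_wpM2l ?expR_ge0 //.
  by rewrite -[leRHS]mul1r ler_pM // sin_max.
have qV : `|q%:R^-1 : R| <= 1.
  by rewrite normfV ger0_norm ?ler0n // invf_le1 ?ltr0n // ler1n.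
apply: le_trans (ler_normD _ _) _; rewrite normrM.
have h3 : `|q%:R^-1 : R| * `|\sum_w weight w * sin (u * tau w + phi) * E w| <=
   2 * rb * (s * q)%:R ^+ 2 * ka * S.
  by apply: le_trans hE2; rewrite ler_piMl.
apply: le_trans (lerD hst h3) _.
rewrite -mulrDl /eps -[leRHS]mulrA; apply: ler_wpM2l => //.
rewrite addr_ge0 // !mulr_ge0 ?exprn_ge0 ?ler0n // ?stein_remainder_ge0 //.
by have /andP[/ltW] := e1.
Qed.
End SingleSize.

(** * Gaussian vectors *)

Section AffineChange.
Context {R : realType}.
Local Notation mu := (@lebesgue_measure R).
Local Open Scope ereal_scope.
Variables (y c : R).
Hypothesis c0 : c != 0%R.

Let phi (x : measurableTypeR R) : measurableTypeR R := (y + c * x)%R.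

Let mphi : measurable_fun setT phi.
Proof.
by apply: measurable_funD => //; exact: measurable_funM.
Qed.

Let nu : {measure set (measurableTypeR R) -> \bar R} :=
  mscale (NngNum (normr_ge0 c))
    (measure_function_pushforward__canonical__measure_function_Measure mu mphi).

Lemma lebesgue_measure_affine (A : set R) : measurable A ->
  mu A = (`|c|)%:E * mu (phi @^-1` A).
Proof.
move=> mA.
apply: (@lebesgue_measure_unique R nu) => // _ [[a b]] _ <- /=.
suff : mu `]a, b]%classic = (`|c|)%:E * mu (phi @^-1` `]a, b]%classic) by [].
have -> : phi @^-1` `]a, b] =
   if (0 < c)%R then `]((a - y) / c)%R, ((b - y) / c)%R]%classic
   else `[((b - y) / c)%R, ((a - y) / c)%R[%classic.
  apply/seteqP; rewrite /phi; have [cp|cn] := ltrP 0%R c; split => x /=; rewrite !in_itv /=.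
  - by rewrite ltr_pdivrMr // ler_pdivlMr // => /andP[? ?]; apply/andP; split; lra.
  - by rewrite ltr_pdivrMr // ler_pdivlMr // => /andP[? ?]; apply/andP; split; lra.
  - have cn' : (c < 0)%R by rewrite lt_neqAle c0.
    by rewrite ltr_ndivlMr // ler_ndivrMr // => /andP[? ?]; apply/andP; split; lra.
  - have cn' : (c < 0)%R by rewrite lt_neqAle c0.
    by rewrite ltr_ndivlMr // ler_ndivrMr // => /andP[? ?]; apply/andP; split; lra.
rewrite lebesgue_measure_itv /= lte_fin.
have [cp|cp] := ltrP 0%R c; rewrite lebesgue_measure_itv /= lte_fin.
  rewrite ltr_pM2r ?invr_gt0 // ltrD2r; case: ifP => _; last by rewrite mule0.
  by rewrite -!EFinB -EFinM gtr0_norm //; congr EFin; field.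
have cn : (c < 0)%R by rewrite lt_neqAle c0.
rewrite ltr_nM2r ?invr_lt0 // ltrD2r; case: ifP => _; last by rewrite mule0.
by rewrite -!EFinB -EFinM ltr0_norm //; congr EFin; field.
Qed.

Lemma ge0_integral_affine (f : R -> \bar R) : measurable_fun setT f ->
  (forall x, 0 <= f x) ->
  \int[mu]_z f z = (`|c|)%:E * \int[mu]_x f (y + c * x)%R.
Proof.
move=> mf f0.
transitivity (\int[nu]_z f z).
  by apply: eq_measure_integral => A mA _; first [exact: lebesgue_measure_affine|exact/esym/lebesgue_measure_affine].
rewrite ge0_integral_mscale //; congr (_ * _).
by rewrite ge0_integral_pushforward.
Qed.

End AffineChange.

(** * Affine images and convolutions of normal laws *)

Section NormalProb.
Context {R : realType}.
Local Notation mu := (@lebesgue_measure R).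
Local Open Scope ereal_scope.

Lemma ge0_integral_normal_prob (m s : R) (f : R -> \bar R) :
  measurable_fun setT f -> (forall x, 0 <= f x) ->
  \int[normal_prob m s]_x f x = \int[mu]_x (f x * (normal_pdf m s x)%:E).
Proof.
move=> mf f0.
have dom := normal_prob_dominates m s.
rewrite -(Radon_Nikodym_SigmaFinite.change_of_variables dom) //.
apply: ae_eq_integral => //.
- apply: emeasurable_funM => //; apply: measurable_int.
  exact: Radon_Nikodym_SigmaFinite.f_integrable dom.
- apply: emeasurable_funM => //; apply/measurable_EFinP.
  exact: measurable_normal_pdf.
- apply: ae_eqe_mul2l; apply: integral_ae_eq => //.
  + exact: Radon_Nikodym_SigmaFinite.f_integrable dom.
  + by apply/measurable_EFinP; exact: measurable_normal_pdf.
  + by move=> E _ mE; rewrite -(Radon_Nikodym_SigmaFinite.f_integral dom).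
Qed.

Lemma normal_peakE (s : R) : (0 < s)%R ->
  normal_peak s = (s * Num.sqrt (pi *+ 2))^-1%R.
Proof.
move=> s0; rewrite /normal_peak -mulrnAr sqrtrM ?sqr_ge0 // sqrtr_sqr.
by rewrite gtr0_norm.
Qed.

Lemma normal_pdf_affine (y c x : R) : c != 0%R ->
  (`|c| * normal_pdf y `|c| (y + c * x) = normal_pdf 0 1 x)%R.
Proof.
move=> c0; have ac0 : (0 < `|c|)%R by rewrite normr_gt0.
rewrite !normal_pdfE ?normr_eq0 ?oner_eq0 // mulrA; congr (_ * _)%R.
  by rewrite !normal_peakE // invfM mulrA divff ?gt_eqF // mul1r mul1r.
rewrite /normal_fun; congr expR; rewrite subr0 addrAC subrr add0r expr1n.
rewrite real_normK ?num_real // exprMn -[(c ^+ 2 *+ 2)%R]mulr_natr.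
by field.
Qed.

Lemma normal_prob_affine (y c : R) (B : set R) : c != 0%R -> measurable B ->
  normal_prob 0 1 ((fun x => y + c * x)%R @^-1` B) = normal_prob y `|c| B.
Proof.
move=> c0 mB; rewrite /normal_prob.
have mr : measurable_fun setT ((fun x => (normal_pdf y `|c| x)%:E) \_ B).
  apply/(measurable_restrictT _ mB); apply: measurable_funTS.
  by apply/measurable_EFinP; exact: measurable_normal_pdf.
have r0 x : 0 <= ((fun x => (normal_pdf y `|c| x)%:E) \_ B) x.
  by rewrite patchE; case: ifP => // _; rewrite lee_fin normal_pdf_ge0.
rewrite [RHS]integral_mkcond (ge0_integral_affine y c0) //.
rewrite -ge0_integralZl //; last first.
  by apply: measurableT_comp => //; exact: measurable_funD.
rewrite [LHS]integral_mkcond; apply: eq_integral => x _.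
rewrite !patchE (_ : (x \in _ @^-1` B) = ((y + c * x)%R \in B)); last first.
  by apply/idP/idP; rewrite !inE.
by case: ifP => _; rewrite ?mule0 // -EFinM normal_pdf_affine.
Qed.

(** The joint density of a pair (v, z) factored in both orders: on the right, the law of z comes
    first and is followed by the conditional density of v given z, which integrates to 1 and leaves
    the convolution. *)
Lemma normal_pdf_conv (s t v z : R) : (0 < s)%R -> (0 < t)%R ->
  (normal_pdf 0 s v * normal_pdf v t z =
   normal_pdf 0 (Num.sqrt (s ^+ 2 + t ^+ 2)) z *
   normal_pdf (s ^+ 2 * z / (s ^+ 2 + t ^+ 2)) (s * t / Num.sqrt (s ^+ 2 + t ^+ 2)) v)%R.
Proof.
move=> s0 t0.
have h0 : (0 < s ^+ 2 + t ^+ 2)%R by rewrite addr_gt0 ?exprn_gt0.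
set h := (s ^+ 2 + t ^+ 2)%R in h0 *.
have r0 : (0 < Num.sqrt h)%R by rewrite sqrtr_gt0.
have r2 : (Num.sqrt h ^+ 2 = h)%R by rewrite sqr_sqrtr // ltW.
rewrite !normal_pdfE ?gt_eqF ?divr_gt0 ?mulr_gt0 // mulrACA [RHS]mulrACA.
congr (_ * _)%R.
  rewrite !normal_peakE ?divr_gt0 ?mulr_gt0 //.
  have p0 : (0 < Num.sqrt (pi *+ 2) :> R)%R by rewrite sqrtr_gt0 mulrn_wgt0 // pi_gt0.
  by field; rewrite !gt_eqF.
rewrite /normal_fun -!expRD; congr expR.
rewrite r2 (_ : (s * t / Num.sqrt h) ^+ 2 = s ^+ 2 * t ^+ 2 / h)%R; last first.
  by rewrite !exprMn exprVn r2.
rewrite /h; field; rewrite !gt_eqF //.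
Qed.

Lemma normal_pdf_centerE (m t x : R) : (0 < t)%R ->
  normal_pdf m t x = normal_pdf 0 t (x - m).
Proof.
by move=> t0; rewrite !normal_pdfE ?gt_eqF // normal_fun_center /= /normal_fun /= !subr0.
Qed.

Let measurable_kernel (t : R) (B : set R) : (0 < t)%R -> measurable B ->
  measurable_fun setT
    (fun p : R * R => (normal_pdf p.1 t p.2)%:E * (\1_B p.2)%:E).
Proof.
move=> t0 mB; apply: emeasurable_funM; apply/measurable_EFinP.
  under eq_fun do rewrite normal_pdf_centerE //.
  apply: (measurableT_comp (measurable_normal_pdf 0 t)).
  exact: measurable_funB.
exact: measurableT_comp.
Qed.

Let integral_kernel (t v : R) (B : set R) :
  \int[mu]_z ((normal_pdf v t z)%:E * (\1_B z)%:E) = normal_prob v t B.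
Proof.
rewrite /normal_prob [RHS]integral_mkcond; apply: eq_integral => z _.
by rewrite patchE indicE; case: ifP => _; rewrite ?mule1 ?mule0.
Qed.

Lemma measurable_normal_prob_mean (t : R) (B : set R) : (0 < t)%R ->
  measurable B -> measurable_fun setT (fun v => normal_prob v t B).
Proof.
move=> t0 mB; under eq_fun do rewrite -integral_kernel.
pose g (p : R * R) : \bar R := (normal_pdf p.1 t p.2)%:E * (\1_B p.2)%:E.
have mg : measurable_fun setT g by exact: measurable_kernel.
have g0 p : 0 <= g p by rewrite /g mule_ge0 // lee_fin normal_pdf_ge0.
exact: (@measurable_fun_fubini_tonelli_F _ _ _ _ _ mu g mg g0).
Qed.

Lemma normal_prob_conv (s t : R) (B : set R) : (0 < s)%R -> (0 < t)%R ->
  measurable B ->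
  \int[normal_prob 0 s]_v normal_prob v t B =
  normal_prob 0 (Num.sqrt (s ^+ 2 + t ^+ 2)) B.
Proof.
move=> s0 t0 mB; set u := Num.sqrt _.
pose g (p : R * R) : \bar R :=
  (normal_pdf 0 s p.1)%:E * ((normal_pdf p.1 t p.2)%:E * (\1_B p.2)%:E).
pose g' (p : R * R) : \bar R := (normal_pdf p.1 t p.2)%:E * (\1_B p.2)%:E.
have mg' : measurable_fun setT g' by exact: measurable_kernel.
have g'0 p : 0 <= g' p by rewrite /g' mule_ge0 // lee_fin normal_pdf_ge0.
have mg : measurable_fun setT g.
  apply: emeasurable_funM => //; apply/measurable_EFinP; apply: measurableT_comp => //.
  exact: measurable_normal_pdf.
have g0 p : 0 <= g p by apply: mule_ge0; [rewrite lee_fin normal_pdf_ge0|exact: g'0].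
have innerE v : \int[mu]_z g (v, z) = (normal_pdf 0 s v)%:E * normal_prob v t B.
  rewrite /g /= ge0_integralZl //; first last.
  - by rewrite lee_fin normal_pdf_ge0.
  - by move=> z _; rewrite mule_ge0 // lee_fin normal_pdf_ge0.
  - apply: emeasurable_funM; apply/measurable_EFinP => //.
    exact: measurable_normal_pdf.
  by rewrite -integral_kernel.
have mF := measurable_normal_prob_mean t0 mB.
rewrite ge0_integral_normal_prob //.
under eq_integral do rewrite muleC -innerE.
transitivity (\int[mu]_z \int[mu]_v g (v, z)).
  exact: (@fubini_tonelli _ _ _ _ _ mu mu).
rewrite /normal_prob [RHS]integral_mkcond; apply: eq_integral => z _.
rewrite /g /= patchE indicE; case: ifP => zB; last first.
  by under eq_integral do rewrite !mule0; rewrite integral0.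
under eq_integral do rewrite mule1 -EFinM normal_pdf_conv // EFinM.
rewrite ge0_integralZl //; first last.
- by rewrite lee_fin normal_pdf_ge0.
- by move=> v _; rewrite lee_fin normal_pdf_ge0.
- by apply/measurable_EFinP; exact: measurable_normal_pdf.
by rewrite integral_normal_pdf mule1.
Qed.
End NormalProb.

(** * Independent standard normal variables *)

Section StandardNormals.
Context {R : realType}.
Local Open Scope ereal_scope.

Definition centered_normal_law (s : R) (B : set R) : \bar R :=
  if s == 0%R then \d_(0%R : R) B else normal_prob 0 s B.

(** Given the first factor, the sum is normal with mean [Y], and averaging over [Y] is a
    convolution. The cases c = 0 and s = 0 are separate because one of the two laws is then a Dirac
    mass. *)
Lemma centered_normal_law_prod d (T : measurableType d) (P : probability T R)
    (Y : T -> R) (s c : R) : measurable_fun setT Y -> (0 <= s)%R ->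
  (forall B, measurable B -> P (Y @^-1` B) = centered_normal_law s B) ->
  forall B, measurable B ->
  (P \x normal_prob 0 1) ((fun p : T * R => Y p.1 + c * p.2)%R @^-1` B) =
  centered_normal_law (Num.sqrt (s ^+ 2 + c ^+ 2)) B.
Proof.
move=> mY s0 lY B mB.
rewrite /product_measure1 /=.
have -> : \int[P]_x (normal_prob 0 1 \o xsection ((fun p : T * R => Y p.1 + c * p.2)%R @^-1` B)) x =
  \int[P]_x normal_prob 0 1 ((fun z => Y x + c * z)%R @^-1` B).
  apply: eq_integral => x _ /=; congr (normal_prob 0 1 _).
  by apply/seteqP; split => z /=; rewrite /xsection /= inE.
have mYB : measurable (Y @^-1` B) by rewrite -[X in measurable X]setTI; exact: mY.
have [->|c0] := eqVneq c 0%R.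
  rewrite expr0n addr0 sqrtr_sqr ger0_norm // -lY // -[P _]/(P _).
  rewrite -[in RHS](setIT (Y @^-1` B)) -integral_indic //.
  apply: eq_integral => x _; rewrite indicE.
  have [xB|xB] := boolP (x \in Y @^-1` B).
    rewrite -[RHS](@probability_setT _ _ R (normal_prob 0 1)); congr (normal_prob 0 1 _).
    by apply/seteqP; split => z //=; move: xB; rewrite inE mul0r addr0.
  rewrite -[RHS](@measure0 _ _ _ (normal_prob 0 1)); congr (normal_prob 0 1 _).
  by apply/seteqP; split => z //=; move/negP: xB; rewrite inE mul0r addr0.
under eq_integral do rewrite normal_prob_affine //.
have ac0 : (0 < `|c|)%R by rewrite normr_gt0.
have mN := measurable_normal_prob_mean ac0 mB.
have mY' : measurable_fun setT (Y : T -> measurableTypeR R) by exact: mY.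
have e : \int[P]_x normal_prob (Y x) `|c| B =
  \int[measure_function_pushforward__canonical__measure_function_Measure P mY']_v
     normal_prob v `|c| B.
  by rewrite [RHS]ge0_integral_pushforward.
rewrite e; have [s_eq0|sn0] := eqVneq s 0%R.
  rewrite (eq_measure_integral (dirac (0%R : measurableTypeR R))); last first.
    by move=> A mA _; rewrite /= -[LHS]/(P (Y @^-1` A)) lY // /centered_normal_law s_eq0 eqxx.
  rewrite integral_dirac // diracT mul1e s_eq0 expr0n add0r sqrtr_sqr.
  by rewrite /centered_normal_law normr_eq0 (negbTE c0).
have sp : (0 < s)%R by rewrite lt_neqAle eq_sym sn0.
transitivity (\int[normal_prob 0 s]_v normal_prob v `|c| B).
  apply: eq_measure_integral.
  by move=> A mA _; rewrite /= -[LHS]/(P (Y @^-1` A)) lY // /centered_normal_law (negbTE sn0).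
rewrite normal_prob_conv // real_normK ?num_real // /centered_normal_law.
by rewrite gt_eqF // sqrtr_gt0 ltr_wpDl ?sqr_ge0 // exprn_even_gt0.
Qed.

(** Independence is recorded only through the laws of all linear combinations. This form passes
    through the induction, which multiplies the space by one more standard normal line, and is what
    Gaussian vectors require. *)
Lemma iid_standard_normal_exists n :
  exists (d : measure_display) (T : measurableType d) (P : probability T R)
    (g : 'I_n -> T -> R),
    (forall i, measurable_fun setT (g i)) /\
    forall (a : 'I_n -> R) (B : set R), measurable B ->
      P ((fun w => \sum_i a i * g i w)%R @^-1` B) =
      centered_normal_law (Num.sqrt (\sum_i a i ^+ 2)) B.
Proof.
elim: n => [|n [d [T [P [g [mg lg]]]]]].
  exists _, (measurableTypeR R), (normal_prob 0 1), (fun _ _ => 0%R); split => [[]//|a B mB].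
  under eq_fun do rewrite big_ord0.
  rewrite big_ord0 sqrtr0 /centered_normal_law eqxx diracE.
  have [xB|xB] := boolP (0%R \in B).
    rewrite -[RHS](@probability_setT _ _ R (normal_prob 0 1)); congr (normal_prob 0 1 _).
    by apply/seteqP; split => z //=; move: xB; rewrite inE.
  rewrite -[RHS](@measure0 _ _ _ (normal_prob 0 1)); congr (normal_prob 0 1 _).
  by apply/seteqP; split => z //=; move/negP: xB; rewrite inE.
pose g' (i : 'I_n.+1) (p : T * R) : R :=
  if unlift ord_max i is Some j then g j p.1 else p.2.
exists _, (T * measurableTypeR R)%type, (P \x normal_prob 0 1), g'; split => [i|a B mB].
  rewrite /g'; case: (unlift ord_max i) => [j|] //.
    exact: measurableT_comp.
  exact: measurable_snd.
have -> : (fun w => \sum_i a i * g' i w)%R =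
    (fun p : T * R => \sum_(i < n) a (lift ord_max i) * g i p.1 + a ord_max * p.2)%R.
  apply/funext => p; rewrite big_ord_recr /=; congr (_ + _)%R.
    apply: eq_bigr => i _; have -> : widen_ord (leqnSn n) i = lift ord_max i.
      by apply/val_inj; rewrite /= /bump leqNgt ltn_ord.
    by rewrite /g' liftK.
  by rewrite /g' unlift_none.
have mS : measurable_fun setT (fun w => \sum_(i < n) a (lift ord_max i) * g i w)%R.
  by apply: measurable_sum => i; exact: measurable_funM.
apply: etrans (centered_normal_law_prod (a ord_max) mS (sqrtr_ge0 _)
  (lg (fun i => a (lift ord_max i))) mB) _.
rewrite sqr_sqrtr; last by apply: sumr_ge0 => *; exact: sqr_ge0.
rewrite [in RHS]big_ord_recr /=; congr (centered_normal_law (Num.sqrt (_ + _)) B).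
apply: eq_bigr => i _; have -> // : widen_ord (leqnSn n) i = lift ord_max i.
by apply/val_inj; rewrite /= /bump leqNgt ltn_ord.
Qed.
End StandardNormals.

Section IntegralDerivative.
Context {R : realType}.
Local Notation mu := (@lebesgue_measure R).

(** The fundamental theorem of calculus on [-n, n], then dominated convergence. *)
Lemma Rintegral_derive_eq0 (G dG : R -> R) :
  (forall x : R, is_derive x 1 G (dG x)) -> continuous dG ->
  mu.-integrable setT (EFin \o dG) ->
  G n%:R @[n --> \oo] --> 0 -> G (- n%:R) @[n --> \oo] --> 0 ->
  \int[mu]_x dG x = 0.
Proof.
move=> GdG cdG idG Gy GNy.
pose D n := `[- n%:R, n%:R]%classic : set R.
have mdG : measurable_fun setT dG by apply: continuous_measurable_fun.
have ftc n : (0 < n)%N ->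
    (\int[mu]_x ((EFin \o dG) \_ (D n)) x = (G n%:R - G (- n%:R))%:E)%E.
  move=> n0; rewrite -integral_mkcond.
  have nn : - n%:R < n%:R :> R.
    have : 0 < n%:R :> R by rewrite ltr0n.
    lra.
  have cG (x : R) : {for x, continuous G}.
    by apply: differentiable_continuous; apply/derivable1_diffP; apply: ex_derive.
  rewrite /D (continuous_FTC2 (F := G) nn) ?EFinB //.
  - exact: continuous_subspaceT.
  - split; first by move=> x _; apply: ex_derive.
      by apply: cvg_at_right_filter; exact: cG.
    by apply: cvg_at_left_filter; exact: cG.
  - by move=> x _; rewrite derive1E; apply: derive_val.
have mD n : measurable (D n) by exact: measurable_itv.
have mdG' : measurable_fun setT (EFin \o dG) by exact/measurable_EFinP.
have mf n : measurable_fun setT ((EFin \o dG) \_ (D n)).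
  by apply/(measurable_restrictT _ (mD n)); exact: measurable_funTS.
have lim : \forall x \ae mu, setT x ->
    ((EFin \o dG) \_ (D n)) x @[n --> \oo] --> (EFin \o dG) x.
  apply: aeW => x _; apply: cvg_near_cst; near=> n.
  rewrite patchE ifT // inE /D /= in_itv /= -ler_norml ltW //.
  near: n; exact: nbhs_infty_gtr.
have bound : \forall x \ae mu, forall n, setT x ->
    (`|((EFin \o dG) \_ (D n)) x| <= (abse \o (EFin \o dG)) x)%E.
  by apply: aeW => x n _; rewrite patchE; case: ifP => _ //=; rewrite normr0 lee_fin.
have [_ _ h] := @dominated_convergence _ _ _ mu setT measurableT
  (fun n => (EFin \o dG) \_ (D n)) _ _ mf mdG' lim (integrable_abse idG) bound.
have h0 : (\int[mu]_x ((EFin \o dG) \_ (D n)) x)%E @[n --> \oo] --> (0 : R)%:E.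
  rewrite -[X in X%:E](subrr 0).
  apply: (@cvg_trans _ ((G n%:R - G (- n%:R))%:E @[n --> \oo])).
    apply: near_eq_cvg; near=> n; rewrite ftc //.
    by near: n; exact: nbhs_infty_gt.
  by apply: cvg_EFin; [exact: nearW|exact: cvgB].
by rewrite /Rintegral (cvg_unique _ h h0).
Unshelve. all: by end_near.
Qed.
End IntegralDerivative.

(** * Stein's identity for the normal density *)

Section NormalMoments.
Context {R : realType}.
Local Notation mu := (@lebesgue_measure R).
Variable s : R.
Hypothesis s0 : 0 < s.
Local Notation p := (normal_pdf 0 s).

(** The ratio of the densities of deviations s and 2 s is 2 exp (-y) with y = 3 x^2 / (8 s^2), and
    both exp (-y) and y exp (-y) are at most 1. Integrability under quadratic growth thus reduces to
    that of a density. *)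
Lemma normal_pdf_sqr_le (x : R) :
  (1 + x ^+ 2) * p x <= 2 * (1 + 8 * s ^+ 2 / 3) * normal_pdf 0 (2 * s) x.
Proof.
have s20 : 0 < 2 * s by rewrite mulr_gt0.
rewrite !normal_pdfE ?gt_eqF // !normal_peakE // /normal_fun !subr0.
set k := Num.sqrt _; have k0 : 0 < k by rewrite sqrtr_gt0 mulrn_wgt0 // pi_gt0.
pose y := 3 * x ^+ 2 / (8 * s ^+ 2).
have s2 : 0 < s ^+ 2 by rewrite exprn_gt0.
have y0 : 0 <= y by rewrite divr_ge0 // mulr_ge0 ?sqr_ge0 // ltW.
have -> : expR (- x ^+ 2 / (s ^+ 2 *+ 2)) =
    expR (- x ^+ 2 / ((2 * s) ^+ 2 *+ 2)) * expR (- y).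
  by rewrite -expRD /y; congr expR; field; rewrite gt_eqF.
have -> : 2 * (1 + 8 * s ^+ 2 / 3) * ((2 * s * k)^-1 * expR (- x ^+ 2 / ((2 * s) ^+ 2 *+ 2)))
   = (s * k)^-1 * expR (- x ^+ 2 / ((2 * s) ^+ 2 *+ 2)) * (1 + 8 * s ^+ 2 / 3).
  by field; rewrite !gt_eqF.
rewrite mulrC -!mulrA ler_pM2l ?invr_gt0 ?mulr_gt0 // ler_pM2l ?expR_gt0 //.
have -> : x ^+ 2 = 8 * s ^+ 2 / 3 * y by rewrite /y; field; lra.
have e1 : expR (- y) <= 1 by rewrite expR_le1 oppr_le0.
have e2 : y * expR (- y) <= 1.
  rewrite expRN -ler_pdivlMr ?invr_gt0 ?expR_gt0 // invrK mul1r.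
  by have := expR_ge1Dx y; lra.
have : 0 <= 8 * s ^+ 2 / 3 by rewrite divr_ge0 // mulr_ge0 // ltW.
have := expR_ge0 (- y); nra.
Qed.

Lemma integrable_normal_growth (f : R -> R) (C : R) : measurable_fun setT f ->
  (forall x, `|f x| <= C * (1 + x ^+ 2)) ->
  mu.-integrable setT (fun x => (f x * p x)%:E).
Proof.
move=> mf fC; set K := 2 * (1 + 8 * s ^+ 2 / 3).
have C0 : 0 <= C.
  by have := fC 0; rewrite expr0n addr0 mulr1; apply: le_trans.
apply: (@le_integrable _ _ _ mu setT measurableT _
  (fun x => ((C * K)%:E * (normal_pdf 0 (2 * s) x)%:E)%E)).
- apply/measurable_EFinP; apply: measurable_funM => //.
  exact: measurable_normal_pdf.
- move=> x _ /=; rewrite lee_fin normrM (ger0_norm (normal_pdf_ge0 _ _ _)).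
  apply: le_trans (ler_wpM2r (normal_pdf_ge0 _ _ _) (fC x)) _.
  rewrite -[leLHS]mulrA; apply: le_trans (ler_norm _); rewrite -[leRHS]mulrA.
  exact: (ler_wpM2l C0 (normal_pdf_sqr_le x)).
- by apply: integrableZl => //; exact: integrable_normal_pdf.
Qed.

Lemma is_derive_normal_pdf (x : R) : is_derive x 1 p (- (x / s ^+ 2) * p x).
Proof.
rewrite normal_pdfE ?gt_eqF //.
pose c := - (2 * s ^+ 2)^-1.
have d0 : is_derive x 1 (fun x : R => c * x ^+ 2) (- (x / s ^+ 2)).
  by apply: is_derive_eq; rewrite /GRing.scale /= /c; field; rewrite gt_eqF.
have nE : normal_fun 0 s = expR \o (fun x => c * x ^+ 2).
  by apply/funext => y; rewrite /normal_fun /c /= subr0; congr expR; field; rewrite gt_eqF.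
have d1 : is_derive x 1 (normal_fun 0 s) (normal_fun 0 s x * - (x / s ^+ 2)).
  by rewrite nE; exact: (is_derive1_comp (is_derive_expR _) d0).
have d2 := is_deriveZ (normal_peak s) d1.
by apply: is_derive_eq d2 _; rewrite /GRing.scale /=; ring.
Qed.

(** Integration by parts: [dG] is the derivative of the product of [f] and the density, which
    vanishes at infinity. *)
Lemma normal_stein (f f' : R -> R) (C : R) :
  (forall x : R, is_derive x 1 f (f' x)) -> continuous f' ->
  (forall x, `|f x| <= C * (1 + `|x|)) -> (forall x, `|f' x| <= C) ->
  \int[mu]_x (x * f x * p x) = s ^+ 2 * \int[mu]_x (f' x * p x).
Proof.
move=> df cf' fC f'C.
have C0 : 0 <= C by apply: le_trans (f'C 0).
have s2 : 0 < s ^+ 2 by rewrite exprn_gt0.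
have cf : continuous f.
  by move=> x; apply: differentiable_continuous; apply/derivable1_diffP; apply: ex_derive.
have mf := continuous_measurable_fun cf.
have mf' := continuous_measurable_fun cf'.
have xx (x : R) : `|x| * (1 + `|x|) <= 2 * (1 + x ^+ 2).
  by rewrite -(real_normK (num_real x)); have := sqr_ge0 (`|x| - 1); nra.
have x1 (x : R) : 1 + `|x| <= 2 * (1 + x ^+ 2).
  by rewrite -(real_normK (num_real x)); have := sqr_ge0 (`|x| - 1); have := sqr_ge0 `|x|; nra.
have i1 : mu.-integrable setT (fun x => (x * f x * p x)%:E).
  apply: (integrable_normal_growth (C := 2 * C)); first exact: measurable_funM.
  move=> x; rewrite normrM; apply: le_trans (ler_wpM2l (normr_ge0 _) (fC x)) _.
  by have := ler_wpM2l C0 (xx x); lra.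
have i2 : mu.-integrable setT (fun x => (f' x * p x)%:E).
  apply: (integrable_normal_growth (C := C)) => // x; apply: le_trans (f'C x) _.
  by rewrite ler_peMr // lerDl sqr_ge0.
pose dG x := f' x * p x - (s ^+ 2)^-1 * (x * f x * p x).
have cp : continuous p by apply: continuous_normal_pdf; rewrite gt_eqF.
have idG : mu.-integrable setT (EFin \o dG).
  have := integrableB measurableT i2 (integrableZl measurableT (s ^+ 2)^-1 i1).
  by apply: eq_integrable => // x _.
have s20 : 0 < 2 * s by rewrite mulr_gt0.
(* Since n <= n^2, the density of deviation 2 s at n or -n is at most a constant times r^n. *)
pose r := expR (- (8 * s ^+ 2)^-1).
have r01 : `|r| < 1.
  by rewrite ger0_norm ?expR_ge0 // expR_lt1 oppr_lt0 invr_gt0 mulr_gt0.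
pose M := 2 * C * (2 * (1 + 8 * s ^+ 2 / 3) * normal_peak (2 * s)).
have decay (y : nat -> R) : (forall n, `|y n| = n%:R) ->
    f (y n) * p (y n) @[n --> \oo] --> 0.
  move=> yn; apply: norm_cvg0.
  have hM : M * r ^+ n @[n --> \oo] --> 0.
    by rewrite -(mulr0 M); apply: cvgM; [exact: cvg_cst|exact: cvg_expr].
  apply: (squeeze_cvgr _ (@cvg_cst _ 0 _ _ _) hM).
  apply: nearW => n; rewrite /= normr_ge0 /= normrM (ger0_norm (normal_pdf_ge0 _ _ _)).
  have h1 : C * (1 + `|y n|) * p (y n) <= 2 * C * ((1 + y n ^+ 2) * p (y n)).
    have := ler_wpM2l (mulr_ge0 C0 (normal_pdf_ge0 0 s (y n))) (x1 (y n)); lra.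
  apply: le_trans (ler_wpM2r (normal_pdf_ge0 _ _ _) (fC _)) _.
  apply: le_trans h1 _; rewrite /M -[leRHS]mulrA; apply: ler_wpM2l; first by rewrite mulr_ge0.
  apply: le_trans (normal_pdf_sqr_le _) _; rewrite -[leRHS]mulrA; apply: ler_wpM2l.
    by rewrite mulr_ge0 // addr_ge0 // divr_ge0 // mulr_ge0 // ltW.
  rewrite normal_pdfE ?gt_eqF // ler_wpM2l ?normal_peak_ge0 // /r -expRM_natl ler_expR subr0.
  rewrite -(real_normK (num_real (y n))) yn.
  have -> : - n%:R ^+ 2 / ((2 * s) ^+ 2 *+ 2) = n%:R ^+ 2 * - (8 * s ^+ 2)^-1 :> R.
    by field; rewrite gt_eqF.
  rewrite !mulrN lerN2 ler_pM2r ?invr_gt0 ?mulr_gt0 //.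
  by rewrite -natrX ler_nat; case: (n) => // k; rewrite expnS leq_pmulr.
have h : \int[mu]_x dG x = 0.
  apply: (@Rintegral_derive_eq0 _ (fun x => f x * p x)) => //.
  - move=> x; have d := is_derive_normal_pdf x.
    by apply: is_derive_eq; rewrite /GRing.scale /= /dG; field; rewrite gt_eqF.
  - move=> x; apply: cvgB; first by apply: cvgM; [exact: cf'|exact: cp].
    apply: cvgM; first exact: cvg_cst.
    by apply: cvgM; [apply: cvgM; [exact: cvg_id|exact: cf]|exact: cp].
  - by apply: decay => n; rewrite ger0_norm.
  - by apply: decay => n; rewrite normrN ger0_norm.
have e : \int[mu]_x dG x = \int[mu]_x (f' x * p x) - (s ^+ 2)^-1 * \int[mu]_x (x * f x * p x).
  rewrite RintegralB //; last exact: (integrableZl measurableT (s ^+ 2)^-1 i1).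
  by rewrite RintegralZl.
move: h; rewrite e => /eqP; rewrite subr_eq0 => /eqP ->.
by rewrite mulrA divff ?mul1r // gt_eqF.
Qed.

End NormalMoments.

(** * Integrals of functions of a centered normal variable *)

Section NormalLaw.
Context {R : realType}.
Local Notation mu := (@lebesgue_measure R).

Lemma integral_normal_prob (s : R) (f : R -> R) : measurable_fun setT f ->
  (\int[normal_prob 0 s]_x (f x)%:E = \int[mu]_x (f x * normal_pdf 0 s x)%:E)%E.
Proof.
move=> mf; have mfE : measurable_fun setT (EFin \o f) by exact/measurable_EFinP.
have p0 x := normal_pdf_ge0 0 s x.
rewrite [LHS]integralE [RHS]integralE; congr (_ - _)%E.
  rewrite ge0_integral_normal_prob //; last exact: measurable_funepos.
  apply: eq_integral => x _; rewrite !funeposE /= -!EFin_max -EFinM.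
  by rewrite maxr_pMl // mul0r.
rewrite ge0_integral_normal_prob //; last exact: measurable_funeneg.
apply: eq_integral => x _; rewrite !funenegE /= -!EFin_max -EFinM.
by rewrite maxr_pMl // mul0r mulNr.
Qed.

Context d (T : measurableType d) (P : probability T R) (Y : T -> R) (s : R).
Hypothesis mY : measurable_fun setT Y.
Hypothesis s0 : 0 <= s.
Hypothesis lY : forall B, measurable B -> P (Y @^-1` B) = centered_normal_law s B.

Let mY' : measurable_fun setT (Y : T -> measurableTypeR R). Proof. exact: mY. Qed.
Let law := measure_function_pushforward__canonical__measure_function_Measure P mY'.

Let law0 : s = 0%R -> forall f : R -> \bar R,
  (\int[law]_x f x = \int[dirac (0%R : measurableTypeR R)]_x f x)%E.
Proof.
move=> s_eq0 f; apply: eq_measure_integral => A mA _.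
by rewrite /= -[LHS]/(P (Y @^-1` A)) lY // /centered_normal_law s_eq0 eqxx.
Qed.

Let lawN : s != 0 -> forall f : R -> \bar R,
  (\int[law]_x f x = \int[normal_prob 0 s]_x f x)%E.
Proof.
move=> sn0 f; apply: eq_measure_integral => A mA _.
by rewrite /= -[LHS]/(P (Y @^-1` A)) lY // /centered_normal_law (negbTE sn0).
Qed.

Lemma normal_law_integrable (f : R -> R) (C : R) : measurable_fun setT f ->
  (forall x, `|f x| <= C * (1 + x ^+ 2)) ->
  P.-integrable setT (fun w => (f (Y w))%:E).
Proof.
move=> mf fC; apply/integrableP; split.
  by apply/measurable_EFinP; exact: measurableT_comp.
have mabs : measurable_fun setT (fun x => (`|f x|)%:E).
  by apply/measurable_EFinP; exact: measurableT_comp.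
have -> : (\int[P]_w `|(f (Y w))%:E| = \int[law]_x (`|f x|)%:E)%E.
  by rewrite [RHS]ge0_integral_pushforward.
have [s_eq0|sn0] := eqVneq s 0.
  by rewrite law0 // integral_dirac //= ?diracT ?mul1e ltry.
have sp : 0 < s by rewrite lt_neqAle eq_sym sn0.
rewrite lawN // integral_normal_prob; last exact: measurableT_comp.
have h : mu.-integrable setT (fun x => (`|f x| * normal_pdf 0 s x)%:E).
  apply: (integrable_normal_growth sp (C := C)); first exact: measurableT_comp.
  by move=> x; rewrite normr_id.
by rewrite ltey_eq (integrable_fin_num measurableT h).
Qed.

Lemma normal_law_Rintegral (f : R -> R) (C : R) : measurable_fun setT f ->
  (forall x, `|f x| <= C * (1 + x ^+ 2)) ->
  \int[P]_w f (Y w) =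
  if s == 0 then f 0 else \int[mu]_x (f x * normal_pdf 0 s x).
Proof.
move=> mf fC; rewrite /Rintegral.
have mfE : measurable_fun setT (fun x => (f x)%:E) by exact/measurable_EFinP.
have -> : (\int[P]_w (f (Y w))%:E = \int[law]_x (f x)%:E)%E.
  rewrite [RHS]integral_pushforward //.
  by rewrite preimage_setT; exact: normal_law_integrable fC.
have [s_eq0|sn0] := eqVneq s 0.
  by rewrite law0 // integral_dirac // diracT mul1e.
by rewrite lawN // integral_normal_prob.
Qed.

Lemma normal_law_stein (f f' : R -> R) (C : R) :
  (forall x : R, is_derive x 1 f (f' x)) -> continuous f' ->
  (forall x, `|f x| <= C * (1 + `|x|)) -> (forall x, `|f' x| <= C) ->
  \int[P]_w (Y w * f (Y w)) = s ^+ 2 * \int[P]_w f' (Y w).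
Proof.
move=> df cf' fC f'C.
have C0 : 0 <= C by apply: le_trans (f'C 0).
have cf : continuous f.
  by move=> x; apply: differentiable_continuous; apply/derivable1_diffP; apply: ex_derive.
have mf := continuous_measurable_fun cf.
have mf' := continuous_measurable_fun cf'.
rewrite (@normal_law_Rintegral f' C) //; last first.
  by move=> x; apply: le_trans (f'C x) _; rewrite ler_peMr // lerDl sqr_ge0.
rewrite (@normal_law_Rintegral (fun x => x * f x) (2 * C)); last 2 first.
- exact: measurable_funM.
- move=> x; rewrite normrM; apply: le_trans (ler_wpM2l (normr_ge0 _) (fC x)) _.
  have xx : `|x| * (1 + `|x|) <= 2 * (1 + x ^+ 2).
    by rewrite -(real_normK (num_real x)); have := sqr_ge0 (`|x| - 1); nra.
  by have := ler_wpM2l C0 xx; lra.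
have [->|sn0] := eqVneq s 0; first by rewrite expr0n /= !mul0r.
have sp : 0 < s by rewrite lt_neqAle eq_sym sn0.
exact: (normal_stein sp df cf' fC f'C).
Qed.

Lemma normal_law_mean : \int[P]_w Y w = 0.
Proof.
transitivity (\int[P]_w (Y w * cst 1 (Y w))).
  by apply: eq_Rintegral => w _; rewrite /= mulr1.
rewrite (@normal_law_stein (cst 1) (cst 0) 1) //.
- by rewrite Rintegral_cst //= mul0r mulr0.
- by move=> x; exact: cvg_cst.
- by move=> x; rewrite /= normr1 mul1r lerDl.
- by move=> x; rewrite /= normr0.
Qed.

Lemma normal_law_sqr : \int[P]_w (Y w ^+ 2) = s ^+ 2.
Proof.
transitivity (\int[P]_w (Y w * id (Y w))).
  by apply: eq_Rintegral => w _; rewrite /= expr2.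
rewrite (@normal_law_stein id (cst 1) 1) //.
- by rewrite Rintegral_cst //= probability_setT mul1r mulr1.
- by move=> x; exact: cvg_cst.
- by move=> x; rewrite /= mul1r lerDr.
- by move=> x; rewrite /= normr1.
Qed.

(** Stein's identity for sin (u x + phi) gives the same differential equation as for the Gibbs
    means, now without error, so [gaussian_ode] applies with eps = 0. *)
Lemma normal_law_cos (phi : R) :
  \int[P]_w cos (Y w + phi) = expR (- (s ^+ 2 / 2)) * cos phi.
Proof.
have cosC x : `|cos x| <= 1 :> R by rewrite cos_max.
have sinC x : `|sin x| <= 1 :> R by rewrite sin_max.
pose a u := \int[P]_w cos (u * Y w + phi).
pose a' u := \int[P]_w (- (Y w * sin (u * Y w + phi))).
have mlin u : measurable_fun setT (fun x : R => u * x + phi).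
  by apply: measurable_funD => //; exact: measurable_funM.
have int_cos u : P.-integrable setT (fun w => (cos (u * Y w + phi))%:E).
  apply: (@normal_law_integrable (fun x => cos (u * x + phi)) 1).
    by apply: measurableT_comp => //; exact: continuous_measurable_fun (@continuous_cos R).
  by move=> x; rewrite mul1r; apply: le_trans (cosC _) _; rewrite lerDl sqr_ge0.
have int_Y : P.-integrable setT (fun w => (`|Y w|)%:E).
  apply: (@normal_law_integrable (fun x => `|x|) 1); first exact: measurableT_comp.
  move=> x; rewrite normr_id mul1r -(real_normK (num_real x)).
  by have := sqr_ge0 (`|x| - 1); nra.
have dcos (y u : R) : is_derive u 1 (fun u => cos (u * y + phi)) (- (y * sin (u * y + phi))).
  have d2 : is_derive u 1 (fun u => u * y + phi) y.
    by apply: is_derive_eq; rewrite /GRing.scale /=; ring.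
  have d3 := is_derive1_comp (is_derive_cos _) d2.
  by apply: is_derive_eq d3 _; ring.
have d1E (u : R) w : partial1of2 (fun u w => cos (u * Y w + phi)) u w =
    - (Y w * sin (u * Y w + phi)).
  by rewrite partial1of2E; apply: derive_val.
have da (u : R) : is_derive u 1 a (a' u).
  have Iu : `]u - 1, u + 1[%classic u by rewrite /= in_itv /=; apply/andP; split; lra.
  have h1 := @derivable_under_integral _ _ _ P (fun u w => cos (u * Y w + phi))
     setT measurableT u (u - 1) (u + 1) Iu (fun x _ => int_cos x)
     (fun x w _ _ => @ex_derive _ _ _ _ _ _ _ (dcos (Y w) x)) (fun w => `|Y w|)
     (fun w => normr_ge0 _) int_Y.
  have h2 := @differentiation_under_integral _ _ _ P (fun u w => cos (u * Y w + phi))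
     setT measurableT u (u - 1) (u + 1) Iu (fun x _ => int_cos x)
     (fun x w _ _ => @ex_derive _ _ _ _ _ _ _ (dcos (Y w) x)) (fun w => `|Y w|)
     (fun w => normr_ge0 _) int_Y.
  have ub (x : R) w : `]u - 1, u + 1[%classic x -> setT w ->
     `|partial1of2 (fun u w => cos (u * Y w + phi)) x w| <= `|Y w|.
    by move=> _ _; rewrite d1E normrN normrM ler_piMr.
  apply: DeriveDef; first exact: h1.
  rewrite -derive1E h2 // /a'; apply: eq_Rintegral => w _; exact: d1E.
have := @gaussian_ode R a a' (s ^+ 2) 0 (sqr_ge0 s) da.
have -> : a 1 = \int[P]_w cos (Y w + phi).
  by apply: eq_Rintegral => w _; rewrite mul1r.
have -> : a 0 = cos phi.
  rewrite /a; under eq_Rintegral do rewrite mul0r add0r.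
  by rewrite Rintegral_cst //= probability_setT mulr1.
move=> h; apply/eqP; rewrite -subr_eq0 -normr_le0; apply: h => u u01.
have st := @normal_law_stein (fun x => sin (u * x + phi)) (fun x => u * cos (u * x + phi)) 1.
have clin (x : R) : {for x, continuous (fun x : R => u * x + phi)}.
  by apply: cvgD; [apply: cvgM; [exact: cvg_cst|exact: cvg_id]|exact: cvg_cst].
have csin : continuous (fun x => sin (u * x + phi)).
  by move=> x; apply: continuous_comp; [exact: clin|exact: continuous_sin].
have ccos : continuous (fun x => cos (u * x + phi)).
  by move=> x; apply: continuous_comp; [exact: clin|exact: continuous_cos].
have int_sin : P.-integrable setT (fun w => (Y w * sin (u * Y w + phi))%:E).
  apply: (@normal_law_integrable (fun x => x * sin (u * x + phi)) 1).
    by apply: measurable_funM => //; exact: continuous_measurable_fun csin.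
  move=> x; rewrite mul1r normrM -(real_normK (num_real x)).
  have := sqr_ge0 (`|x| - 1); have := ler_wpM2l (normr_ge0 x) (sinC (u * x + phi)); nra.
have a'E : a' u = - \int[P]_w (Y w * sin (u * Y w + phi)).
  rewrite -mulN1r -RintegralZl //; apply: eq_Rintegral => w _; by rewrite mulN1r.
have -> : a' u = - (s ^+ 2 * (u * a u)); last by rewrite normr_le0; apply/eqP; ring.
have dsin (x : R) : is_derive x 1 (fun x => sin (u * x + phi)) (u * cos (u * x + phi)).
  have d2 : is_derive x 1 (fun x => u * x + phi) u.
    by apply: is_derive_eq; rewrite /GRing.scale /=; ring.
  have d3 := is_derive1_comp (is_derive_sin _) d2.
  by apply: is_derive_eq d3 _; ring.
rewrite a'E (st dsin) //.
- by rewrite RintegralZl //; exact: int_cos.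
- by move=> x; apply: cvgM; [exact: cvg_cst|exact: ccos].
- by move=> x; rewrite mul1r; apply: le_trans (sinC _) _; rewrite lerDl.
- move=> x; rewrite normrM; have /andP[u0 u1] := u01.
  by rewrite -[leRHS]mul1r ler_pM // ger0_norm.
Qed.

End NormalLaw.

(** * Factorization of positive semidefinite matrices *)

Section Cholesky.
Context {R : realType}.

Definition psdmx n (A : 'M[R]_n) := forall x : 'cV[R]_n, 0 <= (x^T *m A *m x) 0 0.

(** Induction through the Schur complement [D']. The matrix may be singular: a zero pivot forces the
    rest of its column to be 0, and the convention 0^-1 = 0 then makes the same formulas valid. *)
Lemma cholesky n (A : 'M[R]_n) : A^T = A -> psdmx A ->
  exists L : 'M[R]_n, L *m L^T = A.
Proof.
elim: n A => [|n IH] A Asym Apsd.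
  by exists 0; apply/matrixP => -[].
move: A Asym Apsd; rewrite -[n.+1]/(1 + n)%N => A.
rewrite -[A]submxK; set a := ulsubmx A; set b := dlsubmx A; set D := drsubmx A.
rewrite tr_block_mx => /eq_block_mx[_ _ urE Dsym] Apsd.
have {urE} urE : ursubmx A = b^T by rewrite -urE trmxK.
rewrite urE in Apsd *.
have [a0 aE] : exists a0, a = a0%:M by exists (a 0 0); exact: mx11_scalar.
rewrite aE in Apsd *.
clear urE aE; clearbody a b D; clear a A.
have quadE x0 (y : 'cV[R]_n) :
    a0 * x0 ^+ 2 + 2 * x0 * (b^T *m y) 0 0 + (y^T *m D *m y) 0 0 =
    ((col_mx x0%:M y)^T *m block_mx a0%:M b^T b D *m col_mx x0%:M y) 0 0.
  rewrite tr_col_mx mul_row_block mul_row_col !mulmxDl tr_scalar_mx.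
  have -> : y^T *m b *m x0%:M = (x0 *: (b^T *m y))^T.
    by rewrite mul_mx_scalar linearZ /= trmx_mul trmxK.
  rewrite -!scalar_mxM mul_scalar_mx -scalemxAl.
  by rewrite !mxE /= mulr1n; ring.
have Apsd' x0 (y : 'cV[R]_n) : 0 <= a0 * x0 ^+ 2 + 2 * x0 * (b^T *m y) 0 0 + (y^T *m D *m y) 0 0.
  by rewrite quadE.
have a_ge0 : 0 <= a0.
  by have := Apsd' 1 0; rewrite !mulmx0 !mxE; lra.
have b_eq0 : a0 = 0 -> b = 0.
  move=> a00; suff bb : (b^T *m b) 0 0 = 0.
    have bb' : \sum_i b i 0 ^+ 2 = 0.
      apply: etrans bb; rewrite mxE; apply: eq_bigr => i _.
      by rewrite !mxE expr2.
    apply/matrixP => i j; rewrite ord1 mxE; apply/eqP; rewrite -sqrf_eq0.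
    have := psumr_eq0P (fun i _ => sqr_ge0 (b i 0)) bb' (i := i) isT.
    by move=> ->.
  apply/eqP; apply: contraT => bn.
  (* With a zero pivot the form is affine in [x0]; at this value it equals -1. *)
  have := Apsd' (- ((b^T *m D *m b) 0 0 + 1) / (2 * (b^T *m b) 0 0)) b.
  have -> : 2 * (- ((b^T *m D *m b) 0 0 + 1) / (2 * (b^T *m b) 0 0)) * (b^T *m b) 0 0 =
     - ((b^T *m D *m b) 0 0 + 1) by field.
  by rewrite a00 mul0r; lra.
pose D' := D - a0^-1 *: (b *m b^T).
have [||L' L'E] := IH D'.
- by rewrite /D' linearB linearZ /= trmx_mul trmxK Dsym.
- move=> y; have := Apsd' (- (b^T *m y) 0 0 / a0) y.
  rewrite /D' mulmxBr mulmxBl -scalemxAr -scalemxAl mulmxA.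
  have -> : (y^T *m b *m b^T *m y) = ((b^T *m y) 0 0 ^+ 2)%:M.
    rewrite -mulmxA -[y^T *m b]trmxK trmx_mul trmxK [b^T *m y]mx11_scalar tr_scalar_mx.
    by rewrite -scalar_mxM [_%:M 0 0]mxE /= mulr1n expr2.
  set u := (b^T *m y) 0 0; rewrite !mxE /= mulr1n.
  have [->|an] := eqVneq a0 0; first by rewrite invr0 !mulr0 !mul0r; lra.
  have -> : a0 * (- u / a0) ^+ 2 + 2 * (- u / a0) * u = - (a0^-1 * u ^+ 2) by field.
  by rewrite addrC.
exists (block_mx (Num.sqrt a0)%:M 0 ((Num.sqrt a0)^-1 *: b) L').
rewrite tr_block_mx mulmx_block !trmx0 !mul0mx !mulmx0 !addr0.
rewrite tr_scalar_mx linearZ /= -scalar_mxM -expr2 sqr_sqrtr //.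
have bz : (Num.sqrt a0 * (Num.sqrt a0)^-1) *: b = b.
  have [a00|an] := eqVneq a0 0; first by rewrite (b_eq0 a00) scaler0.
  by rewrite divff ?scale1r // sqrtr_eq0 -ltNge lt_neqAle eq_sym an.
congr block_mx.
- have bzT := congr1 trmx bz; rewrite linearZ /= in bzT.
  by rewrite mul_scalar_mx scalerA bzT.
- by rewrite mul_mx_scalar scalerA bz.
- rewrite L'E /D' -scalemxAl -scalemxAr scalerA -invfM -expr2 sqr_sqrtr //.
  by rewrite addrC subrK.
Qed.
End Cholesky.

Section GaussianVector.
Context {R : realType}.

(** The vector is L g, for a factor L of Sigma and standard normals g. Its linear forms are normal
    with variance [q t], and this yields both the Gaussian property and the cosine integrals, also
    for singular Sigma. *)
Lemma gaussian_vector_exists n (Sigma : 'M[R]_n) :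
  Sigma^T = Sigma -> psdmx Sigma ->
  exists (d : measure_display) (T : measurableType d) (P : probability T R)
    (W : 'I_n -> {RV P >-> R}),
    centered_gaussian W Sigma /\
    forall (t : 'I_n -> R) (phi : R),
      \int[P]_w cos (\sum_i t i * W i w + phi) =
      expR (- ((\sum_i \sum_j t i * Sigma i j * t j) / 2)) * cos phi.
Proof.
move=> Ssym Spsd; have [L LE] := cholesky Ssym Spsd.
have [d [T [P [g [mg lg]]]]] := @iid_standard_normal_exists R n.
pose W0 i w := \sum_j L i j * g j w.
have mW i : measurable_fun setT (W0 i).
  by apply: measurable_sum => j; exact: measurable_funM.
pose W i : {RV P >-> R} := mfun_Sub (mem_set (mW i)).
have WE i w : W i w = W0 i w by [].
exists d, T, P, W.
pose q t := \sum_i \sum_j t i * Sigma i j * t j.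
have qE t : q t = \sum_j (\sum_i t i * L i j) ^+ 2.
  transitivity (\sum_i \sum_k \sum_j (t i * L i j) * (t k * L k j)).
    apply: eq_bigr => i _; apply: eq_bigr => k _; rewrite -LE mxE mulr_sumr mulr_suml.
    by apply: eq_bigr => j _; rewrite mxE; ring.
  under eq_bigr do rewrite exchange_big /=.
  rewrite exchange_big /=; apply: eq_bigr => j _.
  by rewrite expr2 mulr_suml; apply: eq_bigr => i _; rewrite mulr_sumr.
have q0 t : 0 <= q t by rewrite qE; apply: sumr_ge0 => *; exact: sqr_ge0.
have sumE t w : \sum_i t i * W i w = \sum_j (\sum_i t i * L i j) * g j w.
  rewrite /W /=; under eq_bigr do rewrite mulr_sumr.
  rewrite exchange_big /=; apply: eq_bigr => j _; rewrite mulr_suml.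
  by apply: eq_bigr => i _; rewrite mulrA.
have mS t : measurable_fun setT (fun w => \sum_i t i * W i w).
  by apply: measurable_sum => i; exact: measurable_funM.
have lS t B : measurable B ->
    P ((fun w => \sum_i t i * W i w) @^-1` B) = centered_normal_law (Num.sqrt (q t)) B.
  move=> mB; rewrite qE -(lg (fun j => \sum_i t i * L i j)) //.
  have -> // : (fun w => \sum_i t i * W i w) =
    (fun w => \sum_j (\sum_i t i * L i j) * g j w).
  by apply/funext => w; exact: sumE.
have sq t : Num.sqrt (q t) ^+ 2 = q t by rewrite sqr_sqrtr.
split; last first.
  by move=> t phi; rewrite (normal_law_cos (mS t) (sqrtr_ge0 _) (lS t)) sq.
have int1 t : P.-integrable setT (fun w => (\sum_i t i * W i w)%:E).
  apply: (@normal_law_integrable _ _ _ _ _ _ (mS t) (sqrtr_ge0 _) (lS t) id 1) => //.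
  move=> x; rewrite mul1r -(real_normK (num_real x)).
  by have := sqr_ge0 (`|x| - 1); have := normr_ge0 x; nra.
have int2 t : P.-integrable setT (fun w => ((\sum_i t i * W i w) ^+ 2)%:E).
  apply: (@normal_law_integrable _ _ _ _ _ _ (mS t) (sqrtr_ge0 _) (lS t) (fun x => x ^+ 2) 1).
    exact: measurable_funX.
  by move=> x; rewrite mul1r ger0_norm ?sqr_ge0 // lerDr.
have mean t : (\int[P]_w (\sum_i t i * W i w)%:E = 0)%E.
  rewrite -[LHS]fineK ?(integrable_fin_num measurableT (int1 t)) //.
  by rewrite -[fine _]/(Rintegral _ _ _) (normal_law_mean (mS t) (sqrtr_ge0 _) (lS t)).
have sqr t : (\int[P]_w ((\sum_i t i * W i w) ^+ 2)%:E = (q t)%:E)%E.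
  rewrite -[LHS]fineK ?(integrable_fin_num measurableT (int2 t)) //.
  by rewrite -[fine _]/(Rintegral _ _ _) (normal_law_sqr (mS t) (sqrtr_ge0 _) (lS t)) sq.
pose e i := fun k : 'I_n => (k == i)%:R : R.
have We i : (fun w => \sum_k e i k * W k w) = W i.
  apply/funext => w; rewrite (bigD1 i) //= /e eqxx mul1r big1 ?addr0 //.
  by move=> k /negbTE ->; rewrite mul0r.
(* Covariances are obtained by polarization from the variances of W_i, W_j and W_i + W_j. *)
pose e2 i j := fun k : 'I_n => e i k + e j k.
have We2 i j : (fun w => \sum_k e2 i j k * W k w) = (fun w => W i w + W j w).
  apply/funext => w; rewrite -[in RHS](We i) -[in RHS](We j) -big_split /=.
  by apply: eq_bigr => k _; rewrite /e2 mulrDl.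
have meanW i : ('E_P[W i] = 0)%E by rewrite unlock -(We i) mean.
have qe i j : \sum_k \sum_l e i k * Sigma k l * e j l = Sigma i j.
  rewrite (bigD1 i) //= (bigD1 j) //= /e !eqxx mul1r mulr1 !big1 ?addr0 //.
    by move=> k /negbTE ->; apply: big1 => l _; rewrite !mul0r.
  by move=> l /negbTE ->; rewrite mulr0.
have q2 i j : q (e2 i j) = Sigma i i + Sigma j j + 2 * Sigma i j.
  have -> : 2 * Sigma i j = Sigma i j + Sigma j i by rewrite -{3}Ssym mxE; ring.
  rewrite -!qe -!big_split /=; apply: eq_bigr => k _; rewrite -!big_split /=.
  by apply: eq_bigr => l _; rewrite /e2; ring.
have iW i : P.-integrable setT (EFin \o W i) by rewrite -(We i); exact: int1.
have i2 i j : P.-integrable setT (fun w => ((W i w + W j w) ^+ 2)%:E).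
  by have := int2 (e2 i j); under eq_fun do rewrite (congr1 (fun f => f _) (We2 i j)).
have i1 i : P.-integrable setT (fun w => (W i w ^+ 2)%:E).
  by have := int2 (e i); under eq_fun do rewrite (congr1 (fun f => f _) (We i)).
have s2 i j : (\int[P]_w ((W i w + W j w) ^+ 2)%:E = (q (e2 i j))%:E)%E.
  by rewrite -sqr; apply: eq_integral => w _; rewrite (congr1 (fun f => f w) (We2 i j)).
have s1 i : (\int[P]_w (W i w ^+ 2)%:E = (Sigma i i)%:E)%E.
  by rewrite -qe -/(q (e i)) -sqr; apply: eq_integral => w _; rewrite (congr1 (fun f => f w) (We i)).
split=> // [t|i j].
  by exists 0, (Num.sqrt (q t)); split => // B mB; rewrite lS.
have WWE : EFin \o (W i * W j) = (fun w => (2^-1)%:E *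
    (((W i w + W j w) ^+ 2)%:E - (W i w ^+ 2)%:E - (W j w ^+ 2)%:E))%E.
  by apply/funext => w /=; rewrite -!EFinB -EFinM; congr EFin; rewrite !fctE; field.
have iB := integrableB measurableT (integrableB measurableT (i2 i j) (i1 i)) (i1 j).
have iWW : P.-integrable setT (EFin \o (W i * W j)).
  by rewrite WWE; exact: integrableZl.
rewrite covarianceE ?meanW ?mule0 ?sube0; try exact/Lfun1_integrable.
rewrite unlock -[LHS]/(\int[P]_w (EFin \o (W i * W j)%R) w)%E WWE integralZl //.
rewrite integralB //; last exact: integrableB.
by rewrite integralB // s2 !s1 q2 -!EFinB -EFinM; congr EFin; field.
Qed.
End GaussianVector.

(** * Approximation by trigonometric polynomials *)

Section TrigonometricPolynomials.
Context {R : realType} (n : nat).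

(** The phase makes real cosines sufficient: it covers sines and constants, and the span is closed
    under products. *)
Definition trig_poly (g : 'cV[R]_n -> R) :=
  exists l : seq (R * ('I_n -> R) * R),
    forall x, g x = \sum_(p <- l) p.1.1 * cos (\sum_i p.1.2 i * x i 0 + p.2).

Lemma trig_poly_cos (c : R) (t : 'I_n -> R) (phi : R) :
  trig_poly (fun x => c * cos (\sum_i t i * x i 0 + phi)).
Proof. by exists [:: (c, t, phi)] => x; rewrite big_seq1. Qed.

Lemma trig_poly_cst (c : R) : trig_poly (fun=> c).
Proof.
exists [:: (c, fun=> 0, 0)] => x; rewrite big_seq1 /= addr0 big1 ?cos0 ?mulr1 //.
by move=> i _; rewrite mul0r.
Qed.

Lemma trig_polyD f g : trig_poly f -> trig_poly g -> trig_poly (fun x => f x + g x).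
Proof. by move=> [l fE] [k gE]; exists (l ++ k) => x; rewrite big_cat /= fE gE. Qed.

Lemma trig_poly_sum (I : Type) (r : seq I) (F : I -> 'cV[R]_n -> R) :
  (forall i, trig_poly (F i)) -> trig_poly (fun x => \sum_(i <- r) F i x).
Proof.
move=> h; elim: r => [|i r IH].
  by under eq_fun do rewrite big_nil; exact: trig_poly_cst.
by under eq_fun do rewrite big_cons; exact: trig_polyD.
Qed.

Lemma trig_polyM f g : trig_poly f -> trig_poly g -> trig_poly (fun x => f x * g x).
Proof.
move=> [l fE] [k gE].
under eq_fun do rewrite fE gE mulr_suml.
apply: trig_poly_sum => p; under eq_fun do rewrite mulr_sumr.
apply: trig_poly_sum => q.
have -> : (fun x : 'cV[R]_n => p.1.1 * cos (\sum_i p.1.2 i * x i 0 + p.2) *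
    (q.1.1 * cos (\sum_i q.1.2 i * x i 0 + q.2))) =
  (fun x : 'cV[R]_n =>
   p.1.1 * q.1.1 / 2 * cos (\sum_i (p.1.2 i + q.1.2 i) * x i 0 + (p.2 + q.2)) +
   p.1.1 * q.1.1 / 2 * cos (\sum_i (p.1.2 i - q.1.2 i) * x i 0 + (p.2 - q.2))).
  apply/funext => x.
  under [X in _ = _ * cos (X + _) + _]eq_bigr do rewrite mulrDl.
  under [X in _ = _ + _ * cos (X + _)]eq_bigr do rewrite mulrBl.
  rewrite big_split sumrB /=; set a := \sum_i _; set b := \sum_i _.
  rewrite (_ : a + b + (p.2 + q.2) = (a + p.2) + (b + q.2)); last by ring.
  rewrite (_ : a - b + (p.2 - q.2) = (a + p.2) - (b + q.2)); last by ring.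
  by move: (a + p.2) (b + q.2) => u v; rewrite cosD cosB; field.
by apply: trig_polyD; exact: trig_poly_cos.
Qed.

Lemma trig_poly_prod (I : Type) (r : seq I) (F : I -> 'cV[R]_n -> R) :
  (forall i, trig_poly (F i)) -> trig_poly (fun x => \prod_(i <- r) F i x).
Proof.
move=> h; elim: r => [|i r IH].
  by under eq_fun do rewrite big_nil; exact: trig_poly_cst.
by under eq_fun do rewrite big_cons; exact: trig_polyM.
Qed.

End TrigonometricPolynomials.

(** * Bernstein polynomials in several variables *)

Section Bernstein.
Context {R : realType}.

(* The binomial weight [C(m, j) y^j (1 - y)^(m - j)], given by Pascal's rule. *)
Fixpoint bernstein (m j : nat) (y : R) : R :=
  if m is m'.+1 then
    y * (if j is j'.+1 then bernstein m' j' y else 0) + (1 - y) * bernstein m' j y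
  else (j == 0)%:R.

Lemma bernstein_ge0 m j y : 0 <= y <= 1 -> 0 <= bernstein m j y.
Proof.
move=> /andP[y0 y1]; elim: m j => [|m IH] [|j] //=.
  by rewrite mulr0 add0r mulr_ge0 // subr_ge0.
by rewrite addr_ge0 // mulr_ge0 // subr_ge0.
Qed.

Lemma bernstein_gt m j y : (m < j)%N -> bernstein m j y = 0.
Proof.
elim: m j => [|m IH] [|j] //= mj; rewrite !IH ?mulr0 ?addr0 //.
exact: ltn_trans (ltnSn m) _.
Qed.

Lemma sum_bernsteinS m y (G : nat -> R) :
  \sum_(j < m.+2) bernstein m.+1 j y * G j =
  y * (\sum_(j < m.+1) bernstein m j y * G j.+1)
  + (1 - y) * \sum_(j < m.+1) bernstein m j y * G j.
Proof.
rewrite (eq_bigr (fun j : 'I_m.+2 =>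
  y * ((if nat_of_ord j is j'.+1 then bernstein m j' y else 0) * G j)
  + (1 - y) * (bernstein m j y * G j))); last by move=> j _ /=; ring.
rewrite big_split /= -!mulr_sumr; congr (_ * _ + _ * _).
  by rewrite big_ord_recl /= mul0r add0r.
by rewrite big_ord_recr /= bernstein_gt // mul0r addr0.
Qed.

Lemma sum_bernstein m y : \sum_(j < m.+1) bernstein m j y = 1.
Proof.
under eq_bigr do rewrite -[bernstein _ _ _]mulr1.
elim: m => [|m IH]; first by rewrite big_ord1 /= mulr1.
by rewrite (sum_bernsteinS _ _ (fun=> 1)) IH; ring.
Qed.

(** The free shift [a] closes the induction, since Pascal's rule replaces it by 1 + a. The choice a
    = - m y gives the binomial variance. *)
Lemma bernstein_second_moment m y a :
  \sum_(j < m.+1) bernstein m j y * (j%:R + a) ^+ 2 =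
  m%:R * y * (1 - y) + (m%:R * y + a) ^+ 2.
Proof.
elim: m a => [|m IH] a; first by rewrite big_ord1 /=; ring.
rewrite (sum_bernsteinS _ _ (fun j => (j%:R + a) ^+ 2)) IH.
under eq_bigr do rewrite -natr1 -addrA.
by rewrite IH -natr1; ring.
Qed.

Lemma bernstein_variance_le m y : 0 <= y <= 1 ->
  \sum_(j < m.+2) bernstein m.+1 j y * (y - j%:R / m.+1%:R) ^+ 2 <= m.+1%:R^-1.
Proof.
move=> /andP[y0 y1]; have m0 : 0 < m.+1%:R :> R by rewrite ltr0n.
rewrite (eq_bigr (fun j : 'I_m.+2 =>
  m.+1%:R^-1 ^+ 2 * (bernstein m.+1 j y * (j%:R + - (m.+1%:R * y)) ^+ 2))); last first.
  by move=> j _; field; rewrite gt_eqF.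
rewrite -mulr_sumr bernstein_second_moment subrr expr0n addr0.
rewrite (_ : _ * _ = m.+1%:R^-1 * (y * (1 - y))); last by field; rewrite gt_eqF.
by rewrite ler_piMr ?invr_ge0 ?ler0n //; nra.
Qed.

Lemma bernstein_trig n m j (g : 'cV[R]_n -> R) : trig_poly g ->
  trig_poly (fun x => bernstein m j (g x)).
Proof.
move=> tg; elim: m j => [|m IH] j /=; first exact: trig_poly_cst.
apply: trig_polyD; apply: trig_polyM => //.
  by case: j => [|j] //; exact: trig_poly_cst.
apply: trig_polyD; first exact: trig_poly_cst.
under eq_fun do rewrite -mulN1r; apply: trig_polyM => //; exact: trig_poly_cst.
Qed.

(** The products of weights form a product probability on the grid. With a modulus of the form e + D
    |y - z|^2 the error is averaged directly into binomial variances, without separating near and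
    far nodes. *)
Lemma bernstein_approx n (F : ('I_n -> R) -> R) (e D : R) (m : nat) y : 0 <= D ->
  (forall i, 0 <= y i <= 1) ->
  (forall z, (forall i, 0 <= z i <= 1) ->
     `|F y - F z| <= e + D * \sum_i (y i - z i) ^+ 2) ->
  `|F y - \sum_(j : {ffun 'I_n -> 'I_m.+2})
     F (fun i => (j i)%:R / m.+1%:R) * \prod_i bernstein m.+1 (j i) (y i)|
  <= e + D * (n%:R / m.+1%:R).
Proof.
move=> D0 y01 hF; have m0 : 0 < m.+1%:R :> R by rewrite ltr0n.
pose b i (j : 'I_m.+2) := bernstein m.+1 j (y i).
have b0 i j : 0 <= b i j by exact: bernstein_ge0.
have sumb1 : \sum_(j : {ffun 'I_n -> 'I_m.+2}) \prod_i b i (j i) = 1.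
  rewrite -(bigA_distr_bigA b); apply: big1 => i _; exact: sum_bernstein.
have P0 (j : {ffun 'I_n -> 'I_m.+2}) : 0 <= \prod_i b i (j i).
  by apply: prodr_ge0 => i _; exact: b0.
have FE : F y = \sum_(j : {ffun 'I_n -> 'I_m.+2}) (\prod_i b i (j i)) * F y.
  by rewrite -mulr_suml sumb1 mul1r.
rewrite FE -sumrB.
apply: le_trans (ler_norm_sum _ _ _) _.
apply: (@le_trans _ _ (\sum_(j : {ffun 'I_n -> 'I_m.+2}) \prod_i b i (j i) *
   (e + D * \sum_i (y i - (j i)%:R / m.+1%:R) ^+ 2))).
  apply: ler_sum => j _; rewrite [F _ * _]mulrC -mulrBr normrM ger0_norm //.
  rewrite ler_wpM2l //; apply: hF => i.
  by rewrite divr_ge0 ?ler0n //= ler_pdivrMr // mul1r ler_nat -ltnS.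
rewrite (eq_bigr (fun j : {ffun 'I_n -> 'I_m.+2} => e * \prod_i b i (j i) +
   D * \sum_k \prod_i b i (j i) * (y k - (j k)%:R / m.+1%:R) ^+ 2)); last first.
  by move=> j _; rewrite -mulr_sumr; ring.
rewrite big_split /= -!mulr_sumr sumb1 mulr1 lerD2l ler_wpM2l //.
rewrite exchange_big /=.
have -> : n%:R / m.+1%:R = \sum_(k < n) m.+1%:R^-1 :> R.
  by rewrite sumr_const card_ord -(mulr_natl m.+1%:R^-1).
apply: ler_sum => k _; apply: le_trans (bernstein_variance_le m (y01 k)).
(* Puts the squared deviation on the coordinate [k], so that the sum over the grid still
   factorizes. *)
pose b' i (j : 'I_m.+2) := if i == k then b i j * (y k - j%:R / m.+1%:R) ^+ 2 else b i j.
rewrite (eq_bigr (fun j : {ffun 'I_n -> 'I_m.+2} => \prod_i b' i (j i))).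
  rewrite -(bigA_distr_bigA b') (bigD1 k) //= [X in _ * X]big1 ?mulr1.
    by rewrite /b' eqxx.
  by move=> i /negbTE ik; rewrite /b' ik; exact: sum_bernstein.
move=> j _; rewrite (bigD1 k) //= [in RHS](bigD1 k) //= /b' eqxx mulrAC.
by congr (_ * _); apply: eq_bigr => i /negbTE ->.
Qed.

End Bernstein.

(** Compactness of the cube gives a radius d within which the variation is at most e; beyond it the
    trivial bound 2 B is at most 2 B |y - z|^2 / d^2. *)
Lemma continuous_box_modulus {R : realType} n (g : 'rV[R]_n -> R) (B e : R) :
  continuous g -> (forall x, `|g x| <= B) -> 0 < e ->
  exists2 D, 0 <= D & forall y z : 'rV[R]_n, (forall i, 0 <= y 0 i <= 1) ->
    `|g y - g z| <= e + D * \sum_i (y 0 i - z 0 i) ^+ 2.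
Proof.
move=> gc gB e0.
pose K := [set v : 'rV[R]_n | forall i, `[0%R, 1%R]%classic (v ord0 i)].
have cK : compact K.
  by apply: (@rV_compact R n (fun=> `[0%R, 1%R]%classic)) => i; exact: segment_compact.
pose P (d : R) (y : 'rV[R]_n) :=
  forall z : 'rV[R]_n, (forall i, `|y 0 i - z 0 i| < d) -> `|g y - g z| <= e.
have nc : forall x, K x -> \forall x' \near x & d \near (0:R)^'+, P d x'.
  move=> x _; have /cvgrPdist_lt/(_ (e / 2)) := gc x.
  rewrite divr_gt0// => /(_ isT)/nbhs_ballP[d /= d0 hd].
  have d20 : 0 < d / 2 by rewrite divr_gt0.
  exists (ball x (d / 2), [set t | t < d / 2]) => /=.
    by split; [exact: nbhsx_ballx | exact: nbhs_right_lt].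
  move=> [x' t] /= [bx td] z hz.
  have h1 : `|g x - g x'| < e / 2.
    by apply: hd; apply: le_ball bx; rewrite ler_pdivrMr // ler_pMr // ler1n.
  have h2 : `|g x - g z| < e / 2.
    apply: hd; split=> // i j; rewrite (splitr d); apply: (ball_triangle (y := x' i j)).
      by case: bx => _; exact.
    by rewrite ord1; apply: lt_trans (hz j) td.
  rewrite (_ : g x' - g z = (g x - g z) - (g x - g x')); last by ring.
  by apply: le_trans (ler_normB _ _) _; rewrite (splitr e) lerD // ltW.
have /compact_near_coveringP/(_ _ _ P _ nc) := cK => near0.
have [d [d0 hd]] : exists d, 0 < d /\ K `<=` P d.
  near (0:R)^'+ => d; exists d; split; near: d; first exact: nbhs_right_gt.
  exact: near0.
exists (2 * B / d ^+ 2).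
  by rewrite divr_ge0 ?sqr_ge0 ?mulr_ge0 //; exact: le_trans (normr_ge0 _) (gB 0).
move=> y z y01; have S0 : 0 <= \sum_i (y 0 i - z 0 i) ^+ 2.
  by apply: sumr_ge0 => i _; exact: sqr_ge0.
have B0 : 0 <= B by exact: le_trans (normr_ge0 _) (gB 0).
have [yz|] := pselect (forall i, `|y 0 i - z 0 i| < d).
  apply: le_trans (hd y _ z yz) _; first by move=> i; rewrite /= in_itv /=; exact: y01.
  by rewrite lerDl mulr_ge0 // divr_ge0 ?sqr_ge0 ?mulr_ge0.
move=> /existsNP[i /negP]; rewrite -leNgt => di.
apply: le_trans (ler_normB _ _) _.
apply: (@le_trans _ _ (2 * B)).
  by rewrite mulr_natl mulr2n; apply: lerD.
have dS : d ^+ 2 <= \sum_i (y 0 i - z 0 i) ^+ 2.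
  rewrite (bigD1 i) //= -[X in _ <= X + _]real_normK ?num_real //.
  apply: ler_wpDr; first by apply: sumr_ge0 => ? _; exact: sqr_ge0.
  by rewrite ler_sqr ?nnegrE // ltW.
apply: ler_wpDl; first exact: ltW.
rewrite mulrAC ler_pdivlMr ?exprn_gt0 // ler_wpM2l // mulr_ge0 //.
Unshelve. all: by end_near.
Qed.

Lemma continuous_col {R : realType} (T : topologicalType) n (u : 'I_n -> T -> R) :
  (forall i, continuous (u i)) -> continuous (fun v => \col_i u i v : 'cV[R]_n).
Proof.
move=> uc v; apply/cvg_ballP => e e0; near=> w; split => // i j; rewrite !mxE.
move: (i); near: w; apply: filter_forall => k.
by have /cvg_ballP := uc k v; exact.
Unshelve. all: by end_near.
Qed.

Section Squash.
Context {R : realType}.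

(* [squash M] is a trigonometric polynomial with values in [0, 1] which is
   injective on [-M, M]. *)
Definition squash (M x : R) : R := (1 + sin (x / (2 * M))) / 2.

(** Inverts [squash M] on [-M, M], where x / (2 M) stays within 1/2. The clamping at sin (1/2) keeps
    [asin] strictly inside its domain, so that the inverse extends continuously to the whole
    line. *)
Definition unsquash (M y : R) : R :=
  2 * M * asin (Num.max (- sin 2^-1) (Num.min (sin 2^-1) (2 * y - 1))).

Lemma squash_itv M x : 0 <= squash M x <= 1.
Proof.
rewrite /squash divr_ge0 ?ler_pdivrMr //=.
  by have := sin_le1 (x / (2 * M)); lra.
Qed.

Lemma sin_half_itv : 0 < sin (2^-1 : R) < 1.
Proof.
have h := pihalf_ge1 R.
apply/andP; split; first by rewrite sin_gt0_pihalf //; apply/andP; split; lra.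
rewrite -[ltRHS](sin_pihalf R) ltr_sin; first by lra.
  by rewrite in_itv /=; apply/andP; split; lra.
by rewrite in_itv /=; apply/andP; split; lra.
Qed.

Lemma squashK M x : 0 < M -> `|x| <= M -> unsquash M (squash M x) = x.
Proof.
move=> M0 xM; have h := pihalf_ge1 R.
have M20 : 0 < 2 * M by rewrite mulr_gt0.
have : `|x / (2 * M)| <= 2^-1.
  by rewrite normrM normfV (gtr0_norm M20) ler_pdivrMr //; lra.
rewrite /unsquash /squash; set u := x / (2 * M); rewrite ler_norml => /andP[u1 u2].
have -> : 2 * ((1 + sin u) / 2) - 1 = sin u by field.
have inpi (v : R) : - 2^-1 <= v -> v <= 2^-1 -> v \in `[- (pi / 2), pi / 2].
  by move=> v1 v2; rewrite in_itv /=; apply/andP; split; lra.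
have ler_sin : {in `[- (pi / 2), pi / 2] &, {mono @sin R : v w / v <= w}}.
  by apply: le_mono_in => v w hv hw; rewrite ltr_sin.
have s1 : sin u <= sin 2^-1 by rewrite ler_sin ?inpi //; lra.
have s2 : - sin 2^-1 <= sin u by rewrite -sinN ler_sin ?inpi //; lra.
rewrite min_r // max_r // sinK ?inpi //.
by rewrite mulrC mulfVK // gt_eqF.
Qed.

Lemma continuous_unsquash M : continuous (unsquash M).
Proof.
move=> y; rewrite /unsquash; have /andP[s0 s1] := sin_half_itv.
apply: cvgM; first exact: cvg_cst.
pose g (y : R) := Num.max (- sin 2^-1) (Num.min (sin 2^-1) (2 * y - 1)).
have gc : {for y, continuous g}.
  apply: (@continuous_max R R (fun=> _) (fun y => Num.min _ _)); first exact: cvg_cst.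
  apply: (@continuous_min R R (fun=> _)); first exact: cvg_cst.
  apply: cvgB; last exact: cvg_cst.
  by apply: cvgM; [exact: cvg_cst | exact: cvg_id].
apply: (continuous_comp gc); apply: continuous_asin.
rewrite /g lt_max gt_max; apply/andP; split; first by rewrite ltrN2 s1.
by rewrite gt_min s1 andbT; lra.
Qed.

Lemma trig_poly_squash n (i : 'I_n) M : trig_poly (fun x : 'cV[R]_n => squash M (x i 0)).
Proof.
have -> : (fun x : 'cV[R]_n => squash M (x i 0)) = (fun x : 'cV[R]_n =>
    2^-1 + 2^-1 * cos (\sum_j ((j == i)%:R / (2 * M)) * x j 0 + - (pi / 2))).
  apply/funext => x; rewrite cosBpihalf (bigD1 i) //= eqxx big1 ?addr0.
    by rewrite /squash [_ / _ * x i 0]mulrC mul1r; field.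
  by move=> j /negbTE ->; rewrite !mul0r.
by apply: trig_polyD; [exact: trig_poly_cst | exact: trig_poly_cos].
Qed.

End Squash.

(** On the box, f is [F] composed with the squashed coordinates. The approximant is an average of
    values of [F], hence of f, so it obeys the bound [B] outside the box as well; the tail estimate
    depends on this. *)
Lemma trig_approx {R : realType} n (f : 'cV[R]_n -> R) (B M e : R) :
  continuous f -> (forall x, `|f x| <= B) -> 0 < M -> 0 < e ->
  exists T : 'cV[R]_n -> R, [/\ trig_poly T, forall x, `|T x| <= B
    & forall x : 'cV[R]_n, (forall i, `|x i 0| <= M) -> `|f x - T x| <= e].
Proof.
move=> fc fB M0 e0.
pose F (y : 'I_n -> R) := f (\col_i unsquash M (y i)).
have Gc : continuous (fun v : 'rV[R]_n => F (v 0)).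
  move=> v; apply: (@continuous_comp _ _ _ (fun v : 'rV_n => \col_i unsquash M (v 0 i)) f).
    apply: continuous_col => i {}v.
    by apply: (@continuous_comp _ _ _ (fun v : 'rV[R]_n => v 0 i) (unsquash M));
      [exact: coord_continuous | exact: continuous_unsquash].
  exact: fc.
have e20 : 0 < e / 2 by rewrite divr_gt0.
have [D D0 hD] := continuous_box_modulus Gc (fun v => fB _) e20.
have [m hm] : exists m, D * (n%:R / m.+1%:R) <= e / 2.
  exists (Num.truncn (D * n%:R / (e / 2))).
  rewrite mulrA ler_pdivrMr ?ltr0n // [leRHS]mulrC -ler_pdivrMr //.
  exact: ltW (truncnS_gt _).
exists (fun x => \sum_(j : {ffun 'I_n -> 'I_m.+2})
   F (fun i => (j i)%:R / m.+1%:R) *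
     \prod_i bernstein m.+1 (j i) (squash M (x i 0))).
split.
- apply: trig_poly_sum => j; apply: trig_polyM; first exact: trig_poly_cst.
  by apply: trig_poly_prod => i; apply: bernstein_trig; exact: trig_poly_squash.
- move=> x; apply: le_trans (ler_norm_sum _ _ _) _.
  have -> : B = \sum_(j : {ffun 'I_n -> 'I_m.+2})
      B * \prod_i bernstein m.+1 (j i) (squash M (x i 0)).
    rewrite -mulr_sumr.
    rewrite -(bigA_distr_bigA (fun i (j : 'I_m.+2) => bernstein m.+1 j (squash M (x i 0)))).
    by rewrite big1 ?mulr1 // => i _; exact: sum_bernstein.
  apply: ler_sum => j _; rewrite normrM.
  have p0 : 0 <= \prod_i bernstein m.+1 (j i) (squash M (x i 0)).
    by apply: prodr_ge0 => i _; exact: bernstein_ge0 (squash_itv _ _).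
  by rewrite (ger0_norm p0) ler_wpM2r //; exact: fB.
- move=> x xM.
  have -> : f x = F (fun i => squash M (x i 0)).
    by congr f; apply/matrixP => i j; rewrite !mxE ord1 squashK.
  apply: le_trans (bernstein_approx (e := e / 2) m D0 _ _) _.
  + by move=> i; exact: squash_itv.
  + move=> z _.
    have := hD (\row_i squash M (x i 0)) (\row_i z i).
    have rE (u : 'I_n -> R) : (\row_i u i) 0 = u by apply/funext => i; rewrite mxE.
    by rewrite !rE; apply=> i; exact: squash_itv.
  + by rewrite [leRHS](splitr e) lerD2l.
Qed.

(** * Convergence in distribution from cosines and second moments *)

Section CosineCriterion.
Context {R : realType} {d : measure_display} {T : measurableType d}.
Variable P : probability T R.
Context (n : nat) (W : 'I_n -> {RV P >-> R}).

Let Z w : 'cV[R]_n := \col_i W i w.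

Lemma measurable_trig_poly g : trig_poly g -> measurable_fun setT (g \o Z).
Proof.
move=> [l gE].
have -> : g \o Z = fun w => \sum_(p <- l) p.1.1 * cos (\sum_i p.1.2 i * W i w + p.2).
  apply/funext => w; rewrite /= gE; apply: eq_bigr => p _; congr (_ * cos (_ + _)).
  by apply: eq_bigr => i _; rewrite mxE.
apply: measurable_sum => p; apply: measurable_funM => //.
apply: measurableT_comp; first exact: continuous_measurable_fun (@continuous_cos R).
apply: measurable_funD => //; apply: measurable_sum => i; exact: measurable_funM.
Qed.

Lemma bounded_RV_integrable (g : T -> R) (B : R) :
  measurable_fun setT g -> (forall w, `|g w| <= B) -> P.-integrable setT (EFin \o g).
Proof.
move=> mg gB; apply: measurable_bounded_integrable => //.
  exact: le_lt_trans (probability_le1 P measurableT) (ltry 1).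
by exists B; split; [exact: num_real|move=> x Bx w _ /=; exact: le_trans (gB w) (ltW Bx)].
Qed.

Lemma trig_poly_cvg (Om : nat -> finType) (p : forall N, Om N -> R)
    (X : forall N, Om N -> 'cV[R]_n) g :
  (forall t phi, (fun N => \sum_w p N w * cos (\sum_i t i * X N w i 0 + phi)) @ \oo -->
     \int[P]_w cos (\sum_i t i * W i w + phi)) ->
  trig_poly g ->
  (fun N => \sum_w p N w * g (X N w)) @ \oo --> \int[P]_w g (Z w).
Proof.
move=> hcos [l gE].
have -> : \int[P]_w g (Z w) =
    \sum_(a <- l) a.1.1 * \int[P]_w cos (\sum_i a.1.2 i * W i w + a.2).
  have mcos (a : R * ('I_n -> R) * R) :
      measurable_fun setT (fun w => cos (\sum_i a.1.2 i * W i w + a.2)).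
    apply: measurableT_comp; first exact: continuous_measurable_fun (@continuous_cos R).
    by apply: measurable_funD => //; apply: measurable_sum => i; exact: measurable_funM.
  have icos (a : R * ('I_n -> R) * R) :
      P.-integrable setT (EFin \o (fun w => cos (\sum_i a.1.2 i * W i w + a.2))).
    by apply: (@bounded_RV_integrable _ 1) => // w; rewrite cos_max.
  have -> : \int[P]_w g (Z w) =
      \int[P]_w (\sum_(a <- l) a.1.1 * cos (\sum_i a.1.2 i * W i w + a.2)).
    apply: eq_Rintegral => w _; rewrite gE; apply: eq_bigr => a _; congr (_ * cos (_ + _)).
    by apply: eq_bigr => i _; rewrite mxE.
  elim: l {gE} => [|a l IH].
    under eq_Rintegral do rewrite big_nil.
    by rewrite big_nil Rintegral_cst // mul0r.
  rewrite big_cons -IH; under eq_Rintegral do rewrite big_cons.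
  rewrite RintegralD ?RintegralZl //; first exact: (integrableZl measurableT a.1.1 (icos a)).
  apply: (@bounded_RV_integrable _ (\sum_(a <- l) `|a.1.1|)).
    by apply: measurable_sum => b; exact: measurable_funM.
  move=> w; apply: le_trans (ler_norm_sum _ _ _) _; apply: ler_sum => b _.
  by rewrite normrM ler_piMr // cos_max.
have -> : (fun N => \sum_w p N w * g (X N w)) = (fun N => \sum_(a <- l) a.1.1 *
    \sum_w p N w * cos (\sum_i a.1.2 i * X N w i 0 + a.2)).
  apply/funext => N; under eq_bigr do rewrite gE mulr_sumr.
  rewrite exchange_big /=; apply: eq_bigr => a _; rewrite mulr_sumr.
  by apply: eq_bigr => w _; ring.
by apply: cvg_sumr => a; apply: cvgM; [exact: cvg_cst | exact: hcos].
Qed.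

(** A pointwise form of Chebyshev's inequality: outside the box the bound 2 B is dominated by a
    multiple of |x|^2 / M^2. Being valid everywhere, it can be averaged under any law. *)
Lemma approx_tail_le (f h : 'cV[R]_n -> R) (B : R) (M : R) (x : 'cV[R]_n) : 0 < M ->
  (forall x, `|f x| <= B) -> (forall x, `|h x| <= B) ->
  (forall x : 'cV[R]_n, (forall i, `|x i 0| <= M) -> `|f x - h x| <= M^-1) ->
  `|f x - h x| <= M^-1 + 2 * B * (M ^+ 2)^-1 * \sum_i x i 0 ^+ 2.
Proof.
move=> M0 fB hB fh; have B0 : 0 <= B by exact: le_trans (normr_ge0 _) (fB 0).
have S0 : 0 <= \sum_i x i 0 ^+ 2 by apply: sumr_ge0 => i _; exact: sqr_ge0.
have M20 : 0 < M ^+ 2 by exact: exprn_gt0.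
have [xM|] := pselect (forall i, `|x i 0| <= M).
  apply: le_trans (fh x xM) _; rewrite lerDl mulr_ge0 //.
  by rewrite !mulr_ge0 // invr_ge0 ltW.
move=> /existsNP[i /negP]; rewrite -ltNge => Mi.
apply: le_trans (ler_normB _ _) _; apply: (@le_trans _ _ (2 * B)).
  by rewrite mulr_natl mulr2n; apply: lerD.
apply: ler_wpDl; first by rewrite invr_ge0 ltW.
rewrite -mulrA ler_peMr ?mulr_ge0 // mulrC ler_pdivlMr // mul1r.
rewrite (bigD1 i) //= -[X in _ <= X + _]real_normK ?num_real //.
apply: ler_wpDr; first by apply: sumr_ge0 => ? _; exact: sqr_ge0.
by rewrite ler_sqr ?nnegrE // ltW.
Qed.

(** Under [p N] the error of the approximants is controlled by the second moment bound [C],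
    uniformly in N. Under the limit law their bounded pointwise convergence to f is enough, and it
    also provides the measurability of f along [W]. *)
Lemma cvg_in_distribution_of_cos (Om : nat -> finType) (p : forall N, Om N -> R)
    (X : forall N, Om N -> 'cV[R]_n) (C : R) (f : 'cV[R]_n -> R) (B : R) :
  (\forall N \near \oo, [/\ forall w, 0 <= p N w, \sum_w p N w = 1
     & \sum_w p N w * \sum_i X N w i 0 ^+ 2 <= C]) ->
  (forall t phi, (fun N => \sum_w p N w * cos (\sum_i t i * X N w i 0 + phi)) @ \oo -->
     \int[P]_w cos (\sum_i t i * W i w + phi)) ->
  continuous f -> (forall x, `|f x| <= B) ->
  (fun N => \sum_w p N w * f (X N w)) @ \oo --> \int[P]_w f (Z w).
Proof.
move=> hp hcos fc fB; have B0 : 0 <= B by exact: le_trans (normr_ge0 _) (fB 0).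
have m0 m : 0 < m.+1%:R :> R by rewrite ltr0n.
(* One parameter governs both the half-width m + 1 of the box and the precision 1 / (m + 1), so both
   error terms vanish with m. *)
have /choice[h hP] m : exists h : 'cV[R]_n -> R, [/\ trig_poly h, forall x, `|h x| <= B
    & forall x : 'cV[R]_n, (forall i, `|x i 0| <= m.+1%:R) -> `|f x - h x| <= m.+1%:R^-1].
  by apply: trig_approx => //; rewrite invr_gt0.
have ht m : trig_poly (h m) by case: (hP m).
have hB m x : `|h m x| <= B by case: (hP m).
have fh m x : `|f x - h m x| <= m.+1%:R^-1 + 2 * B * (m.+1%:R ^+ 2)^-1 * \sum_i x i 0 ^+ 2.
  by case: (hP m) => _ hB' fh; exact: approx_tail_le.
have cinv : (fun m : nat => m.+1%:R^-1 : R) @ \oo --> (0 : R) by exact: cvg_harmonic.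
have hf x : (fun m => h m x) @ \oo --> f x.
  apply/cvgrPdist_le => e e0.
  pose a (m : nat) : R := m.+1%:R^-1 + 2 * B * (m.+1%:R ^+ 2)^-1 * \sum_i x i 0 ^+ 2.
  have ca : a @ \oo --> (0 + 2 * B * 0 ^+ 2 * \sum_i x i 0 ^+ 2).
    apply: cvgD => //; apply: cvgM; last exact: cvg_cst.
    apply: cvgM; first exact: cvg_cst.
    under eq_fun do rewrite -exprVn.
    by rewrite !expr2; exact: cvgM.
  rewrite expr0n mulr0 mul0r addr0 in ca.
  have /cvgrPdist_le/(_ e e0) := ca; apply: filterS => m.
  rewrite sub0r normrN => am; apply: le_trans (fh m x) _.
  exact: le_trans (ler_norm _) am.
have cE : (fun m => \int[P]_w h m (Z w)) @ \oo --> \int[P]_w f (Z w).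
  have mf : measurable_fun setT (f \o Z).
    apply: (@measurable_fun_cvg _ _ _ _ (fun m => h m \o Z)).
      by move=> m; exact: measurable_trig_poly.
    by move=> w _; exact: hf.
  have := @dominated_cvg _ _ _ P setT measurableT (fun m => EFin \o (h m \o Z))
    (EFin \o (f \o Z)) (cst B%:E) _ _ _ _ _.
  move=> D; apply: fine_cvg; rewrite fineK; last first.
    by apply: integrable_fin_num => //; exact: (@bounded_RV_integrable _ B).
  apply: D => //.
  - by move=> m; apply/measurable_EFinP; exact: measurable_trig_poly.
  - by move=> w _; apply: cvg_EFin; [exact: nearW | exact: hf].
  - by apply: (@bounded_RV_integrable (cst B) B) => // w; rewrite ger0_norm.
  - by move=> m w _; rewrite lee_fin; exact: hB.
apply/cvgrPdist_le => e e0.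
have e3 : 0 < e / 3 by rewrite divr_gt0.
have cb : (fun m : nat => m.+1%:R^-1 + 2 * B * (m.+1%:R ^+ 2)^-1 * C) @ \oo --> (0 : R).
  rewrite [X in _ --> X](_ : _ = 0 + 2 * B * 0 ^+ 2 * C); last by ring.
  apply: cvgD => //; apply: cvgM; last exact: cvg_cst.
  apply: cvgM; first exact: cvg_cst.
  under eq_fun do rewrite -exprVn.
  by rewrite !expr2; exact: cvgM.
have [m [mb mE]] : exists m, m.+1%:R^-1 + 2 * B * (m.+1%:R ^+ 2)^-1 * C <= e / 3 /\
    `|\int[P]_w f (Z w) - \int[P]_w h m (Z w)| <= e / 3.
  near \oo => m; exists m; split; near: m.
    have /cvgrPdist_le/(_ _ e3) := cb; apply: filterS => m.
    by rewrite sub0r normrN; exact: le_trans (ler_norm _).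
  by have /cvgrPdist_le/(_ _ e3) := cE.
have /cvgrPdist_le/(_ _ e3) := trig_poly_cvg hcos (ht m).
apply: filterS2 hp => N [p0 p1 pC] hN.
have hNf : `|\sum_w p N w * h m (X N w) - \sum_w p N w * f (X N w)| <= e / 3.
  rewrite -sumrB; apply: le_trans (ler_norm_sum _ _ _) _; apply: le_trans mb.
  apply: (@le_trans _ _ (\sum_w p N w * (m.+1%:R^-1 +
      2 * B * (m.+1%:R ^+ 2)^-1 * \sum_i X N w i 0 ^+ 2))).
    apply: ler_sum => w _; rewrite -mulrBr normrM ger0_norm // ler_wpM2l //.
    by rewrite distrC.
  under eq_bigr do rewrite mulrDr mulrCA.
  rewrite big_split /= -mulr_suml p1 mul1r -mulr_sumr lerD2l ler_wpM2l //.
  by rewrite !mulr_ge0 // invr_ge0 sqr_ge0.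
rewrite (_ : _ - _ = (\int[P]_w f (Z w) - \int[P]_w h m (Z w)) +
   ((\int[P]_w h m (Z w) - \sum_w p N w * h m (X N w)) +
    (\sum_w p N w * h m (X N w) - \sum_w p N w * f (X N w)))); last by ring.
apply: le_trans (ler_normD _ _) _; rewrite (_ : e = e / 3 + (e / 3 + e / 3)); last by field.
apply: lerD => //; apply: le_trans (ler_normD _ _) _; exact: lerD.
Unshelve. all: by end_near.
Qed.

End CosineCriterion.

(** * The limit covariance *)

Lemma mul_trmx_self {R : realType} n (x : 'cV[R]_n) : (x^T *m x) 0 0 = \sum_i x i 0 ^+ 2.
Proof. by rewrite mxE; apply: eq_bigr => i _; rewrite mxE expr2. Qed.

Lemma unitmx_injective {R : realType} n (M : 'M[R]_n) :
  (forall x : 'cV[R]_n, M *m x = 0 -> x = 0) -> M \in unitmx.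
Proof.
move=> h; rewrite unitmxE unitfE -det_tr; apply/negP => /det0P[v v0 vM].
have : v^T = 0 by apply: h; rewrite -[M]trmxK -trmx_mul vM trmx0.
by move/(congr1 trmx); rewrite trmxK trmx0 => v00; rewrite v00 eqxx in v0.
Qed.

(** * The matrix V (I - K V)^-1 for a multiple V of a projection *)

Section TiltedCovariance.
Context {R : realType} (n : nat) (K V : 'M[R]_n) (p lam : R).
Hypothesis K_sym : K^T = K.
Hypothesis V_sym : V^T = V.
Hypothesis V_idem : V *m V = p *: V.
Hypothesis p_gt0 : 0 < p.
Hypothesis lam_lt : lam < p^-1.
Hypothesis K_le : forall x : 'cV[R]_n, (x^T *m K *m x) 0 0 <= lam * \sum_i x i 0 ^+ 2.

Let M := 1%:M - K *m V.

(** As V = V^2 / p, the form of V M at u is |V u|^2 / p minus the form of K at V u. *)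
Lemma tilted_quad_ge (u : 'cV[R]_n) :
  (p^-1 - lam) * \sum_i (V *m u) i 0 ^+ 2 <= (u^T *m V *m M *m u) 0 0.
Proof.
have h : (u^T *m V *m u) = p^-1 *: ((V *m u)^T *m (V *m u)).
  rewrite trmx_mul V_sym [u^T *m V *m (V *m u)]mulmxA -[u^T *m V *m V]mulmxA V_idem.
  by rewrite -scalemxAr -scalemxAl scalerA mulVf ?gt_eqF // scale1r.
have -> : (u^T *m V *m M *m u) = u^T *m V *m u - (V *m u)^T *m K *m (V *m u).
  by rewrite /M mulmxBr mulmx1 mulmxBl trmx_mul V_sym !mulmxA.
rewrite h [X in _ <= X]mxE [X in _ <= X + _]mxE [X in _ <= _ + X]mxE mul_trmx_self.
by rewrite mulrBl lerD2l lerN2; exact: K_le.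
Qed.

(** If M u = 0, the preceding inequality forces V u = 0, and then M u = u. *)
Lemma tilted_unit : M \in unitmx.
Proof.
apply: unitmx_injective => u Mu.
have := tilted_quad_ge u; rewrite -[_ *m M *m u]mulmxA Mu mulmx0 [leRHS]mxE.
rewrite pmulr_rle0 ?subr_gt0 // => S0.
have Vu : V *m u = 0.
  have /eqP : \sum_i (V *m u) i 0 ^+ 2 = 0.
    by apply/le_anti; rewrite S0 sumr_ge0 // => i _; exact: sqr_ge0.
  rewrite psumr_eq0 => [/allP h|i _]; last exact: sqr_ge0.
  apply/matrixP => i j; rewrite ord1 [RHS]mxE; apply/eqP.
  by rewrite -sqrf_eq0; exact: h (mem_index_enum _).
by rewrite /M mulmxBl mul1mx -mulmxA Vu mulmx0 subr0 in Mu.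
Qed.

(** V M = V - V K V is symmetric, and multiplying by the inverses of M and its transpose carries
    this over. *)
Lemma tilted_sym : (V *m invmx M)^T = V *m invmx M.
Proof.
have Mu := tilted_unit.
have MV : M^T *m V = V *m M.
  by rewrite /M linearB /= trmx1 trmx_mul K_sym V_sym mulmxBl mulmxBr mul1mx mulmx1 mulmxA.
rewrite trmx_mul V_sym trmx_inv.
by rewrite -[LHS](mulmxK Mu) -[_ *m V *m M]mulmxA -MV mulKmx // unitmx_tr.
Qed.

Lemma tilted_psd : psdmx (V *m invmx M).
Proof.
move=> x; have Mu := tilted_unit.
pose u := invmx M *m x; have xE : x = M *m u by rewrite mulKVmx.
have -> : x^T *m (V *m invmx M) *m x = u^T *m V *m M *m u.
  rewrite -tilted_sym trmx_mul V_sym -[RHS]mulmxA -xE /u.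
  by rewrite [(invmx M *m x)^T]trmx_mul !mulmxA.
apply: le_trans (tilted_quad_ge u); rewrite mulr_ge0 //; first by rewrite subr_ge0 ltW.
by apply: sumr_ge0 => i _; exact: sqr_ge0.
Qed.

(** M^-1 - I = K V M^-1. This links the covariance formula of the statement with the form in which
    symmetry and positivity can be read off. *)
Lemma tiltedE : K \in unitmx -> invmx K *m (invmx M - 1%:M) = V *m invmx M.
Proof.
move=> Ku; have Mu := tilted_unit.
have -> : invmx M - 1%:M = K *m V *m invmx M.
  rewrite -(mulmxV Mu) -{1}[invmx M]mul1mx -mulmxBl; congr (_ *m _).
  by rewrite /M opprB addrC subrK.
by rewrite -mulmxA mulKmx.
Qed.

End TiltedCovariance.

Lemma posdefmx_unit {R : realType} n (A : 'M[R]_n) : posdefmx A -> A \in unitmx.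
Proof.
move=> Ap; apply: unitmx_injective => x Ax; apply/eqP/negPn/negP => /Ap.
by rewrite -mulmxA Ax mulmx0 mxE ltxx.
Qed.

Section SpectralNorm.
Context {R : realType} (n : nat).
Implicit Types (M : 'M[R]_n) (x : 'cV[R]_n).

Lemma l2norm_sqr x : l2norm x ^+ 2 = \sum_i x i 0 ^+ 2.
Proof. by rewrite sqr_sqrtr //; apply: sumr_ge0 => i _; exact: sqr_ge0. Qed.

Lemma l2norm_ge0 x : 0 <= l2norm x. Proof. exact: sqrtr_ge0. Qed.

Lemma l2norm_scale a x : 0 <= a -> l2norm (a *: x) = a * l2norm x.
Proof.
move=> a0; rewrite /l2norm; under eq_bigr do rewrite mxE exprMn.
by rewrite -mulr_sumr sqrtrM ?sqr_ge0 // sqrtr_sqr ger0_norm.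
Qed.

(** A supremum is an upper bound only for a set that is bounded above; a multiple of the Frobenius
    norm of [M] provides the bound. *)
Lemma l2norm_mul_le M x : l2norm x <= 1 -> l2norm (M *m x) <= spectral_norm M.
Proof.
move=> x1; apply: (@ub_le_sup R); last by exists x.
pose C := n%:R * \sum_i \sum_j M i j ^+ 2.
exists (Num.sqrt C) => _ [y /= y1 <-]; apply: ler_wsqrtr; rewrite /C mulr_sumr.
apply: ler_sum => i _; rewrite mxE; apply: le_trans (sqr_sum_le _) _.
rewrite card_ord ler_wpM2l ?ler0n //; apply: ler_sum => j _; rewrite exprMn.
rewrite ler_piMr ?sqr_ge0 //; apply: (@le_trans _ _ (l2norm y ^+ 2)).
  rewrite l2norm_sqr (bigD1 j) //= lerDl.
  by apply: sumr_ge0 => k _; exact: sqr_ge0.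
by rewrite expr_le1 // l2norm_ge0.
Qed.

(** After scaling to a unit vector y, the weighted inequality 2 u v <= lam u^2 + v^2 / lam in each
    coordinate replaces Cauchy-Schwarz. *)
Lemma spectral_norm_quad_le M lam x : 0 < lam -> spectral_norm M <= lam ->
  (x^T *m M *m x) 0 0 <= lam * \sum_i x i 0 ^+ 2.
Proof.
move=> lam0 Mlam; have [|xN0] := eqVneq (l2norm x) 0.
  move/(congr1 (fun r => r ^+ 2)); rewrite l2norm_sqr expr0n => /= /eqP.
  rewrite psumr_eq0 => [/allP h|i _]; last exact: sqr_ge0.
  have -> : x = 0.
    apply/matrixP => i j; rewrite ord1 [RHS]mxE; apply/eqP.
    by rewrite -sqrf_eq0; exact: h (mem_index_enum _).
  rewrite mulmx0 mxE mulr_ge0 //; first exact: ltW.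
  by apply: sumr_ge0 => i _; exact: sqr_ge0.
have a0 : 0 < l2norm x by rewrite lt_def xN0 l2norm_ge0.
pose a := l2norm x; pose y : 'cV[R]_n := a^-1 *: x.
have xE : x = a *: y by rewrite /y scalerA mulfV ?scale1r.
have y1 : l2norm y = 1.
  by rewrite /y l2norm_scale ?invr_ge0 ?ltW // mulVf.
have My : l2norm (M *m y) <= lam by apply: le_trans Mlam; rewrite l2norm_mul_le ?y1.
have Sy : \sum_i y i 0 ^+ 2 = 1 by rewrite -l2norm_sqr y1 expr1n.
have SMy : \sum_i (M *m y) i 0 ^+ 2 <= lam ^+ 2.
  by rewrite -l2norm_sqr ler_sqr ?nnegrE ?l2norm_ge0 // ltW.
suff h : (y^T *m M *m y) 0 0 <= lam.
  have -> : \sum_i x i 0 ^+ 2 = a ^+ 2 by rewrite -l2norm_sqr.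
  move: h xE; move: (y) (a) => y' a' h ->.
  rewrite [_^T]linearZ /= -scalemxAr -!scalemxAl scalerA mxE -expr2 mulrC.
  by rewrite ler_wpM2r ?sqr_ge0.
rewrite -mulmxA mxE.
apply: (@le_trans _ _ (\sum_i (lam * y i 0 ^+ 2 + (M *m y) i 0 ^+ 2 / lam) / 2)).
  apply: ler_sum => i _; rewrite [X in X * _]mxE.
  move: (y i 0) ((M *m y) i 0) => u v.
  rewrite ler_pdivlMr // -(ler_pM2r lam0) mulrDl mulfVK ?gt_eqF //.
  by have := sqr_ge0 (lam * u - v); nra.
rewrite -mulr_suml big_split /= -mulr_sumr -mulr_suml Sy mulr1.
rewrite ler_pdivrMr // mulr_natr mulr2n lerD2l ler_pdivrMr //.
Qed.

End SpectralNorm.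

Lemma sum_mxtens {R : nmodType} s q (F : 'I_(s * q) -> R) :
  \sum_i F i = \sum_p F (mxtens_index p).
Proof.
rewrite (reindex (@mxtens_index s q)) //; exists (@mxtens_unindex s q) => i _.
  exact: mxtens_indexK.
exact: mxtens_unindexK.
Qed.

Section Coupling.
Context {R : realType} (s q : nat) (A : 'M[R]_s).
Implicit Type g : 'I_s -> R.

(** The weights [g] are left free: [gamma] gives the limit matrix, and the proportions |S_k| / N
    give the matrix of the finite model. *)
Definition coupling g (i j : 'I_s * 'I_q) : R :=
  Num.sqrt (g i.1) * Num.sqrt (g j.1) * A i.1 j.1 * (i.2 == j.2)%:R.

Lemma coupling_mxE g i j :
  coupling_mx q A g (mxtens_index i) (mxtens_index j) = coupling g i j.
Proof.
case: i => k c; case: j => l c'.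
rewrite /coupling_mx /diag_sqrt mul_diag_mx mul_mx_diag !mxE.
rewrite !mxtens_indexK !eqxx !mulr1n !mulr1 /coupling /=.
ring.
Qed.

Lemma coupling_sym g : A^T = A -> forall i j, coupling g i j = coupling g j i.
Proof.
move=> As i j; rewrite /coupling -{1}As mxE [in RHS]eq_sym.
by rewrite [Num.sqrt (g i.1) * _]mulrC.
Qed.

Lemma quad_coupling g (x : 'I_s * 'I_q -> R) :
  let y c : 'cV[R]_s := \col_k (Num.sqrt (g k) * x (k, c)) in
  quad (coupling g) x = \sum_c ((y c)^T *m A *m y c) 0 0.
Proof.
move=> y; rewrite /quad /matvec sum_pairE exchange_big /=; apply: eq_bigr => c _.
rewrite -mulmxA mxE; apply: eq_bigr => k _; rewrite !mxE sum_pairE.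
rewrite [Num.sqrt _ * x _]mulrC -mulrA; congr (_ * _).
rewrite mulr_sumr; apply: eq_bigr => l _; rewrite !mxE (bigD1 c) //= big1 ?addr0.
  by rewrite /coupling /= eqxx mulr1; ring.
by move=> c1 c1c; rewrite /coupling /= eq_sym (negbTE c1c) mulr0 mul0r.
Qed.

Lemma quad_coupling_ge0 g x : posdefmx A -> 0 <= quad (coupling g) x.
Proof.
move=> Ap; rewrite quad_coupling; apply: sumr_ge0 => c _.
set y := \col_k _; have [->|y0] := eqVneq y 0; first by rewrite mulmx0 mxE.
exact: ltW (Ap _ y0).
Qed.

Lemma coupling_mx_quad g (x : 'cV[R]_(s * q)) :
  (x^T *m coupling_mx q A g *m x) 0 0 = quad (coupling g) (fun p => x (mxtens_index p) 0).
Proof.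
rewrite -mulmxA mxE sum_mxtens; apply: eq_bigr => i _; rewrite !mxE; congr (_ * _).
by rewrite sum_mxtens; apply: eq_bigr => j _; rewrite coupling_mxE.
Qed.

Lemma coupling_mx_posdef g : posdefmx A -> (forall k, 0 < g k) ->
  posdefmx (coupling_mx q A g).
Proof.
move=> Ap g0 x x0; rewrite coupling_mx_quad quad_coupling.
have [[k c] xk] : exists p, x (mxtens_index p) 0 != 0.
  apply/existsP; apply: contraNT x0; rewrite negb_exists => /forallP h; apply/eqP/matrixP => i j.
  rewrite ord1 [RHS]mxE -[i]mxtens_unindexK.
  exact/eqP/negPn/(h (mxtens_unindex i)).
pose y c : 'cV[R]_s := \col_k (Num.sqrt (g k) * x (mxtens_index (k, c)) 0).
have yge c' : 0 <= ((y c')^T *m A *m y c') 0 0.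
  have [->|y0] := eqVneq (y c') 0; first by rewrite mulmx0 mxE.
  exact: ltW (Ap _ y0).
rewrite (bigD1 c) //= ltr_pwDl //; last by apply: sumr_ge0 => c' _; exact: yge.
apply: Ap; apply: contraNN xk => /eqP/matrixP/(_ k 0); rewrite !mxE => /eqP.
by rewrite mulf_eq0 sqrtr_eq0 leNgt g0.
Qed.

(** The covariance of the fluctuations without interaction; the covariance formula of the statement
    contains its opposite. *)
Definition centering_mx : 'M[R]_(s * q) :=
  (1%:M : 'M[R]_s) *t (q%:R^-1 *: 1%:M - (q%:R ^+ 2)^-1 *: const_mx 1 : 'M[R]_q).

Lemma centering_mxE k c l c' :
  centering_mx (mxtens_index (k, c)) (mxtens_index (l, c')) =
  (k == l)%:R * (q%:R^-1 * (c == c')%:R - (q%:R ^+ 2)^-1).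
Proof. by rewrite tensmxE !mxE mulr1. Qed.

Lemma centering_mx_mul (r : 'cV[R]_(s * q)) p : (0 < q)%N ->
  (centering_mx *m r) (mxtens_index p) 0 =
  q%:R^-1 * block_center (fun p => r (mxtens_index p) 0) p.
Proof.
case: p => k c q0; have qN0 : q%:R != 0 :> R by rewrite pnatr_eq0 -lt0n.
rewrite mxE sum_mxtens sum_pairE (bigD1 k) //= [X in _ + X]big1 ?addr0; last first.
  by move=> l lk; apply: big1 => c' _; rewrite centering_mxE eq_sym (negbTE lk) !mul0r.
rewrite /block_center /= (eq_bigr (fun c' : 'I_q =>
    q%:R^-1 * ((c == c')%:R * r (mxtens_index (k, c')) 0)
    - (q%:R ^+ 2)^-1 * r (mxtens_index (k, c')) 0)); last first.
  by move=> c' _; rewrite centering_mxE eqxx mul1r; ring.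
rewrite sumrB -!mulr_sumr (bigD1 c) //= [X in _ * (_ + X)]big1 ?addr0; last first.
  by move=> c' c'c; rewrite eq_sym (negbTE c'c) mul0r.
by rewrite eqxx mul1r; field.
Qed.

Lemma centering_mx_sym : centering_mx^T = centering_mx.
Proof.
rewrite /centering_mx trmx_tens trmx1; congr (_ *t _); rewrite linearB !linearZ /= trmx1.
by rewrite trmx_const.
Qed.

Lemma centering_mx_idem : (0 < q)%N ->
  centering_mx *m centering_mx = q%:R^-1 *: centering_mx.
Proof.
move=> q0; have qN0 : q%:R != 0 :> R by rewrite pnatr_eq0 -lt0n.
pose J : 'M[R]_q := const_mx 1.
have JJ : J *m J = q%:R *: J.
  apply/matrixP => c c'; rewrite !mxE; under eq_bigr do rewrite !mxE mulr1.
  by rewrite sumr_const card_ord mulr1.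
rewrite /centering_mx tensmx_mul mulmx1 -/J.
set B := _ - _; have -> : B *m B = q%:R^-1 *: B.
  rewrite /B mulmxBl !mulmxBr -!scalemxAl -!scalemxAr JJ mulmx1 mul1mx mulmx1 !scalerBr !scalerA.
  apply/matrixP => c c'; rewrite !mxE; field; exact: qN0.
by apply/matrixP => i j; rewrite !mxE mulrCA.
Qed.

(** The all-ones vector lies in the kernel, reflecting that the fluctuations of each block add up to
    0 over the colours. The singularity of the limit covariance is inherited from here. *)
Lemma centering_mx_det : (0 < s)%N -> (0 < q)%N -> \det centering_mx = 0.
Proof.
move=> s0 q0; have sq0 : (0 < s * q)%N by rewrite muln_gt0 s0.
apply/eqP/det0P; exists (const_mx 1).
  by apply/eqP => /matrixP/(_ 0 (Ordinal sq0)); rewrite !mxE => /eqP; rewrite oner_eq0.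
rewrite -[LHS]trmxK trmx_mul centering_mx_sym trmx_const -[RHS]trmxK trmx0; congr (_^T).
apply/matrixP => i j; rewrite ord1 -[i]mxtens_unindexK centering_mx_mul // [RHS]mxE.
rewrite /block_center mxE; under eq_bigr do rewrite mxE.
by rewrite sumr_const card_ord divff ?subrr ?mulr0 // pnatr_eq0 -lt0n.
Qed.

End Coupling.

Section LimitCovariance.
Context {R : realType} (s q : nat) (A : 'M[R]_s) (gamma : 'I_s -> R) (lam : R).
Hypothesis s_gt0 : (0 < s)%N.
Hypothesis q_gt0 : (0 < q)%N.
Hypothesis A_sym : A^T = A.
Hypothesis A_posdef : posdefmx A.
Hypothesis gamma_gt0 : forall k, 0 < gamma k.
Hypothesis lam_gt0 : 0 < lam.
Hypothesis lam_lt : lam < q%:R.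
Hypothesis norm_le : spectral_norm (coupling_mx q A gamma) <= lam.

Let K := coupling_mx q A gamma.
Let V := centering_mx s q : 'M[R]_(s * q).
Let M := 1%:M - K *m V.

Lemma coupling_mx_sym : K^T = K.
Proof.
apply/matrixP => i j; rewrite mxE -[i]mxtens_unindexK -[j]mxtens_unindexK !coupling_mxE.
exact: coupling_sym.
Qed.

Lemma quad_coupling_le (x : 'I_s * 'I_q -> R) : quad (coupling A gamma) x <= lam * sqnorm x.
Proof.
have := spectral_norm_quad_le (\col_i x (mxtens_unindex i)) lam_gt0 norm_le.
rewrite coupling_mx_quad sum_mxtens.
under eq_bigr do rewrite mxE mxtens_indexK.
congr (_ <= _); congr quad; apply/funext => p; by rewrite mxE mxtens_indexK.
Qed.

Let qV_gt0 : 0 < q%:R^-1 :> R. Proof. by rewrite invr_gt0 ltr0n. Qed.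
Let lamV : lam < q%:R^-1^-1. Proof. by rewrite invrK. Qed.
Let V_idem : V *m V = q%:R^-1 *: V := centering_mx_idem s q_gt0.
Let V_sym : V^T = V := centering_mx_sym s q.
Let K_le (x : 'cV[R]_(s * q)) := spectral_norm_quad_le x lam_gt0 norm_le.

Lemma limit_covE : limit_cov q A gamma = V *m invmx M.
Proof.
rewrite -(tiltedE V_sym V_idem qV_gt0 lamV K_le); last first.
  by apply: posdefmx_unit; exact: coupling_mx_posdef.
rewrite /limit_cov; congr (_ *m (invmx _ - _)).
have -> : 1%:M *t ((q%:R ^+ 2)^-1 *: const_mx 1 - q%:R^-1 *: 1%:M) = - V.
  by apply/matrixP => i j; rewrite /V /centering_mx !mxE; ring.
by rewrite mulmxN.
Qed.

Lemma limit_cov_sym : (limit_cov q A gamma)^T = limit_cov q A gamma.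
Proof.
by rewrite limit_covE (tilted_sym coupling_mx_sym V_sym V_idem qV_gt0 lamV K_le).
Qed.

Lemma limit_cov_psd : psdmx (limit_cov q A gamma).
Proof.
by rewrite limit_covE; exact: (tilted_psd coupling_mx_sym V_sym V_idem qV_gt0 lamV K_le).
Qed.

Lemma limit_cov_det : \det (limit_cov q A gamma) = 0.
Proof. by rewrite limit_covE det_mulmx centering_mx_det // mul0r. Qed.

(* For [r] solving [r - K V r = t] the Stein identity in the direction [r] only
   involves the component of the fluctuation along [t]. *)
Lemma limit_cov_solve (t : 'I_(s * q) -> R) : exists r : 'I_s * 'I_q -> R,
  (forall j, r j - q%:R^-1 * \sum_i block_center r i * coupling A gamma i j
    = t (mxtens_index j)) /\
  \sum_i \sum_j t i * limit_cov q A gamma i j * t j =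
    q%:R^-1 * \sum_i block_center r i * t (mxtens_index i).
Proof.
have Mu : M \in unitmx := tilted_unit V_sym V_idem qV_gt0 lamV K_le.
pose tc : 'cV[R]_(s * q) := \col_i t i; pose rc := invmx M *m tc.
pose r p := rc (mxtens_index p) 0.
have VrE p : (V *m rc) (mxtens_index p) 0 = q%:R^-1 * block_center r p.
  exact: centering_mx_mul.
exists r; split.
  move=> j; have : M *m rc = tc by rewrite mulKVmx.
  move/matrixP/(_ (mxtens_index j) 0); rewrite [RHS]mxE => <-.
  rewrite /M mulmxBl mul1mx -mulmxA [RHS]mxE; congr (_ + _).
  rewrite [RHS]mxE [in RHS]mxE sum_mxtens mulr_sumr; congr (- _).
  by apply: eq_bigr => i _; rewrite VrE coupling_mxE coupling_sym //; ring.
transitivity ((tc^T *m (V *m rc)) 0 0).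
  rewrite /rc [V *m _]mulmxA -limit_covE mulmxA.
  rewrite mxE exchange_big /=; apply: eq_bigr => j _; rewrite mxE mulr_suml mxE.
  by apply: eq_bigr => i _; rewrite !mxE.
rewrite mxE sum_mxtens mulr_sumr; apply: eq_bigr => i _.
by rewrite VrE !mxE; ring.
Qed.

End LimitCovariance.

(** * Asymptotics of the block Potts model *)

Lemma block_map_exists s N (S : 'I_s -> {set 'I_N}) : is_block_partition S ->
  exists b : 'I_N -> 'I_s,
    (forall j k, (j \in S k) = (b j == k)) /\ (forall k, (0 < #|S k|)%N).
Proof.
move=> [Sinj /and3P[/eqP covS trS S0]].
have inS j : exists k, j \in S k.
  have : j \in finset.cover [set S k | k in finset.setTfor 'I_s]%SET by rewrite covS inE.
  by move=> /finset.bigcupP[_ /imsetP[k _ ->] jk]; exists k.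
have /choice[b bP] := inS; exists b; split; last first.
  move=> k; rewrite card_gt0; apply: contraNN S0 => /eqP <-.
  by apply/imsetP; exists k.
move=> j k; apply/idP/eqP => [jk|<-//].
apply: Sinj; apply/eqP; apply/negPn/negP => neq.
have /finset.trivIsetP/(_ (S (b j)) (S k) _ _ neq) := trS.
move=> /(_ (imset_f _ _) (imset_f _ _)); rewrite !inE => /(_ isT isT).
by rewrite -setI_eq0 => /eqP/setP/(_ j); rewrite !inE bP jk.
Qed.

(** * The Gibbs measure in terms of the fluctuations *)

Section BlockModel.
Context {R : realType} (s q N : nat) (S : 'I_s -> {set 'I_N}) (A : 'M[R]_s).
Variable b : 'I_N -> 'I_s.
Hypothesis q_gt0 : (0 < q)%N.
Hypothesis bE : forall j k, (j \in S k) = (b j == k).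
Hypothesis S_gt0 : forall k, (0 < #|S k|)%N.

Definition block_scale (k : 'I_s) : R := (Num.sqrt #|S k|%:R)^-1.
Local Notation nu := block_scale.
Local Notation Y := (fluctuation b nu).
Definition fraction (k : 'I_s) : R := #|S k|%:R / N%:R.

Let n_gt0 k : 0 < #|S k|%:R :> R. Proof. by rewrite ltr0n. Qed.
Let sqrt_gt0 k : 0 < Num.sqrt #|S k|%:R :> R. Proof. by rewrite sqrtr_gt0. Qed.
Let sqrtE k : Num.sqrt #|S k|%:R ^+ 2 = #|S k|%:R :> R.
Proof. by rewrite sqr_sqrtr // ltW. Qed.

Lemma block_scale_gt0 k : 0 < nu k. Proof. by rewrite invr_gt0. Qed.

Lemma block_scale_sqr k : (block_size b k)%:R * nu k ^+ 2 = 1.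
Proof.
have -> : block_size b k = #|S k| by apply: eq_card => j; rewrite inE bE.
by rewrite exprVn sqrtE mulfV // gt_eqF.
Qed.

Lemma sum_block (V : nmodType) k (F : 'I_N -> V) :
  \sum_(j in S k) F j = \sum_(j | b j == k) F j.
Proof. by apply: eq_bigl => j; rewrite bE. Qed.

Lemma magnetizationE (w : config q N) p :
  #|S p.1|%:R * magnetization S w (mxtens_index p) 0 =
  Num.sqrt #|S p.1|%:R * Y w p + #|S p.1|%:R / q%:R.
Proof.
case: p => k c /=; rewrite !mxE mxtens_indexK mulrA mulfV ?gt_eqF // mul1r.
rewrite /fluctuation /= mulrA /block_scale mulfV ?gt_eqF // mul1r -sum_block sumrB.
by rewrite sumr_const -(mulr_natl q%:R^-1) subrK.
Qed.

Lemma scaled_magnetizationE (w : config q N) p :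
  scaled_magnetization S w (mxtens_index p) 0 = Y w p.
Proof.
have h := magnetizationE w p; case: p h => k c /= h.
rewrite /scaled_magnetization /diag_sqrt mul_diag_mx mxE [X in X * _]mxE [X in _ * X]mxE.
rewrite /size_mx /lift_mx tensmxE [diag_mx _ _ _]mxE !mxE !eqxx mulr1n mulr1 in h *.
apply: (mulfI (lt0r_neq0 (sqrt_gt0 k))).
rewrite mulrA -expr2 sqrtE mulrBr h; ring.
Qed.

Lemma sum_fluctuation (w : config q N) k : \sum_c Y w (k, c) = 0.
Proof.
rewrite /fluctuation /= -mulr_sumr exchange_big /= big1 ?mulr0 // => j _.
rewrite sumrB (bigD1 (w j)) //= eqxx [X in _ + X - _]big1 ?addr0; last first.
  by move=> c /negbTE; rewrite eq_sym => ->.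
by rewrite sumr_const card_ord -(mulr_natl q%:R^-1) mulfV ?subrr // pnatr_eq0 -lt0n.
Qed.

Hypothesis A_sym : A^T = A.

(* The fluctuations of a block add up to 0 over the colours, which kills the
   terms that are linear in [Y]. *)
Lemma hamiltonianE : exists c : R, forall w : config q N,
  - hamiltonian A S w = quad (coupling A fraction) (Y w) / 2 + c.
Proof.
pose B (i j : 'I_s * 'I_q) : R := A i.1 j.1 * (i.2 == j.2)%:R.
have B_sym i j : B i j = B j i by rewrite /B -{1}A_sym mxE eq_sym.
pose v (p : 'I_s * 'I_q) : R := #|S p.1|%:R / q%:R.
exists ((2 * N%:R)^-1 * quad B v) => w.
pose m : 'cV[R]_(s * q) := magnetization S w.
pose z p : R := #|S p.1|%:R * m (mxtens_index p) 0.
pose u p : R := Num.sqrt #|S p.1|%:R * Y w p.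
have zE p : z p = u p + v p by exact: magnetizationE.
have -> : - hamiltonian A S w = (2 * N%:R)^-1 * quad B z.
  rewrite /hamiltonian mulNr opprK; congr (_ * _).
  have sE (i : 'I_s * 'I_q) (x : 'cV[R]_(s * q)) : (size_mx q S *m x) (mxtens_index i) (0 : 'I_1) =
      #|S i.1|%:R * x (mxtens_index i) 0.
    rewrite mxE sum_mxtens (bigD1 i) //= big1 ?addr0 => [|j ji].
      by case: i => k c; rewrite /size_mx /lift_mx tensmxE !mxE !eqxx mulr1n mulr1.
    case: i j ji => k c [l c']; rewrite /size_mx /lift_mx tensmxE !mxE xpair_eqE.
    rewrite [l == k]eq_sym [c' == c]eq_sym.
    by case: (k == l); case: (c == c'); rewrite ?mulr0n ?mulr0 ?mul0r.
  rewrite -[X in fun_of_matrix X]mulmxA -[X in fun_of_matrix X]mulmxA.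
  have -> : m^T *m size_mx q S = (size_mx q S *m m)^T.
    by rewrite trmx_mul /size_mx /lift_mx trmx_tens tr_diag_mx trmx1.
  rewrite mxE sum_mxtens; apply: eq_bigr => i _; rewrite mxE sE; congr (_ * _).
  rewrite mxE sum_mxtens; apply: eq_bigr => j _; rewrite sE; congr (_ * _).
  by case: i j => k c [l c']; rewrite /lift_mx tensmxE mxE.
have -> : quad B z = quad B u + quad B v.
  have := quadB B_sym v z.
  have -> : quad B u = \sum_i (z i - v i) * matvec B (fun j => z j - v j) i.
    have -> : (fun j => z j - v j) = u by apply/funext => j; rewrite zE addrK.
    by apply: eq_bigr => i _; rewrite zE addrK.
  move=> /eqP; rewrite subr_eq => /eqP ->.
  (* The cross term between the uniform part [v] and the fluctuating part [u] vanishes block by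
     block, because [matvec B v (k, c)] does not depend on the colour [c]. *)
  rewrite [X in X + _ + _](_ : _ = 0) ?add0r //.
  rewrite sum_pairE big1 // => k _.
  have mvE c : matvec B v (k, c) = \sum_l A k l * (#|S l|%:R / q%:R).
    rewrite /matvec sum_pairE; apply: eq_bigr => l _; rewrite (bigD1 c) //= big1 ?addr0.
      by rewrite /B /v /= eqxx mulr1.
    by move=> c' c'c; rewrite /B /= eq_sym (negbTE c'c) mulr0 mul0r.
  rewrite (eq_bigr (fun c =>
      (\sum_l A k l * (#|S l|%:R / q%:R)) * Num.sqrt #|S k|%:R *+ 2 * Y w (k, c))).
    by rewrite -mulr_sumr sum_fluctuation mulr0.
  by move=> c _; rewrite mvE zE addrK /u /= mulrA -mulrnAl.
rewrite mulrDr; congr (_ + _).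
have -> : quad (coupling A fraction) (Y w) = N%:R^-1 * quad B u.
  rewrite /quad mulr_sumr; apply: eq_bigr => i _; rewrite /matvec !mulr_sumr.
  apply: eq_bigr => j _; rewrite /coupling /B /u /fraction !sqrtrM ?ler0n //.
  rewrite [in RHS](_ : N%:R^-1 = Num.sqrt N%:R^-1 ^+ 2); last first.
    by rewrite sqr_sqrtr // invr_ge0 ler0n.
  by move: (Num.sqrt _) (Num.sqrt _) (Num.sqrt _) ((_ == _)%:R) => *; ring.
by rewrite invfM; ring.
Qed.

Lemma gibbs_expectationE (F : config q N -> R) :
  gibbs_expectation A S F = gibbs_mean b nu (coupling A fraction) F.
Proof.
have [c cE] := hamiltonianE.
have wE (w : config q N) : expR (- hamiltonian A S w) =
    expR c * expR (quad (coupling A fraction) (Y w) / 2) by rewrite cE expRD mulrC.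
rewrite /gibbs_expectation /gibbs /gibbs_mean.
under eq_bigr do rewrite wE mulrAC.
rewrite -mulr_suml.
under eq_bigr do rewrite -mulrA.
under [X in _ / X]eq_bigr do rewrite wE.
by rewrite -!mulr_sumr invfM mulrACA mulfV ?mul1r // gt_eqF ?expR_gt0.
Qed.

End BlockModel.

Section QuadPerturbation.
Context {R : realType} (I : finType).

Lemma quad_perturb_le (K K0 : I -> I -> R) x :
  quad K x <= quad K0 x + (\sum_i \sum_j `|K i j - K0 i j|) * sqnorm x.
Proof.
rewrite -lerBlDl /quad -sumrB mulr_suml; apply: ler_sum => i _.
rewrite -mulrBr /matvec -sumrB mulr_sumr mulr_suml; apply: ler_sum => j _.
rewrite -mulrBl; apply: le_trans (ler_norm _) _; rewrite !normrM mulrCA ler_wpM2l //.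
have h k : x k ^+ 2 <= sqnorm x.
  by rewrite /sqnorm (bigD1 k) //= lerDl sumr_ge0 // => l _; exact: sqr_ge0.
have := h i; have := h j; rewrite -(real_normK (num_real (x i))).
rewrite -(real_normK (num_real (x j))) => hj hi.
by have := sqr_ge0 (`|x i| - `|x j|); nra.
Qed.

End QuadPerturbation.

Lemma gibbs_prob {R : realType} s q N (A : 'M[R]_s) (S : 'I_s -> {set 'I_N}) : (0 < q)%N ->
  (forall w : config q N, 0 <= gibbs A S w) /\ \sum_(w : config q N) gibbs A S w = 1.
Proof.
move=> q0; have Z0 : 0 < \sum_(w : config q N) expR (- hamiltonian A S w).
  by rewrite (bigD1 [ffun=> Ordinal q0]) //= ltr_pwDl ?expR_gt0 ?sumr_ge0 // => w _; exact: expR_ge0.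
split=> [w|]; first by rewrite divr_ge0 ?expR_ge0 // ltW.
by rewrite -mulr_suml mulfV // gt_eqF.
Qed.

(** * The limit of large N *)

Section Asymptotics.
Context {R : realType} (s q : nat) (S : forall N, 'I_s -> {set 'I_N}).
Context (A : 'M[R]_s) (gamma : 'I_s -> R) (lam be' be : R).
Hypothesis s_gt0 : (0 < s)%N.
Hypothesis q_ge2 : (2 <= q)%N.
Hypothesis S_partition : forall N, (s <= N)%N -> is_block_partition (S N).
Hypothesis S_cvg :
  forall k, (fun N => #|S N k|%:R / N%:R : R) @ \oo --> gamma k.
Hypothesis A_sym : A^T = A.
Hypothesis A_posdef : posdefmx A.
Hypothesis gamma_gt0 : forall k, 0 < gamma k.
Hypothesis lam_lt : 0 < lam < be'.
Hypothesis be_lt : be' < be.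
Hypothesis be_lt_crit : be < 4 * ((q%:R - 1) / q%:R).
Hypothesis norm_le : spectral_norm (coupling_mx q A gamma) <= lam.

Let K0 : 'I_s * 'I_q -> 'I_s * 'I_q -> R := coupling A gamma.
Let K N : 'I_s * 'I_q -> 'I_s * 'I_q -> R := coupling A (fraction (S N)).
Let ka N := \sum_i \sum_j `|K N i j - K0 i j|.

Let q_gt0 : (0 < q)%N. Proof. exact: ltnW. Qed.

Lemma coupling_dist_cvg : ka @ \oo --> (0 : R).
Proof.
have h i j : (fun N => `|K N i j - K0 i j|) @ \oo --> (0 : R).
  rewrite -[X in _ --> X](normr0 R) -(subrr (K0 i j)).
  apply: cvg_norm; apply: cvgB; last exact: cvg_cst.
  apply: cvgM; last exact: cvg_cst.
  apply: cvgM; last exact: cvg_cst.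
  by apply: cvgM; apply: continuous_cvg; [exact: sqrt_continuous|exact: S_cvg|
     exact: sqrt_continuous|exact: S_cvg].
rewrite [X in _ --> X](_ : _ = \sum_(i : 'I_s * 'I_q) \sum_(j : 'I_s * 'I_q) 0); last first.
  by rewrite big1 // => i _; rewrite big1.
by apply: cvg_sumr => i; apply: cvg_sumr.
Qed.

(** For large N every block has at least gamma_k N / 2 sites, so |S_k|^(-1/2) <= (2 / gamma_k)^(1/2)
    N^(-1/2) <= e N, because c^2 >= 2 / gamma_k. Conversely |S_k| <= N gives e N <= c |S_k|^(-1/2),
    so [c] also plays the role of [L]. *)
Let c := 1 + \sum_k 2 / gamma k.
Let e (N : nat) : R := c / Num.sqrt N%:R.

Let c_ge1 : 1 <= c.
Proof. by rewrite lerDl sumr_ge0 // => k _; rewrite divr_ge0 // ltW. Qed.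

Lemma scale_bound_cvg : e @ \oo --> (0 : R).
Proof.
have c0 : 0 < c by exact: lt_le_trans c_ge1.
apply/cvgrPdist_le => d d0; near=> N.
have N0 : 0 < N%:R :> R by rewrite ltr0n; near: N; exact: nbhs_infty_gt.
rewrite sub0r normrN /e ger0_norm; last by rewrite divr_ge0 ?sqrtr_ge0 // ltW.
rewrite ler_pdivrMr ?sqrtr_gt0 // mulrC -ler_pdivrMr //.
rewrite -[X in X <= _]ger0_norm; last by rewrite divr_ge0 // ltW.
rewrite -sqrtr_sqr ler_wsqrtr //.
by near: N; exact: nbhs_infty_ger.
Unshelve. all: by end_near.
Qed.

Lemma block_scale_near : \forall N \near \oo, forall k,
  @block_scale R s N (S N) k <= e N <= c * block_scale (S N) k.
Proof.
have : \forall N \near \oo, forall k : 'I_s, gamma k / 2 < #|S N k|%:R / N%:R.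
  apply: filter_forall => k; apply: (cvgr_gt (gamma k)); first exact: S_cvg.
  by rewrite ltr_pdivrMr // ltr_pMr // ltr1n.
apply: filterS2 (nbhs_infty_ge 1%N) => N N1 hN k.
have N0 : 0 < N%:R :> R by rewrite ltr0n.
have n0 : 0 < #|S N k|%:R :> R.
  have := hN k; rewrite ltr_pdivlMr //; apply: lt_trans.
  by rewrite mulr_gt0 ?divr_gt0.
rewrite /e /block_scale; apply/andP; split.
  rewrite ler_pdivlMr ?sqrtr_gt0 // mulrC ler_pdivrMr ?sqrtr_gt0 //.
  rewrite -[c]ger0_norm ?(le_trans ler01) // -sqrtr_sqr -sqrtrM ?sqr_ge0 // ler_wsqrtr //.
  have ck : 2 / gamma k <= c ^+ 2.
    apply: (@le_trans _ _ c).
      rewrite /c (bigD1 k) //= addrCA lerDl addr_ge0 // sumr_ge0 // => l _.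
      by rewrite divr_ge0 // ltW.
    by rewrite expr2 ler_peMl // (le_trans ler01).
  apply: (@le_trans _ _ (2 / gamma k * #|S N k|%:R)); last by rewrite ler_wpM2r // ltW.
  have := hN k; rewrite ltr_pdivlMr // => h.
  rewrite mulrAC ler_pdivlMr //; have := gamma_gt0 k; nra.
rewrite ler_wpM2l ?(le_trans ler01) // lef_pV2 ?posrE ?sqrtr_gt0 // ler_wsqrtr //.
by rewrite ler_nat -[X in (_ <= X)%N](card_ord N) max_card.
Qed.

Lemma quad_near : \forall N \near \oo, forall x, quad (K N) x <= be' * sqnorm x.
Proof.
have /andP[lam0 lb] := lam_lt.
have d0 : 0 < be' - lam by rewrite subr_gt0.
have /cvgrPdist_le/(_ _ d0) := coupling_dist_cvg.
apply: filterS => N; rewrite sub0r normrN => h x.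
apply: le_trans (quad_perturb_le _ K0 _) _.
rewrite -[be'](subrK lam) addrC mulrDl lerD //; last exact: quad_coupling_le.
rewrite ler_wpM2r //; first by apply: sumr_ge0 => i _; exact: sqr_ge0.
exact: le_trans (ler_norm _) h.
Qed.

Lemma gibbs_moment_near : \forall N \near \oo,
  gibbs_expectation A (S N)
    (fun w => \sum_i @scaled_magnetization R s q N (S N) w i 0 ^+ 2) <= moment_bound s q be be'.
Proof.
apply: filterS2 (nbhs_infty_ge s) quad_near => N /S_partition/block_map_exists[b [bE n0]] hq.
have /andP[lam0 lb] := lam_lt.
have b0 : 0 < be' < be by rewrite be_lt (lt_trans lam0).
have psd x : 0 <= quad (K N) x by exact: quad_coupling_ge0.
have := gibbs_mean_moment_le q_ge2 (block_scale_sqr bE n0) b0 be_lt_crit psd hq.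
apply: le_trans; rewrite (gibbs_expectationE q_gt0 bE n0 A_sym).
rewrite /gibbs_mean ler_pM2r ?invr_gt0; last exact: sum_weight_gt0.
apply: ler_sum => w _; rewrite ler_pM2l ?expR_gt0 // sum_mxtens.
rewrite /sqnorm; under eq_bigr do rewrite (scaled_magnetizationE bE n0).
by rewrite lerDr.
Qed.

Lemma gibbs_cos_cvg (t : 'I_(s * q) -> R) (phi : R) :
  (fun N => gibbs_expectation A (S N)
     (fun w => cos (\sum_i t i * @scaled_magnetization R s q N (S N) w i 0 + phi))) @ \oo -->
  expR (- ((\sum_i \sum_j t i * limit_cov q A gamma i j * t j) / 2)) * cos phi.
Proof.
have /andP[lam0 lb] := lam_lt.
have b0 : 0 < be' < be by rewrite be_lt (lt_trans lam0).
(* The critical value 4 (q - 1) / q does not exceed q, since (q - 2)^2 >= 0. *)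
have lamq : lam < q%:R.
  apply: (lt_le_trans (lt_trans lb (lt_trans be_lt be_lt_crit))).
  have qR : 0 < q%:R :> R by rewrite ltr0n.
  rewrite mulrA ler_pdivrMr //; have := sqr_ge0 (q%:R - 2 : R); nra.
have [r [rE s2E]] := limit_cov_solve q_gt0 A_sym A_posdef gamma_gt0 lam0 lamq norm_le t.
set s2 := \sum_i \sum_j _ in s2E *.
have s2_ge0 : 0 <= s2.
  have := limit_cov_psd q_gt0 A_sym A_posdef gamma_gt0 lam0 lamq norm_le (\col_i t i).
  congr (0 <= _); rewrite mxE /s2 exchange_big /=; apply: eq_bigr => j _.
  by rewrite !mxE mulr_suml; apply: eq_bigr => i _; rewrite !mxE.
pose kb := 1 + \sum_i \sum_j `|K0 i j|.
pose T := \sum_i `|t (mxtens_index i)|.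
pose rb := \sum_i `|r i|.
have rb0 : 0 <= rb by exact: sumr_ge0.
pose bound N := (2 * rb * s%:R * stein_remainder s q kb c T * e N +
  2 * rb * (s * q)%:R ^+ 2 * ka N) * moment_bound s q be be'.
have bound_cvg : bound @ \oo --> (0 : R).
  rewrite [X in _ --> X](_ : _ = (2 * rb * s%:R * stein_remainder s q kb c T * 0 +
     2 * rb * (s * q)%:R ^+ 2 * 0) * moment_bound s q be be'); last by ring.
  apply: cvgM; last exact: cvg_cst.
  by apply: cvgD; apply: cvgM; [exact: cvg_cst|exact: scale_bound_cvg|exact: cvg_cst|
    exact: coupling_dist_cvg].
have near_bound : \forall N \near \oo,
  `|gibbs_expectation A (S N)
     (fun w => cos (\sum_i t i * @scaled_magnetization R s q N (S N) w i 0 + phi))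
    - expR (- (s2 / 2)) * cos phi| <= bound N.
  have e_near : \forall N \near \oo, e N <= 1.
    have /cvgrPdist_le/(_ _ ltr01) := scale_bound_cvg.
    by apply: filterS => N; rewrite sub0r normrN; exact: le_trans (ler_norm _).
  have ka_near : \forall N \near \oo, ka N <= 1.
    have /cvgrPdist_le/(_ _ ltr01) := coupling_dist_cvg.
    by apply: filterS => N; rewrite sub0r normrN; exact: le_trans (ler_norm _).
  near=> N.
  have sN : (s <= N)%N by near: N; exact: nbhs_infty_ge.
  have [b [bE n0]] := block_map_exists (S_partition sN).
  have psd x : 0 <= quad (K N) x by exact: quad_coupling_ge0.
  have hq : forall x, quad (K N) x <= be' * sqnorm x by near: N; exact: quad_near.
  have ka0 i : 0 <= \sum_j `|K N i j - K0 i j| by exact: sumr_ge0.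
  have hka i j : `|K N i j - K0 i j| <= ka N.
    rewrite /ka (bigD1 i) //= (bigD1 j) //= -addrA lerDl addr_ge0 ?sumr_ge0 //.
  have hK i j : `|K N i j| <= kb.
    rewrite -[K N i j](subrK (K0 i j)); apply: le_trans (ler_normD _ _) _.
    apply: lerD.
      by apply: le_trans (hka i j) _; near: N; exact: ka_near.
    by rewrite (bigD1 i) //= (bigD1 j) //= -addrA lerDl addr_ge0 ?sumr_ge0 // => *;
      exact: sumr_ge0.
  have nu_e : forall k, @block_scale R s N (S N) k <= e N <= c * block_scale (S N) k.
    by near: N; exact: block_scale_near.
  have e1 : 0 < e N <= 1.
    have N0 : 0 < Num.sqrt N%:R :> R by rewrite sqrtr_gt0 ltr0n (leq_trans s_gt0).
    rewrite (divr_gt0 (lt_le_trans ltr01 c_ge1) N0).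
    by near: N; exact: e_near.
  have := @gibbs_mean_cos_le R s q N b (block_scale (S N)) (K N) K0 q_ge2
    (block_scale_sqr bE n0) be be' b0 be_lt_crit psd hq (coupling_sym _ A_sym)
    (block_scale_gt0 n0) kb c (e N) (ka N) _ hK e1 _ _ _ hka
    (fun i => t (mxtens_index i)) r T rb phi s2 _ _ rb0 rE s2_ge0 s2E.
  rewrite (gibbs_expectationE q_gt0 bE n0 A_sym).
  rewrite (_ : (fun w => cos (\sum_i t i * _ + _)) = (fun w : {ffun 'I_N -> 'I_q} =>
      cos (\sum_i t (mxtens_index i) * fluctuation b (block_scale (S N)) w i + phi))).
    apply.
    - by rewrite addr_ge0 // sumr_ge0 // => i _; exact: sumr_ge0.
    - by move=> k; have /andP[] := nu_e k.
    - by move=> k; have /andP[] := nu_e k.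
    - exact: sumr_ge0.
    - by move=> i; rewrite /T (bigD1 i) //= lerDl sumr_ge0.
    - by move=> i; rewrite /rb (bigD1 i) //= lerDl sumr_ge0.
  apply/funext => w; rewrite sum_mxtens; congr (cos (_ + _)); apply: eq_bigr => i _.
  by rewrite (scaled_magnetizationE bE n0).
apply/cvgrPdist_le => d d0.
have /cvgrPdist_le/(_ _ d0) := bound_cvg.
apply: filterS2 near_bound => N h1; rewrite sub0r normrN distrC => h2.
exact: le_trans h1 (le_trans (ler_norm _) h2).
Unshelve. all: by end_near.
Qed.

End Asymptotics.

Theorem theorem2 (R : realType) (s q : nat) (hs : (1 <= s)%N) (hq : (2 <= q)%N)
    (S : forall N : nat, 'I_s -> {set 'I_N})
    (hS : forall N : nat, (s <= N)%N -> is_block_partition (S N))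
    (gamma : 'I_s -> R)
    (hgamma : forall k : 'I_s,
       (fun N : nat => #|S N k|%:R / N%:R : R) @ \oo --> gamma k)
    (A : 'M[R]_s)
    (A_sym : A^T = A)
    (A_posdef : posdefmx A)
    (A_pos : forall j k : 'I_s, 0 < A j k)
    (gamma_pos : forall k : 'I_s, 0 < gamma k)
    (h_norm : spectral_norm (coupling_mx q A gamma) < 4 * ((q%:R - 1) / q%:R)) :
  let Sigma : 'M[R]_(s * q) := limit_cov q A gamma in
  \det Sigma = 0 /\
  exists (d : measure_display) (T : measurableType d) (P : probability T R)
    (W : 'I_(s * q) -> {RV P >-> R}),
    centered_gaussian W Sigma /\
    gibbs_cvg_in_distribution A S
      (fun N : nat => @scaled_magnetization R s q N (S N)) W.
Proof.
move=> Sigma.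
have s0 : (0 < s)%N by [].
have q0 : (0 < q)%N by exact: ltnW.
pose C : R := 4 * ((q%:R - 1) / q%:R).
(* The maximum with 0 spares a proof that the spectral norm is nonnegative. *)
pose l0 := Num.max (spectral_norm (coupling_mx q A gamma)) 0.
have l0C : l0 < C.
  rewrite gt_max h_norm /= /C mulr_gt0 // divr_gt0 ?ltr0n //.
  by rewrite subr_gt0 ltr1n.
have l0_ge : 0 <= l0 by rewrite le_max lexx orbT.
have norm_l0 : spectral_norm (coupling_mx q A gamma) <= l0 by rewrite le_max lexx.
(* The room below [C] is shared: [lam] is a positive bound for the limit matrix, the gap up to [be']
   absorbs K_N - K, the gap up to [be] pays for the factor 1 + |Y|^2, and be < C keeps the
   exponential moment finite. *)
pose lam := l0 + (C - l0) / 4; pose be' := l0 + (C - l0) / 2.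
pose be := l0 + (C - l0) * 3 / 4.
have lam_lt : 0 < lam < be' by rewrite /lam /be'; apply/andP; split; lra.
have be_lt : be' < be by rewrite /be /be'; lra.
have be_crit : be < C by rewrite /be; lra.
have norm_le : spectral_norm (coupling_mx q A gamma) <= lam.
  by apply: le_trans norm_l0 _; rewrite /lam; lra.
have lam0 : 0 < lam by case/andP: lam_lt.
have lamq : lam < q%:R.
  have qR : 0 < q%:R :> R by rewrite ltr0n.
  have [_ h] := andP lam_lt.
  apply: (lt_le_trans (lt_trans h (lt_trans be_lt be_crit))).
  by rewrite /C mulrA ler_pdivrMr //; have := sqr_ge0 (q%:R - 2 : R); nra.
have psd := limit_cov_psd q0 A_sym A_posdef gamma_pos lam0 lamq norm_le.
have sym := limit_cov_sym q0 A_sym A_posdef gamma_pos lam0 lamq norm_le.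
split; first exact: (limit_cov_det s0 q0 A_posdef gamma_pos lam0 lamq norm_le).
have [d [T [P [W [gW cosW]]]]] := gaussian_vector_exists sym psd.
exists d, T, P, W; split=> // f fc [B fB].
have := @cvg_in_distribution_of_cos R d T P _ W (fun N => config q N : finType)
  (fun N w => gibbs A (S N) w) (fun N => @scaled_magnetization R s q N (S N))
  (moment_bound s q be be') f B.
apply=> //.
- have := gibbs_moment_near hq hS hgamma A_sym A_posdef lam_lt be_lt be_crit norm_le.
  apply: filterS => N h; have [g0 g1] := gibbs_prob A (S N) q0.
  by split.
- move=> t phi; rewrite cosW.
  exact: (gibbs_cos_cvg s0 hq hS hgamma A_sym A_posdef gamma_pos lam_lt be_lt be_crit norm_le).
Qed.
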